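(* Let $\mathcal{H}=\mathbb{R}^d$, let $k$ be the Gaussian kernel with parameter $\sigma>0$, and let $Z=\sum_{\ell=1}^\infty\lambda_\ell Z_\ell^2$ with $Z_1,Z_2,\dots$ i.i.d. $N(0,1)$ and $\lambda_\ell$ the eigenvalues of $S_k$. With $V=I_d+2\sigma\Sigma_0$, \begin{align*} E[Z]&=1-|2V-I_d|^{-1/2}\Big\{1+2\sigma\,\mathrm{tr}[(V+2\sigma\Sigma_0)^{-1}\Sigma_0]\\ &\qquad+2\sigma^2\{\mathrm{tr}[(V+2\sigma\Sigma_0)^{-1}\Sigma_0]\}^2+4\sigma^2\,\mathrm{tr}[\{(V+2\sigma\Sigma_0)^{-1}\Sigma_0\}^2]\Big\}. \end{align*}
   Context: The Gaussian kernel on $\mathbb{R}^d$ is $k(\underline{t},\underline{s})=\exp(-\sigma\|\underline{t}-\underline{s}\|^2_{\mathbb{R}^d})$, $\sigma>0$, with reproducing kernel Hilbert space $H(k)$. $\underline{m}_0\in\mathbb{R}^d$ and $\Sigma_0$ is a $d\times d$ covariance matrix (symmetric positive semidefinite). $|\cdot|$ denotes the determinant. The kernel mean embedding of $N(\underline{m},\Sigma)$ is the function $$\mu(N(\underline{m},\Sigma))(\underline{z})=|I_d+2\sigma\Sigma|^{-1/2}\exp\left(-\sigma(\underline{z}-\underline{m})^T(I_d+2\sigma\Sigma)^{-1}(\underline{z}-\underline{m})\right)\in H(k).$$ Put $B(\underline{x})=(\underline{x}-\underline{m}_0)(\underline{x}-\underline{m}_0)^T-\Sigma_0$. For $\underline{x}\in\mathbb{R}^d$,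 $f(\underline{x})\in H(k)$ is $k(\cdot,\underline{x})-\mu(N(\underline{m}_0,\Sigma_0))$ minus the derivative of $(\underline{m},\Sigma)\mapsto\mu(N(\underline{m},\Sigma))$ at $(\underline{m}_0,\Sigma_0)$ applied to $(\underline{x}-\underline{m}_0,B(\underline{x}))$; explicitly, with $V=I_d+2\sigma\Sigma_0$, $$f(\underline{x})(\underline{z})=k(\underline{z},\underline{x})-\mu(N(\underline{m}_0,\Sigma_0))(\underline{z})\Bigl\{1+2\sigma(\underline{z}-\underline{m}_0)^TV^{-1}(\underline{x}-\underline{m}_0)+\sigma\,\mathrm{tr}\left[V^{-1}\{2\sigma(\underline{z}-\underline{m}_0)(\underline{z}-\underline{m}_0)^TV^{-1}-I_d\}B(\underline{x})\right]\Bigr\}.$$ $S_k$ is the integral operator on $L^2(\mathbb{R}^d,N(\underline{m}_0,\Sigma_0))$ with $(S_kg)(\underline{x})=\int\langle f(\underline{x}),f(\underline{y})\rangle_{H(k)}g(\underline{y})\,dN(\underline{m}_0,\Sigma_0)(\underline{y})$; its eigenvalues $\lambda_\ell$ are repeated according to multiplicity, and $$E[Z]=\sum_{\ell}\lambda_\ell=\int_{\mathbb{R}^d}\langle f(\underline{x}),f(\underline{x})\rangle_{H(k)}\,dN(\underline{m}_0,\Sigma_0)(\underline{x}).$$ *)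

(* Defs.v *)
From HB Require Import structures.
From mathcomp Require Import all_boot all_order all_algebra.
From mathcomp Require Import all_classical all_reals all_analysis.
Set Implicit Arguments.
Unset Strict Implicit.
Unset Printing Implicit Defensive.
Import Order.TTheory GRing.Theory Num.Theory.
Import numFieldNormedType.Exports.
Local Open Scope classical_set_scope.
Local Open Scope ring_scope.

Definition cylinders (R : realType) (d : nat) : set (set 'cV[R]_d) :=
  [set A | exists (i : 'I_d) (B : set R),
     measurable B /\ A = [set x : 'cV[R]_d | B (x i 0)]].

(* R^d with its Borel sigma-algebra, generated by the coordinate maps. This is
   convertible to 'cV[R]_d. *)
Definition borel_cV (R : realType) (d : nat) :=
  g_sigma_algebraType (@cylinders R d).

Definition covariance_matrix (R : realType) (d : nat) (S : 'M[R]_d) : Prop :=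
  S^T = S /\ forall v : 'cV[R]_d, 0 <= (v^T *m S *m v) 0 0.

(* The coordinates are independent N(0,1). *)
Definition std_gaussian (R : realType) (d : nat)
    (G : probability (borel_cV R d) R) : Prop :=
  forall B : 'I_d -> set R, (forall i, measurable (B i)) ->
    G [set z : 'cV[R]_d | forall i, B i (z i 0)] =
    (\prod_(i < d) normal_prob (0 : R) 1 (B i))%E.

(* N(m, S) is the law of m + A W with W standard Gaussian and A A^T = S; this
   covers singular S, where there is no density. *)
Definition gaussian (R : realType) (d : nat) (m : 'cV[R]_d) (S : 'M[R]_d)
    (N : probability (borel_cV R d) R) : Prop :=
  exists (A : 'M[R]_d) (G : probability (borel_cV R d) R),
    [/\ A *m A^T = S, std_gaussian G &
      forall E : set (borel_cV R d), measurable E ->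
        N E = G [set z : 'cV[R]_d | E (m + A *m z)]].

(* A reproducing kernel Hilbert space of k (unique, by Moore-Aronszajn). The
   inner product is a total function, meaningful only on [rkhs_space]. *)
Record rkhs (R : realType) (T : Type) (k : T -> T -> R) := Rkhs {
  rkhs_space : set (T -> R);
  rkhs_ip : (T -> R) -> (T -> R) -> R;
  rkhs_space0 : rkhs_space (fun=> 0);
  rkhs_space_lin : forall (a : R) f g, rkhs_space f -> rkhs_space g ->
    rkhs_space (fun x => a * f x + g x);
  rkhs_ipC : forall f g, rkhs_space f -> rkhs_space g ->
    rkhs_ip f g = rkhs_ip g f;
  rkhs_ip_linl : forall (a : R) f g h,
    rkhs_space f -> rkhs_space g -> rkhs_space h ->
    rkhs_ip (fun x => a * f x + g x) h = a * rkhs_ip f h + rkhs_ip g h;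
  rkhs_ip_ge0 : forall f, rkhs_space f -> 0 <= rkhs_ip f f;
  rkhs_ip_eq0 : forall f, rkhs_space f -> rkhs_ip f f = 0 -> f = (fun=> 0);
  rkhs_complete : forall u : nat -> T -> R,
    (forall n, rkhs_space (u n)) ->
    (forall e : R, 0 < e -> exists n0 : nat, forall m n : nat,
       (n0 <= m)%N -> (n0 <= n)%N ->
       rkhs_ip (fun x => u m x - u n x) (fun x => u m x - u n x) < e) ->
    exists2 l : T -> R, rkhs_space l &
      rkhs_ip (fun x => u n x - l x) (fun x => u n x - l x)
        @[n --> \oo] --> (0 : R);
  rkhs_kernel : forall x, rkhs_space (fun z => k z x);
  rkhs_reproducing : forall f x, rkhs_space f ->
    rkhs_ip f (fun z => k z x) = f x
}.

Section GaussianKernel.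
Context {R : realType} {d : nat}.
Implicit Types (sigma : R) (m x z t s : 'cV[R]_d) (S : 'M[R]_d).

Definition gauss_kernel sigma t s : R :=
  expR (- sigma * ((t - s)^T *m (t - s)) 0 0).

Definition Vmx sigma S : 'M[R]_d := 1%:M + (2 * sigma) *: S.

(* The kernel mean embedding of N(m, S). *)
Definition mean_embedding sigma m S z : R :=
  (Num.sqrt (\det (Vmx sigma S)))^-1 *
  expR (- sigma * ((z - m)^T *m invmx (Vmx sigma S) *m (z - m)) 0 0).

Definition Bmx m S x : 'M[R]_d := (x - m) *m (x - m)^T - S.

Definition feature sigma m S x z : R :=
  let Vi := invmx (Vmx sigma S) in
  gauss_kernel sigma z x -
  mean_embedding sigma m S z *
    (1 + 2 * sigma * ((z - m)^T *m Vi *m (x - m)) 0 0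
     + sigma * \tr (Vi *m ((2 * sigma) *: ((z - m) *m (z - m)^T *m Vi) - 1%:M)
                       *m Bmx m S x)).

End GaussianKernel.

(* Acts on representatives of classes in L^2(N), where the integral converges. *)
Definition Sk (R : realType) (d : nat) (sigma : R)
    (H : rkhs (@gauss_kernel R d sigma)) (m : 'cV[R]_d) (S : 'M[R]_d)
    (N : probability (borel_cV R d) R)
    (g : borel_cV R d -> R) (x : borel_cV R d) : R :=
  \int[N]_(y in setT)
    (rkhs_ip H (feature sigma m S x) (feature sigma m S y) * g y).

Section Eigenvalues.
Context {disp : measure_display} {T : measurableType disp} {R : realType}.
Variables (N : probability T R) (A : (T -> R) -> T -> R).

(* The eigenspace of A on L^2(N), by representatives: equalities between
   functions are N-almost everywhere. *)
Definition eigenspace_L2 (mu : R) : set (T -> R) :=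
  [set g | g \in Lfun N 2%:E /\ {ae N, forall x, A g x = mu * g x}].

(* The eigenspace of mu has dimension n. *)
Definition has_multiplicity (mu : R) (n : nat) : Prop :=
  exists phi : 'I_n -> T -> R,
    [/\ forall i, eigenspace_L2 mu (phi i),
        forall c : 'I_n -> R,
          {ae N, forall x, \sum_(i < n) c i * phi i x = 0} ->
          forall i, c i = 0
      & forall g, eigenspace_L2 mu g ->
          exists c : 'I_n -> R,
            {ae N, forall x, g x = \sum_(i < n) c i * phi i x}].

(* The sequence lambda lists every nonzero eigenvalue as many times as its
   multiplicity. Zero entries are unconstrained: they may be eigenvalues or,
   when there are finitely many nonzero eigenvalues, padding. *)
Definition eigenvalue_sequence (lambda : nat -> R) : Prop :=
  forall mu : R, mu != 0 ->
    exists2 n : nat, has_multiplicity mu n & ([set l | lambda l = mu] #= `I_n)%card.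

End Eigenvalues.

Section RandomVariables.
Context {disp : measure_display} {Omega : measurableType disp} {R : realType}.
Variable P : probability Omega R.

Definition mutually_independent (X : nat -> {RV P >-> R}) : Prop :=
  forall (s : seq nat) (B : nat -> set R), uniq s ->
    (forall i, measurable (B i)) ->
    P [set w | forall i, i \in s -> B i (X i w)] =
    (\prod_(i <- s) P (X i @^-1` B i))%E.

Definition iid_std_normal (X : nat -> {RV P >-> R}) : Prop :=
  mutually_independent X /\
  forall (l : nat) (B : set R), measurable B ->
    distribution P (X l) B = normal_prob (0 : R) 1 B.

End RandomVariables.

(* Main.v *)
Require Import Defs.
From HB Require Import structures.
From mathcomp Require Import all_boot all_order all_algebra.
From mathcomp Require Import all_classical all_reals all_analysis.
From mathcomp Require Import measurable_realfun ring lra.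
Set Implicit Arguments.
Unset Strict Implicit.
Unset Printing Implicit Defensive.
Import Order.TTheory GRing.Theory Num.Theory.
Import numFieldNormedType.Exports.
Local Open Scope classical_set_scope.
Local Open Scope ring_scope.

(** Since each [Zl l] has second moment 1 and the eigenvalues are nonnegative,
    monotone convergence gives $E[Z] = \sum_\ell \lambda_\ell$
    ([expectation_weighted_squares]), and the claim splits into a trace formula
    and a Gaussian computation.

    Trace formula: $\sum_\ell \lambda_\ell = \int \|f(x)\|^2 dN(x)$
    ([sum_eigenvalues]). The operator on $L^2(N)$ is traded for the covariance
    form $c(u, w) = \int \langle f(x), u\rangle \langle f(x), w\rangle dN(x)$ on
    the Hilbert space: the map $h \mapsto \langle f(\cdot), h\rangle$ identifies
    the eigenspaces of both for a nonzero eigenvalue, multiplicities included, so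
    that the $\lambda_\ell$ belong to an orthonormal family of eigenvectors of $c$
    that exhausts its nonzero eigenvalues. Bounded sequences have weakly convergent
    subsequences and $c$ is weakly sequentially continuous, hence $c$ vanishes on
    the orthogonal complement of this family; otherwise a maximizer of $c(h, h)$ on
    the unit ball of the complement would be a further eigenvector
    ([cov_top_eigen]). Then $f(x)$ lies in the closed span of the family for almost
    every $x$, and integrating Parseval's identity gives the trace
    ([cov_trace_eigen]). All of this uses a countable total family of vectors,
    which the kernels at rational points provide.

    Gaussian computation. Write $N$ as the law of $m_0 + A w$ with $w$ standard
    Gaussian under $G$ and $A A^T = \Sigma_0$. The mean embedding is the
    $G$-integral of the kernel at $m_0 + A v$, and its derivatives in the mean and
    the covariance are the Hermite coefficients of degree one and two of
    $v \mapsto k(\cdot, m_0 + A v)$. Thus $f(m_0 + A w)$ is the value at $w$ of this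
    function minus its $L^2(G)$ projection on the polynomials of degree at most two
    ([feature_frame]), and, as for any orthogonal projection,
    $\int \|f\|^2 dN = \int k(x, x) dN(x) - \tau = 1 - \tau$, where
    $\tau$ is the trace of the kernel $k(m_0 + A v, m_0 + A w)$ on those polynomials
    ([frame_trace]). With $J = 2\sigma A^T V^{-1} A$, the number $\tau$ is the
    $G$-integral of $|V|^{-1/2} P(v) \exp(- v^T J v / 2)$ for a polynomial $P$ of
    degree four ([integral_feature_sqnorm]).

    Such integrals come from the Laplace transform of a standard Gaussian law with a
    quadratic tilt, computed one coordinate at a time ([gaussian_laplace]), and from
    its derivatives in the linear part of the tilt ([has_moment_step]). They produce
    $|V|^{-1/2} |I_d + J|^{-1/2}$ and the traces of $J (I_d + J)^{-1}$ and of its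
    square. Exchanging the two factors of $J$ turns these into
    $|2 V - I_d|^{-1/2}$ and the traces of the statement
    ([tilt_det_1J], [tilt_trace], [tilt_trace2]). *)

(** * Symmetric positive semidefinite forms and Hilbert spaces *)

Record psd_form (R : realType) (V : lmodType R) (c : V -> V -> R) : Prop := {
  psdC : forall u v, c u v = c v u;
  psd_linl : forall a u v w, c (a *: u + v) w = a * c u w + c v w;
  psd_ge0 : forall u, 0 <= c u u }.

Section PsdForm.
Context {R : realType} {V : lmodType R} {c : V -> V -> R}.
Hypothesis cP : psd_form c.

Lemma psdDl u v w : c (u + v) w = c u w + c v w.
Proof. by rewrite -{1}[u]scale1r (psd_linl cP) mul1r. Qed.

Lemma psd0l w : c 0 w = 0.
Proof. by apply: (addrI (c 0 w)); rewrite -psdDl !addr0. Qed.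

Lemma psdZl a u w : c (a *: u) w = a * c u w.
Proof. by rewrite -[a *: u]addr0 (psd_linl cP) psd0l addr0. Qed.

Lemma psdNl u w : c (- u) w = - c u w.
Proof. by rewrite -scaleN1r psdZl mulN1r. Qed.

Lemma psdBl u v w : c (u - v) w = c u w - c v w.
Proof. by rewrite psdDl psdNl. Qed.

Lemma psdDr u v w : c w (u + v) = c w u + c w v.
Proof. by rewrite !(psdC cP w) psdDl. Qed.

Lemma psdZr a u w : c w (a *: u) = a * c w u.
Proof. by rewrite !(psdC cP w) psdZl. Qed.

Lemma psd0r w : c w 0 = 0.
Proof. by rewrite (psdC cP) psd0l. Qed.

Lemma psdBr u v w : c w (u - v) = c w u - c w v.
Proof. by rewrite !(psdC cP w) psdBl. Qed.

Lemma psd_suml I (s : seq I) (P : pred I) (F : I -> V) w :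
  c (\sum_(i <- s | P i) F i) w = \sum_(i <- s | P i) c (F i) w.
Proof. by apply: (big_morph (c^~ w)) => [u v|]; rewrite ?psdDl ?psd0l. Qed.

Lemma psd_sumr I (s : seq I) (P : pred I) (F : I -> V) w :
  c w (\sum_(i <- s | P i) F i) = \sum_(i <- s | P i) c w (F i).
Proof. by rewrite (psdC cP) psd_suml; apply: eq_bigr => i _; exact: psdC. Qed.

Lemma psdDD u v : c (u + v) (u + v) = c u u + 2 * c u v + c v v.
Proof. by rewrite !(psdDl, psdDr) (psdC cP v u); ring. Qed.

Lemma psdBB u v : c (u - v) (u - v) = c u u - 2 * c u v + c v v.
Proof. by rewrite !(psdBl, psdBr) (psdC cP v u); ring. Qed.

Lemma psd_CS u v : c u v ^+ 2 <= c u u * c v v.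
Proof.
have pos t : 0 <= c u u - 2 * t * c u v + t ^+ 2 * c v v.
  have := psd_ge0 cP (u - t *: v).
  by rewrite psdBB psdZl !psdZr => /le_trans; apply; rewrite le_eqVlt; apply/orP; left; apply/eqP; ring.
have [vv0|vv0] := eqVneq (c v v) 0; last first.
  have vvp : 0 < c v v by rewrite lt_def vv0 psd_ge0.
  have := pos (c u v / c v v).
  rewrite (_ : _ + _ = c u u - c u v ^+ 2 / c v v); last by field.
  by rewrite subr_ge0 ler_pdivrMr.
(* a null vector of [c] is orthogonal to everything: else the quadratic
   polynomial above would be a nonconstant affine function *)
rewrite vv0 mulr0 le_eqVlt sqrf_eq0; apply/orP; left.
apply/eqP; apply: contrapT => /eqP uv0.
have := pos ((c u u + 1) / (2 * c u v)); rewrite vv0 mulr0 addr0.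
rewrite (_ : 2 * _ * _ = c u u + 1); last by field.
lra.
Qed.

Lemma psd_abs_CS u v : `|c u v| <= Num.sqrt (c u u) * Num.sqrt (c v v).
Proof. by rewrite -sqrtr_sqr -sqrtrM ?psd_ge0 // ler_wsqrtr // psd_CS. Qed.

End PsdForm.

Record hilbert (R : realType) (V : lmodType R) (ip : V -> V -> R) : Prop := {
  hilbert_form :> psd_form ip;
  hilbert_eq0 : forall u, ip u u = 0 -> u = 0;
  hilbert_complete : forall u : nat -> V,
    (forall e : R, 0 < e -> exists n0 : nat, forall m n : nat,
       (n0 <= m)%N -> (n0 <= n)%N -> ip (u m - u n) (u m - u n) < e) ->
    exists l, ip (u n - l) (u n - l) @[n --> \oo] --> (0 : R) }.

Lemma cvgn_unique (R : realType) (u : nat -> R) (a b : R) :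
  u n @[n --> \oo] --> a -> u n @[n --> \oo] --> b -> a = b.
Proof.
by move=> /(cvg_lim (@Rhausdorff R)) <- /(cvg_lim (@Rhausdorff R)) <-.
Qed.

Lemma cvgn_le (R : realType) (u : nat -> R) (l M : R) :
  u n @[n --> \oo] --> l -> (forall n, u n <= M) -> l <= M.
Proof.
move=> ul uM; rewrite -(cvg_lim (@Rhausdorff R) ul).
by apply: limr_le; [apply/cvg_ex; exists l|exact: nearW].
Qed.

Section Hilbert.
Context {R : realType} {V : lmodType R} {ip : V -> V -> R}.
Hypothesis hP : hilbert ip.

Let ipP : psd_form ip := hP.

Definition hcvg (u : nat -> V) (l : V) : Prop :=
  ip (u n - l) (u n - l) @[n --> \oo] --> (0 : R).

Lemma hcvg_forml (c : V -> V -> R) (B : R) u l w : psd_form c ->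
  (forall h, c h h <= B * ip h h) -> hcvg u l ->
  c (u n) w @[n --> \oo] --> c l w.
Proof.
move=> cP cB ul; apply/cvgrPdist_lt => e e0.
have B1 : 0 < (`|B| + 1) * (c w w + 1).
  by rewrite mulr_gt0 // ltr_wpDl // psd_ge0.
have e2 : 0 < e ^+ 2 / ((`|B| + 1) * (c w w + 1)).
  by rewrite divr_gt0 // exprn_gt0.
move/cvgrPdist_lt : ul => /(_ _ e2); apply: filterS => n /=.
rewrite sub0r normrN ger0_norm ?(psd_ge0 ipP) // ltr_pdivlMr // => ub.
rewrite -(ltr_pXn2r (n := 2)) ?nnegrE ?normr_ge0 ?(ltW e0) //.
rewrite real_normK ?num_real //.
rewrite -(psdBl cP) (le_lt_trans (psd_CS cP _ _)) //.
rewrite -opprB (psdNl cP) (psdC cP) (psdNl cP) opprK.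
apply: le_lt_trans ub; rewrite mulrA ler_pM // ?(psd_ge0 cP) ?lerDl //.
rewrite (le_trans (cB _)) // mulrC ler_wpM2l ?(psd_ge0 ipP) //.
by rewrite (le_trans (ler_norm _)) // lerDl.
Qed.

Lemma hcvg_ipl u l w : hcvg u l -> ip (u n) w @[n --> \oo] --> ip l w.
Proof.
by move=> /(@hcvg_forml ip 1 _ _ w ipP); apply => h; rewrite mul1r.
Qed.

Lemma hcvg_form (c : V -> V -> R) (B : R) u l : psd_form c ->
  (forall h, c h h <= B * ip h h) -> hcvg u l ->
  c (u n) (u n) @[n --> \oo] --> c l l.
Proof.
move=> cP cB ul.
have -> : (fun n => c (u n) (u n)) =
   (fun n => c (u n - l) (u n - l) + (2 * c (u n) l - c l l)).
  by apply/funext => n; rewrite (psdBB cP); ring.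
rewrite -[X in _ --> X](_ : 0 + (2 * c l l - c l l) = c l l); last by ring.
apply: cvgD; last first.
  apply: cvgB; last exact: cvg_cst.
  by apply: cvgM; [exact: cvg_cst|exact: hcvg_forml ul].
apply: (@squeeze_cvgr _ _ _ _ (cst 0) (fun n => B * ip (u n - l) (u n - l))).
- by apply: nearW => n; rewrite (psd_ge0 cP) cB.
- exact: cvg_cst.
- by rewrite -[X in _ --> X](mulr0 B); apply: cvgM => //; exact: cvg_cst.
Qed.

Lemma hcvg_ip u l : hcvg u l -> ip (u n) (u n) @[n --> \oo] --> ip l l.
Proof. by move/(@hcvg_form ip 1 _ _ ipP); apply => h; rewrite mul1r. Qed.

(** Zero vectors are allowed so that families of any size are indexed by [nat]. *)
Definition orthonormal_family (e : nat -> V) : Prop :=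
  (forall i j, i != j -> ip (e i) (e j) = 0) /\
  (forall i, e i = 0 \/ ip (e i) (e i) = 1).

Definition total_family (e : nat -> V) : Prop :=
  forall r, (forall i, ip r (e i) = 0) -> r = 0.

Section OrthonormalFamily.
Context {e : nat -> V}.
Hypothesis eP : orthonormal_family e.

Lemma ortho_neq i j : i != j -> ip (e i) (e j) = 0.
Proof. exact: eP.1. Qed.

Lemma ortho_sqr i w : ip w (e i) * ip (e i) (e i) = ip w (e i).
Proof. by case: (eP.2 i) => ->; rewrite ?(psd0r ipP) ?mulr0 ?mulr1. Qed.

Lemma ortho_le1 i : ip (e i) (e i) <= 1.
Proof. by case: (eP.2 i) => ->; rewrite ?(psd0r ipP) ?ler01. Qed.

Lemma ortho_sum_ip (a : nat -> R) (n m : nat) (j : nat) :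
  ip (\sum_(m <= i < n) a i *: e i) (e j) =
  if (m <= j < n)%N then a j * ip (e j) (e j) else 0.
Proof.
rewrite (psd_suml ipP); case: ifPn => jn.
  rewrite (bigD1_seq j) ?mem_index_iota ?iota_uniq //= (psdZl ipP).
  by rewrite big1 ?addr0 // => i ij; rewrite (psdZl ipP) ortho_neq ?mulr0.
rewrite big_nat big1 // => i imn; rewrite (psdZl ipP) ortho_neq ?mulr0 //.
by apply: contraNneq jn => <-.
Qed.

Lemma ortho_sum_sqr (a : nat -> R) (n m : nat) :
  ip (\sum_(m <= i < n) a i *: e i) (\sum_(m <= i < n) a i *: e i) =
  \sum_(m <= i < n) a i ^+ 2 * ip (e i) (e i).
Proof.
rewrite {2}[\sum_(m <= i < n) _ *: _]big_nat (psd_sumr ipP) [RHS]big_nat.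
apply: eq_bigr => i imn; rewrite (psdZr ipP) ortho_sum_ip imn; ring.
Qed.

Lemma ortho_series (a : nat -> R) (B : R) :
  (forall n, \sum_(0 <= i < n) a i ^+ 2 <= B) ->
  exists s, hcvg (fun n => \sum_(0 <= i < n) a i *: e i) s.
Proof.
move=> aB; apply: (hilbert_complete hP) => x x0.
pose A n := \sum_(0 <= i < n) a i ^+ 2.
have Acvg : cvgn A.
  apply: nondecreasing_is_cvgn.
    apply/nondecreasing_seqP => n; rewrite /A big_nat_recr //= lerDl; exact: sqr_ge0.
  by exists B => _ [n _ <-]; exact: aB.
have /cauchy_cvgP/cauchy_seriesP : cvgn (series (fun i => a i ^+ 2)) by exact: Acvg.
move=> /(_ _ x0)[[D1 D2] /= [[n1 _ D1n] [n2 _ D2n]] D12].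
exists (maxn n1 n2) => m n.
wlog nm : m n / (n <= m)%N => [wl|].
  move=> mx nx; have [nm|mn] := leqP n m; first exact: wl.
  rewrite -opprB (psdNl ipP) (psdC ipP) (psdNl ipP) opprK.
  by apply: wl => //; exact: ltnW.
rewrite !geq_max => /andP[m1 m2] /andP[n1' n2'].
rewrite /= (big_cat_nat (n := n)) //= addrAC subrr add0r ortho_sum_sqr.
have := D12 (n, m); rewrite /= => /(_ (conj (D1n _ n1') (D2n _ m2))).
move=> /(le_lt_trans (ler_norm _)); apply: le_lt_trans.
by apply: ler_sum => i _; rewrite ler_piMr ?sqr_ge0 ?ortho_le1.
Qed.

Lemma ortho_residue g n :
  ip (g - \sum_(0 <= i < n) ip g (e i) *: e i)
     (g - \sum_(0 <= i < n) ip g (e i) *: e i) =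
  ip g g - \sum_(0 <= i < n) ip g (e i) ^+ 2.
Proof.
rewrite (psdBB ipP) ortho_sum_sqr (psd_sumr ipP).
rewrite (eq_bigr (fun i => ip g (e i) ^+ 2)); last first.
  by move=> i _; rewrite (psdZr ipP) expr2.
rewrite [X in _ + X](eq_bigr (fun i => ip g (e i) ^+ 2)); last first.
  by move=> i _; rewrite expr2 -mulrA ortho_sqr.
ring.
Qed.

Lemma bessel g n : \sum_(0 <= i < n) ip g (e i) ^+ 2 <= ip g g.
Proof. by rewrite -subr_ge0 -ortho_residue (psd_ge0 ipP). Qed.

Lemma ortho_projection g : exists s,
  [/\ hcvg (fun n => \sum_(0 <= i < n) ip g (e i) *: e i) s,
      forall i, ip (g - s) (e i) = 0
    & \sum_(0 <= i < n) ip g (e i) ^+ 2 @[n --> \oo]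
        --> ip g g - ip (g - s) (g - s)].
Proof.
have [s Ss] := ortho_series (bessel g); exists s; split => //.
- move=> i; rewrite (psdBl ipP); apply/eqP; rewrite subr_eq0 eq_sym; apply/eqP.
  apply: (cvgn_unique (hcvg_ipl (w := e i) Ss)).
  apply: cvg_near_cst; exists i.+1 => // n /= ni.
  by rewrite ortho_sum_ip ni /= ortho_sqr.
- have -> : (fun n => \sum_(0 <= i < n) ip g (e i) ^+ 2) = (fun n => ip g g -
     ip (g - \sum_(0 <= i < n) ip g (e i) *: e i)
        (g - \sum_(0 <= i < n) ip g (e i) *: e i)).
    by apply/funext => n; rewrite ortho_residue; ring.
  apply: cvgB; first exact: cvg_cst.
  have -> : (fun n => ip (g - \sum_(0 <= i < n) ip g (e i) *: e i)
        (g - \sum_(0 <= i < n) ip g (e i) *: e i)) = (fun n => ip g g -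
         2 * ip (\sum_(0 <= i < n) ip g (e i) *: e i) g +
     ip (\sum_(0 <= i < n) ip g (e i) *: e i) (\sum_(0 <= i < n) ip g (e i) *: e i)).
    by apply/funext => n; rewrite (psdBB ipP) (psdC ipP g).
  rewrite (psdBB ipP) (psdC ipP g); apply: cvgD; last exact: hcvg_ip.
  apply: cvgB; first exact: cvg_cst.
  by apply: cvgM; [exact: cvg_cst|exact: hcvg_ipl].
Qed.

Lemma total_expansion g : total_family e ->
  hcvg (fun n => \sum_(0 <= i < n) ip g (e i) *: e i) g.
Proof.
move=> te; have [s [Ss /te/subr0_eq E _]] := ortho_projection g.
by rewrite [X in hcvg _ X]E.
Qed.

Lemma total_parseval g : total_family e ->
  \sum_(0 <= i < n) ip g (e i) ^+ 2 @[n --> \oo] --> ip g g.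
Proof.
move=> te; have [s [_ /te/subr0_eq<-]] := ortho_projection g.
by rewrite subrr (psd0l ipP) subr0.
Qed.

(** With a total orthonormal sequence the representer of [L] is explicit,
    namely the sum of [L (e i) *: e i]. *)
Lemma riesz (L : V -> R) (B : R) : total_family e ->
  (forall a u v, L (a *: u + v) = a * L u + L v) ->
  (forall u, L u ^+ 2 <= B * ip u u) ->
  exists r, forall u, ip r u = L u.
Proof.
move=> te Llin LB.
have LD u v : L (u + v) = L u + L v by rewrite -{1}[u]scale1r Llin mul1r.
have L0 : L 0 = 0 by apply: (addrI (L 0)); rewrite -LD !addr0.
have LZ a u : L (a *: u) = a * L u by rewrite -[a *: u]addr0 Llin L0 addr0.
have Lsum n (a : nat -> R) : L (\sum_(0 <= i < n) a i *: e i) =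
    \sum_(0 <= i < n) a i * L (e i).
  rewrite (big_morph L LD L0); apply: eq_bigr => i _; exact: LZ.
have LN u : L (- u) = - L u by rewrite -scaleN1r LZ mulN1r.
have Lsqr i : L (e i) ^+ 2 * ip (e i) (e i) = L (e i) ^+ 2.
  by case: (eP.2 i) => ->; rewrite ?L0 ?mulr1 // expr2 !mul0r.
have Lbd n : \sum_(0 <= i < n) L (e i) ^+ 2 <= `|B|.
  set S := \sum_(0 <= i < n) _.
  have := LB (\sum_(0 <= i < n) L (e i) *: e i).
  rewrite Lsum ortho_sum_sqr (eq_bigr _ (fun i _ => Lsqr i)) -/S.
  move=> SB; have [S0|S0] := leP S 0; first by rewrite (le_trans S0).
  have : S * S <= B * S by rewrite -expr2.
  by rewrite ler_pM2r // => /le_trans; apply; exact: ler_norm.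
have [r rS] := ortho_series Lbd; exists r => u.
have h1 : ip (\sum_(0 <= i < n) L (e i) *: e i) u @[n --> \oo] --> ip r u.
  exact: hcvg_ipl.
have := total_expansion u te; rewrite /hcvg => ue.
apply: (cvgn_unique h1).
have E n : ip (\sum_(0 <= i < n) L (e i) *: e i) u =
    L (\sum_(0 <= i < n) ip u (e i) *: e i).
  rewrite Lsum (psd_suml ipP); apply: eq_bigr => i _.
  by rewrite (psdZl ipP) (psdC ipP) mulrC.
rewrite (eq_cvg _ _ E); apply/cvgrPdist_lt => x x0.
have B1 : 0 < `|B| + 1 by rewrite ltr_wpDl.
have e2 : 0 < x ^+ 2 / (`|B| + 1) by rewrite divr_gt0 // exprn_gt0.
move/cvgrPdist_lt : ue => /(_ _ e2); apply: filterS => n /=.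
rewrite sub0r normrN ger0_norm ?(psd_ge0 ipP) // ltr_pdivlMr // => ub.
rewrite -(ltr_pXn2r (n := 2)) ?nnegrE ?normr_ge0 ?(ltW x0) //.
rewrite real_normK ?num_real // -LN -LD -opprB LN sqrrN.
rewrite (le_lt_trans (LB _)) //.
apply: le_lt_trans ub; rewrite mulrC ler_wpM2l ?(psd_ge0 ipP) //.
by rewrite (le_trans (ler_norm _)) // lerDl.
Qed.

End OrthonormalFamily.

(** * Gram-Schmidt *)

Section GramSchmidt.
Variable v : nat -> V.

Definition normalize u : V := (Num.sqrt (ip u u))^-1 *: u.

Fixpoint gs_prefix n : seq V :=
  if n is m.+1 then
    rcons (gs_prefix m)
      (normalize (v m - \sum_(e <- gs_prefix m) ip (v m) e *: e))
  else [::].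

Definition gs n : V := last 0 (gs_prefix n.+1).

Definition gs_residue n : V :=
  v n - \sum_(0 <= i < n) ip (v n) (gs i) *: gs i.

Lemma gs_prefixE n : gs_prefix n = [seq gs i | i <- iota 0 n].
Proof.
elim: n => // n IH; rewrite -addn1 iotaD map_cat add0n /= -IH cats1 addn1.
by rewrite /gs /= last_rcons.
Qed.

Lemma gsE n : gs n = normalize (gs_residue n).
Proof.
rewrite /gs /= last_rcons gs_prefixE big_map /gs_residue.
by rewrite /index_iota subn0.
Qed.

Lemma gs_residueE n : gs_residue n = Num.sqrt (ip (gs_residue n) (gs_residue n)) *: gs n.
Proof.
rewrite gsE /normalize; have [u0|u0] := eqVneq (ip (gs_residue n) (gs_residue n)) 0.
  by rewrite (hilbert_eq0 hP u0) !scaler0.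
by rewrite scalerA divff ?scale1r // sqrtr_eq0 -ltNge lt_def u0 (psd_ge0 ipP).
Qed.

Lemma gs_norm n : gs n = 0 \/ ip (gs n) (gs n) = 1.
Proof.
rewrite gsE /normalize; have [u0|u0] := eqVneq (ip (gs_residue n) (gs_residue n)) 0.
  by left; rewrite (hilbert_eq0 hP u0) scaler0.
right; rewrite (psdZl ipP) (psdZr ipP) mulrA -expr2 exprVn sqr_sqrtr ?(psd_ge0 ipP) //.
by rewrite mulVf.
Qed.

Lemma gs_orthonormal : orthonormal_family gs.
Proof.
split; last exact: gs_norm.
suff H n : forall i, (i < n)%N -> ip (gs n) (gs i) = 0.
  move=> i j ij; have [lt|gt|E] := ltngtP i j; last by rewrite E eqxx in ij.
    by rewrite (psdC ipP) H.
  by rewrite H.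
elim/ltn_ind: n => n IH i ni.
rewrite gsE /normalize (psdZl ipP).
suff -> : ip (gs_residue n) (gs i) = 0 by rewrite mulr0.
rewrite /gs_residue (psdBl ipP) (psd_suml ipP).
rewrite (bigD1_seq i) ?mem_index_iota ?iota_uniq // (psdZl ipP) /=.
have sq : ip (v n) (gs i) * ip (gs i) (gs i) = ip (v n) (gs i).
  by case: (gs_norm i) => ->; rewrite ?(psd0r ipP) ?mulr0 ?mulr1.
rewrite sq big_nat_cond big1 ?addr0 ?subrr // => j /andP[jn ji].
rewrite (psdZl ipP).
have [lt|gt|E] := ltngtP i j; last by rewrite E eqxx in ji.
  by rewrite IH ?mulr0.
by rewrite (psdC ipP (gs j)) IH ?mulr0.
Qed.

Lemma gs_orth u : (forall i, ip u (v i) = 0) <-> (forall i, ip u (gs i) = 0).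
Proof.
split=> H n.
  elim/ltn_ind: n => n IH; rewrite gsE (psdZr ipP).
  suff -> : ip u (gs_residue n) = 0 by rewrite mulr0.
  rewrite /gs_residue (psdBr ipP) H (psd_sumr ipP) big_nat big1 ?subr0 //.
  by move=> i ?; rewrite (psdZr ipP) IH ?mulr0.
have -> : v n = gs_residue n + \sum_(0 <= i < n) ip (v n) (gs i) *: gs i.
  by rewrite subrK.
rewrite (psdDr ipP) gs_residueE (psdZr ipP) H mulr0 add0r.
by rewrite (psd_sumr ipP) big1 // => i ?; rewrite (psdZr ipP) H ?mulr0.
Qed.

Lemma gs_total : total_family v -> total_family gs.
Proof. by move=> tv r /gs_orth/tv. Qed.

(** Only the earlier vectors that are not orthogonal to [v n] enter the
    construction of [gs v n], so only these must lie in the subspace [S]. *)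
Lemma gs_closed (S : V -> Prop) n : S 0 ->
  (forall a u w, S u -> S w -> S (a *: u + w)) ->
  S (v n) ->
  (forall i, (i < n)%N -> ip (v n) (gs i) != 0 -> S (gs i)) -> S (gs n).
Proof.
move=> S0 SD Sv Sg; rewrite gsE /normalize -[_ *: _]addr0; apply: (SD) => //.
rewrite /gs_residue -scaleN1r addrC; apply: (SD) => //.
rewrite big_nat; elim/big_rec : _ => [|i x ni Sx]; first exact: S0.
have [E0|E0] := eqVneq (ip (v n) (gs i)) 0; first by rewrite E0 scale0r add0r.
by apply: (SD) => //; apply: Sg.
Qed.

End GramSchmidt.

End Hilbert.

(** * Weak sequential compactness *)

(** An ultrafilter finer than [\oo] makes all the sequences [a ^~ j] converge at
    once, which replaces a diagonal extraction: the indices [phi k] are picked in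
    the sets of the ultrafilter where the first [k] sequences are within
    [k.+1%:R^-1] of their limits. *)
Lemma bounded_subsequence (R : realType) (a : nat -> nat -> R) (B : nat -> R) :
  (forall n j, `|a n j| <= B j) ->
  exists phi : nat -> nat, (forall k, (k <= phi k)%N) /\
    exists l : nat -> R, forall j, a (phi k) j @[k --> \oo] --> l j.
Proof.
move=> aB.
have [U [UU Uoo]] := ultraFilterLemma (F := \oo) _.
have UF : Filter U by exact: filter_filter.
have lim_ex j : exists l, forall e : R, 0 < e -> U [set n | `|l - a n j| < e].
  have [|l [_ lcl]] := @segment_compact R (- B j) (B j) (a ^~ j @ U) _.
    by apply: (@filterE _ U) => n /=; rewrite in_itv /= -ler_norml.
  exists l => e e0.
  have [//|UC] := in_ultra_setVsetC [set n | `|l - a n j| < e] UU.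
  have [] := lcl (~` [set y | `|l - y| < e]) (ball l e) UC (nbhsx_ballx _ _ e0).
  by move=> y [/=]; rewrite /ball /=.
have [l lP] := choice lim_ex.
have /choice[phi phiP] : forall k : nat, exists n, (k <= n)%N /\
    forall j, (j < k)%N -> `|l j - a n j| < k.+1%:R^-1.
  move=> k.
  have Uk m : (m <= k)%N -> U [set n | (k <= n)%N /\
      forall j, (j < m)%N -> `|l j - a n j| < k.+1%:R^-1].
    elim: m => [_|m IH mk].
      by apply: filterS (Uoo [set n | (k <= n)%N] _) => //; exists k.
    have k0 : 0 < (k.+1%:R : R)^-1 by rewrite invr_gt0 ltr0n.
    have H := @filterI _ U UF _ _ (IH (ltnW mk)) (lP m _ k0).
    apply: (@filterS _ U _ _ _ _ H) => n [[kn H1] H2].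
    split => // j; rewrite ltnS leq_eqVlt => /predU1P[->//|]; exact: H1.
  exact: (filter_ex (Uk k (leqnn k))).
exists phi; split=> [k|]; first by have [] := phiP k.
exists l => j; apply/cvgrPdist_lt => e e0.
near=> k; apply: (@lt_trans _ _ k.+1%:R^-1).
  by apply: (phiP k).2; near: k; exists j.+1.
by near: k; exact: near_infty_natSinv_lt (PosNum e0).
Unshelve. all: by end_near. Qed.

Section WeakCompactness.
Context {R : realType} {V : lmodType R} {ip : V -> V -> R}.
Hypothesis hP : hilbert ip.
Let ipP : psd_form ip := hP.
Context {b : nat -> V}.
Hypothesis bP : orthonormal_family (ip := ip) b.
Hypothesis bT : total_family (ip := ip) b.

Lemma real_cauchy_cvg (u : nat -> R) :
  (forall e, 0 < e -> exists n0 : nat, forall n, (n0 <= n)%N -> `|u n0 - u n| < e) ->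
  cvgn u.
Proof.
move=> H; apply/cauchy_cvgP/cauchy_exP => e e0.
have [n0 Hn0] := H e e0; exists (u n0).
by exists n0 => // n /= /Hn0.
Qed.

Lemma cvgn_sum (u : nat -> nat -> R) (l : nat -> R) n :
  (forall i, u k i @[k --> \oo] --> l i) ->
  \sum_(0 <= i < n) u k i @[k --> \oo] --> \sum_(0 <= i < n) l i.
Proof.
move=> ul; elim: n => [|n IH].
  by rewrite big_geq //; under eq_cvg do rewrite big_geq //; exact: cvg_cst.
rewrite big_nat_recr //=; under eq_cvg do rewrite big_nat_recr //=.
exact: cvgD.
Qed.

(** The inner products with the vectors of the total family converge along a
    subsequence. Those with any [u] then form a Cauchy sequence, because the tail
    of the expansion of [u] contributes uniformly little, and Riesz' theorem turns
    the limits into a vector. *)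
Lemma weak_subsequence (h : nat -> V) : (forall n, ip (h n) (h n) <= 1) ->
  exists phi : nat -> nat, (forall k, (k <= phi k)%N) /\
    exists l, ip l l <= 1 /\ forall u, ip (h (phi k)) u @[k --> \oo] --> ip l u.
Proof.
move=> h1.
have hb n u : `|ip (h n) u| <= Num.sqrt (ip u u).
  apply: (le_trans (psd_abs_CS ipP _ _)).
  by rewrite ler_piMl ?sqrtr_ge0 // -sqrtr1 ler_wsqrtr.
have [phi [phik [l lP]]] := @bounded_subsequence R (fun n j => ip (h n) (b j))
  (fun j => Num.sqrt (ip (b j) (b j))) (fun n j => hb n (b j)).
exists phi; split => //.
pose S u n := \sum_(0 <= i < n) ip u (b i) *: b i.
have cvgu u : cvgn (fun k => ip (h (phi k)) u).
  apply: real_cauchy_cvg => e e0.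
  have e3 : 0 < (e / 3) ^+ 2 by rewrite exprn_gt0 // divr_gt0.
  have /cvgrPdist_lt/(_ _ e3)[n1 _ /(_ n1 (leqnn _))] :=
    total_expansion hP bP u bT.
  rewrite sub0r normrN ger0_norm ?(psd_ge0 ipP) // => un1.
  have Scvg : ip (h (phi k)) (S u n1) @[k --> \oo] -->
      \sum_(0 <= i < n1) ip u (b i) * l i.
    have -> : (fun k => ip (h (phi k)) (S u n1)) =
      (fun k => \sum_(0 <= i < n1) ip u (b i) * ip (h (phi k)) (b i)).
      apply/funext => k; rewrite /S (psd_sumr ipP).
      by apply: eq_bigr => i _; rewrite (psdZr ipP).
    by apply: cvgn_sum => i; apply: cvgM; [exact: cvg_cst|exact: lP].
  have e6 : 0 < e / 6 by rewrite divr_gt0.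
  have /cvgrPdist_lt/(_ _ e6)[n0 _ Hn0] := Scvg.
  exists n0 => n n0n.
  have tail k : `|ip (h (phi k)) (u - S u n1)| < e / 3.
    apply: (le_lt_trans (hb _ _)).
    rewrite -(ltr_pXn2r (n := 2)) ?nnegrE ?sqrtr_ge0 ?divr_ge0 ?(ltW e0) //.
    rewrite sqr_sqrtr ?(psd_ge0 ipP) //.
    by rewrite -opprB (psdNl ipP) (psdC ipP) (psdNl ipP) opprK.
  move: (Hn0 n0 (leqnn _)) (Hn0 n n0n) (tail n0) (tail n).
  rewrite /= !(psdBr ipP) !ltr_distl.
  move=> /andP[? ?] /andP[? ?] /andP[? ?] /andP[? ?].
  by apply/andP; split; lra.
pose L u := limn (fun k => ip (h (phi k)) u).
have LP u : ip (h (phi k)) u @[k --> \oo] --> L u by exact: cvgu.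
have LB u : L u ^+ 2 <= 1 * ip u u.
  rewrite mul1r.
  have LL : ip (h (phi k)) u * ip (h (phi k)) u @[k --> \oo] --> L u * L u.
    by apply: cvgM; exact: LP.
  rewrite expr2; apply: (cvgn_le LL) => k; rewrite -expr2.
  by rewrite (le_trans (psd_CS ipP _ _)) // ler_piMl ?(psd_ge0 ipP).
have [r rP] : exists r, forall u, ip r u = L u.
  apply: (riesz hP bP bT (B := 1)) LB => a u v.
  apply: (cvgn_unique (LP (a *: u + v))).
  have -> : (fun k => ip (h (phi k)) (a *: u + v)) =
      (fun k => a * ip (h (phi k)) u + ip (h (phi k)) v).
    by apply/funext => k; rewrite (psdDr ipP) (psdZr ipP).
  by apply: cvgD => //; apply: cvgM => //; exact: cvg_cst.
exists r; split=> [|u]; last by rewrite rP.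
have := LB r; rewrite -rP mul1r expr2.
have [->|r0] := eqVneq (ip r r) 0; first by rewrite ler01.
by rewrite -{3}[ip r r]mul1r ler_pM2r // lt_def r0 (psd_ge0 ipP).
Qed.

End WeakCompactness.

(** * The trace of a covariance form *)

Section SquareIntegrable.
Context {d} {T : measurableType d} {R : realType} (N : {measure set T -> \bar R}).

Lemma integrable_dominated (f g : T -> R) : measurable_fun setT f ->
  (forall x, `|f x| <= g x) -> N.-integrable setT (EFin \o g) ->
  N.-integrable setT (EFin \o f).
Proof.
move=> mf fg ig; apply: (le_integrable measurableT _ _ ig).
  exact/measurable_EFinP.
move=> x _ /=; rewrite lee_fin (le_trans (fg x)) //.
exact: ler_norm.
Qed.

Lemma integrable_mul_sqr (f g : T -> R) :
  measurable_fun setT f -> measurable_fun setT g ->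
  N.-integrable setT (EFin \o (fun x => f x ^+ 2)) ->
  N.-integrable setT (EFin \o (fun x => g x ^+ 2)) ->
  N.-integrable setT (EFin \o (fun x => f x * g x)).
Proof.
move=> mf mg f2 g2.
apply: (@integrable_dominated _ (fun x => f x ^+ 2 + g x ^+ 2)).
- exact: measurable_funM.
- move=> x; rewrite ler_norml; apply/andP.
  have := sqr_ge0 (f x + g x); have := sqr_ge0 (f x - g x).
  rewrite sqrrB sqrrD !mulr2n.
  have := sqr_ge0 (f x); have := sqr_ge0 (g x).
  move: (f x ^+ 2) (g x ^+ 2) (f x * g x) => a b' c.
  by split; lra.
- exact: (integrableD measurableT f2 g2).
Qed.

Lemma Rintegral_EFin (f : T -> R) : N.-integrable setT (EFin \o f) ->
  (\int[N]_x f x)%:E = (\int[N]_x (f x)%:E)%E.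
Proof. by move=> fi; rewrite /Rintegral fineK // integrable_fin_num. Qed.

Lemma Rintegral_sqr_eq0 (f : T -> R) : measurable_fun setT f ->
  N.-integrable setT (EFin \o (fun x => f x ^+ 2)) ->
  \int[N]_x f x ^+ 2 = 0 -> {ae N, forall x, f x = 0}.
Proof.
move=> mf f2 f0.
have : (\int[N]_(x in setT) `|(f x ^+ 2)%:E| = 0)%E.
  rewrite -[RHS]/(0%R%:E) -f0 (Rintegral_EFin f2); apply: eq_integral => x _.
  by rewrite abse_EFin ger0_norm ?sqr_ge0.
move/(ae_eq_integral_abs N measurableT _).1 => H.
have {H} : ae_eq N setT (fun x => (f x ^+ 2)%:E) (cst 0%E).
  by apply: H; apply/measurable_EFinP; exact: measurable_funX.
apply: filterS => x /(_ Logic.I)[]/eqP; rewrite sqrf_eq0 => /eqP.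
exact.
Qed.

End SquareIntegrable.

Section CovarianceForm.
Context {R : realType} {V : lmodType R} {ip : V -> V -> R}.
Hypothesis hP : hilbert ip.
Let ipP : psd_form ip := hP.
Context {b : nat -> V}.
Hypothesis bP : orthonormal_family (ip := ip) b.
Hypothesis bT : total_family (ip := ip) b.
Context {d} {T : measurableType d} (N : probability T R) (F : T -> V).
Hypothesis mFb : forall j, measurable_fun setT (fun x => ip (F x) (b j)).
Hypothesis FFoo : (\int[N]_x (ip (F x) (F x))%:E < +oo)%E.

Lemma measurable_ip u : measurable_fun setT (fun x => ip (F x) u).
Proof.
apply: (@measurable_fun_cvg _ _ _ _
  (fun n x => \sum_(0 <= i < n) ip u (b i) * ip (F x) (b i))).
  by move=> n; apply: measurable_sum => i; exact: measurable_funM.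
move=> x _; rewrite (psdC ipP).
have -> : (fun n => \sum_(0 <= i < n) ip u (b i) * ip (F x) (b i)) =
    (fun n => ip (\sum_(0 <= i < n) ip u (b i) *: b i) (F x)).
  apply/funext => n; rewrite (psd_suml ipP); apply: eq_bigr => i _.
  by rewrite (psdZl ipP) (psdC ipP (F x)).
exact: (hcvg_ipl hP (total_expansion hP bP u bT)).
Qed.

Lemma measurable_sqnorm : measurable_fun setT (fun x => ip (F x) (F x)).
Proof.
apply: (@measurable_fun_cvg _ _ _ _
  (fun n x => \sum_(0 <= i < n) ip (F x) (b i) ^+ 2)).
  by move=> n; apply: measurable_sum => i; exact: measurable_funX.
by move=> x _; exact: (total_parseval hP bP bT).
Qed.

Lemma integrable_sqnorm : N.-integrable setT (EFin \o (fun x => ip (F x) (F x))).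
Proof.
apply/integrableP; split; first exact/measurable_EFinP/measurable_sqnorm.
rewrite (eq_integral (fun x => (ip (F x) (F x))%:E)) // => x _.
by rewrite /= ger0_norm ?(psd_ge0 ipP).
Qed.

Lemma integrable_ip_sqr u :
  N.-integrable setT (EFin \o (fun x => ip (F x) u ^+ 2)).
Proof.
apply: (@integrable_dominated _ _ _ _ _ (fun x => ip u u * ip (F x) (F x))).
- exact/measurable_funX/measurable_ip.
- by move=> x; rewrite ger0_norm ?sqr_ge0 // mulrC; exact: psd_CS.
- exact: (integrableZl measurableT _ integrable_sqnorm).
Qed.

Lemma integrable_ip_mul u w :
  N.-integrable setT (EFin \o (fun x => ip (F x) u * ip (F x) w)).
Proof.
by apply: integrable_mul_sqr; [exact: measurable_ip|exact: measurable_ip|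
  exact: integrable_ip_sqr|exact: integrable_ip_sqr].
Qed.

Definition cov u w : R := \int[N]_x (ip (F x) u * ip (F x) w).

Lemma cov_psd : psd_form cov.
Proof.
split.
- by move=> u w; apply: eq_Rintegral => x _; rewrite mulrC.
- move=> a u v w; rewrite /cov -RintegralZl ?measurableT //; last first.
    exact: integrable_ip_mul.
  rewrite -RintegralD ?measurableT //; last 2 first.
  + exact: (integrableZl measurableT a (integrable_ip_mul u w)).
  + exact: integrable_ip_mul.
  by apply: eq_Rintegral => x _; rewrite (psdDr ipP) (psdZr ipP); ring.
- by move=> u; apply: Rintegral_ge0 => x _; rewrite -expr2 sqr_ge0.
Qed.

Definition cov_trace : R := \int[N]_x ip (F x) (F x).

Lemma cov_le u : cov u u <= cov_trace * ip u u.
Proof.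
rewrite /cov /cov_trace -RintegralZr ?measurableT //; last exact: integrable_sqnorm.
apply: le_Rintegral => //; first exact: integrable_ip_mul.
  exact: (integrableZr measurableT (ip u u) integrable_sqnorm).
by move=> x _; rewrite -expr2; exact: psd_CS.
Qed.

Lemma cov_eq0 u : cov u u = 0 -> {ae N, forall x, ip (F x) u = 0}.
Proof.
move=> u0; apply: Rintegral_sqr_eq0; [exact: measurable_ip|
  exact: integrable_ip_sqr|by rewrite -[RHS]u0; apply: eq_Rintegral => x _].
Qed.

(** The covariance form is weakly sequentially continuous: this is the
    compactness of the covariance operator, and follows by dominated
    convergence. *)
Lemma cov_weak_cvg (h : nat -> V) l : (forall n, ip (h n) (h n) <= 1) ->
  ip l l <= 1 -> (forall u, ip (h n) u @[n --> \oo] --> ip l u) ->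
  cov (h n) (h n) @[n --> \oo] --> cov l l.
Proof.
move=> h1 l1 hl.
have E w : (cov w w)%:E = (\int[N]_x (ip (F x) w * ip (F x) w)%:E)%E.
  by rewrite Rintegral_EFin //; exact: integrable_ip_mul.
have conv x : (ip (F x) (h n) * ip (F x) (h n))%:E @[n --> \oo] -->
    (ip (F x) l * ip (F x) l)%:E.
  apply: cvg_EFin; first exact: nearW.
  rewrite /comp /= !(psdC ipP (F x)).
  under eq_fun do rewrite (psdC ipP (F x)).
  by apply: cvgM; exact: hl.
have dom x n : (`|(ip (F x) (h n) * ip (F x) (h n))%:E| <= (ip (F x) (F x))%:E)%E.
  rewrite abse_EFin lee_fin -expr2 ger0_norm ?sqr_ge0 //.
  by rewrite (le_trans (psd_CS ipP _ _)) // ler_piMr ?(psd_ge0 ipP).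
have [_ _] := @dominated_convergence _ T R N setT measurableT
  (fun n x => (ip (F x) (h n) * ip (F x) (h n))%:E)
  (fun x => (ip (F x) l * ip (F x) l)%:E)
  (EFin \o (fun x => ip (F x) (F x)))
  (fun n => measurable_int N (integrable_ip_mul _ _))
  (measurable_int N (integrable_ip_mul _ _))
  (aeW _ (fun x _ => conv x)) integrable_sqnorm (aeW _ (fun x n _ => dom x n)).
rewrite -E => H.
apply: fine_cvg; apply: cvg_trans H.
by under eq_fun do rewrite -E.
Qed.

Definition cov_eigen (mu : R) (h : V) : Prop := forall u, cov h u = mu * ip h u.

Let covP := cov_psd.

Section OrthogonalComplement.
Context {e : nat -> V} {lam : nat -> R}.
Hypothesis eP : orthonormal_family (ip := ip) e.
Hypothesis e_eigen : forall i, cov_eigen (lam i) (e i).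

Definition orth u : Prop := forall i, ip u (e i) = 0.

Lemma orth_lin a u v : orth u -> orth v -> orth (a *: u + v).
Proof. by move=> Hu Hv i; rewrite (psd_linl ipP) Hu Hv mulr0 addr0. Qed.

Lemma cov_orth_span h s g : orth h ->
  hcvg (ip := ip) (fun n => \sum_(0 <= i < n) ip g (e i) *: e i) s ->
  ip h s = 0 /\ cov h s = 0.
Proof.
move=> Hh Ss; split; rewrite ?(psdC ipP h) ?(psdC covP h).
  apply: (cvgn_unique (hcvg_ipl hP (w := h) Ss)).
  apply: cvg_near_cst; apply: nearW => n; rewrite (psd_suml ipP) big1 // => i _.
  by rewrite (psdZl ipP) (psdC ipP (e i)) Hh mulr0.
apply: (cvgn_unique (hcvg_forml ipP (w := h) covP cov_le Ss)).
apply: cvg_near_cst; apply: nearW => n; rewrite (psd_suml covP) big1 // => i _.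
by rewrite (psdZl covP) e_eigen (psdC ipP (e i)) Hh !mulr0.
Qed.

(** A maximizer of the Rayleigh quotient over the orthogonal complement exists
    by weak compactness, and the first order condition there makes it an
    eigenvector. *)
Lemma cov_top_eigen h0 : orth h0 -> 0 < cov h0 h0 ->
  exists h M, [/\ 0 < M, h != 0, orth h & cov_eigen M h].
Proof.
move=> h0e h0p.
pose E := [set cov h h | h in [set h | ip h h <= 1 /\ orth h]].
have Eub : ubound E cov_trace.
  move=> _ [h [h1 _] <-]; apply: (le_trans (cov_le h)).
  rewrite ler_piMr //; apply: Rintegral_ge0 => x _; exact: psd_ge0.
have orth0 : orth 0 by move=> i; rewrite (psd0l ipP).
have Esup : has_sup E.
  split; last by exists cov_trace.
  by exists (cov 0 0); exists 0 => //; split => //; rewrite (psd0l ipP).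
pose M := sup E.
have covM h : orth h -> cov h h <= M * ip h h.
  move=> he; have [h0'|hn0] := eqVneq (ip h h) 0.
    by rewrite (hilbert_eq0 hP h0') (psd0l covP) (psd0l ipP) mulr0.
  have hp : 0 < ip h h by rewrite lt_def hn0 (psd_ge0 ipP).
  rewrite -ler_pdivrMr //.
  apply: (sup_upper_bound Esup).
  have k2 : (Num.sqrt (ip h h))^-1 * (Num.sqrt (ip h h))^-1 = (ip h h)^-1.
    by rewrite -expr2 exprVn sqr_sqrtr // ltW.
  exists ((Num.sqrt (ip h h))^-1 *: h).
    split; last by rewrite -[_ *: h]addr0; exact: orth_lin.
    by rewrite (psdZl ipP) (psdZr ipP) mulrA k2 mulVf.
  by rewrite (psdZl covP) (psdZr covP) mulrA k2 mulrC.
have M0 : 0 < M.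
  have := lt_le_trans h0p (covM _ h0e); rewrite pmulr_lgt0 //.
  rewrite lt_def (psd_ge0 ipP) andbT; apply: contraTneq h0p => /(hilbert_eq0 hP)->.
  by rewrite (psd0l covP) ltxx.
have /choice[h hE] : forall n : nat, exists h, [/\ ip h h <= 1, orth h &
    M - n.+1%:R^-1 < cov h h].
  move=> n; have n0 : 0 < (n.+1%:R : R)^-1 by rewrite invr_gt0 ltr0n.
  by have [_ [h [h1 he] <-] hM] := sup_adherent n0 Esup; exists h.
have h1 n : ip (h n) (h n) <= 1 by have [] := hE n.
have [phi [phik [l [l1 hl]]]] := weak_subsequence hP bP bT h1.
have lorth : orth l.
  move=> i; apply: (cvgn_unique (hl (e i))).
  by apply: cvg_near_cst; apply: nearW => n; have [_ ->] := hE (phi n).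
have lM : cov l l = M.
  apply: (cvgn_unique (cov_weak_cvg (fun n => h1 (phi n)) l1 hl)).
  apply: (@squeeze_cvgr _ _ _ _ (fun n => M - n.+1%:R^-1) (cst M)).
  - apply: nearW => n; have [hn1 hno hnM] := hE (phi n); apply/andP; split.
      apply: le_trans (ltW hnM); rewrite lerD2l lerN2 lef_pV2 ?posrE ?ltr0n //.
      by rewrite ler_nat ltnS.
    apply: (le_trans (covM _ hno)).
    by rewrite ler_piMr // ltW.
  - rewrite -[X in _ --> X]subr0; apply: cvgB; first exact: cvg_cst.
    by apply: (cvg_comp _ _ _ cvg_harmonic).
  - exact: cvg_cst.
exists l, M; split => //.
  by apply: contraTneq M0 => l0; rewrite -lM l0 (psd0l covP) ltxx.
have eig_orth u : orth u -> cov l u = M * ip l u.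
  move=> uo; pose a := M * ip l u - cov l u; pose q := M * ip u u - cov u u.
  have pos t : 0 <= 2 * t * a + t ^+ 2 * q.
    have := covM (t *: u + l) (orth_lin t uo lorth).
    rewrite -subr_ge0 (psdDD covP) (psdDD ipP) !(psdZl covP, psdZl ipP, psdZr covP, psdZr ipP).
    rewrite lM (psdC covP u) (psdC ipP u) => H.
    have Ml : M * ip l l - M <= 0 by rewrite subr_le0 ler_piMr // ltW.
    apply: (le_trans H); rewrite -subr_ge0 [X in 0 <= X](_ : _ = M - M * ip l l).
      by rewrite -opprB oppr_ge0.
    by rewrite /a /q; ring.
  have q0 : 0 <= q by rewrite subr_ge0 covM.
  have q1 : 0 < q + 1 by rewrite ltr_wpDl.
  (* this point makes the quadratic polynomial negative unless [a = 0]; it is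
     not the minimizer [- a / q] since [q] may vanish *)
  have := pos (- a / (q + 1)).
  rewrite (_ : _ + _ = - (a ^+ 2 * ((q + 2) / (q + 1) ^+ 2))); last first.
    by field; rewrite gt_eqF.
  rewrite oppr_ge0 pmulr_lle0; last first.
    by rewrite divr_gt0 ?exprn_gt0 // ltr_wpDl.
  move=> a2; have : a ^+ 2 == 0 by rewrite eq_le a2 sqr_ge0.
  by rewrite sqrf_eq0 subr_eq0 => /eqP ->.
move=> u; have [s [Ss uo _]] := ortho_projection hP eP u.
have [ls cs] := cov_orth_span lorth Ss.
rewrite -[u](subrK s) (psdDr covP) (psdDr ipP) ls cs !addr0.
exact: eig_orth.
Qed.

(** The part of [F x] orthogonal to all the eigenvectors vanishes almost
    everywhere: tested against each vector of a countable total family it is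
    a null vector of the covariance form. *)
Lemma cov_parseval :
  (forall h mu, mu != 0 -> orth h -> cov_eigen mu h -> h = 0) ->
  {ae N, forall x, \sum_(0 <= i < n) ip (F x) (e i) ^+ 2 @[n --> \oo]
                     --> ip (F x) (F x)}.
Proof.
move=> complete.
have null h : orth h -> cov h h = 0.
  move=> ho; apply: contrapT => /eqP h0.
  have hp : 0 < cov h h by rewrite lt_def h0 (psd_ge0 covP).
  have [g [M [M0 g0 go gM]]] := cov_top_eigen ho hp.
  by move: g0; rewrite (complete g M) ?eqxx // gt_eqF.
have proj j := ortho_projection hP eP (b j).
have [s sP] := choice proj.
have : {ae N, forall x, forall j, ip (F x) (b j - s j) = 0}.
  apply: ae_foralln => j; apply: cov_eq0; apply: null.
  by have [_ ? _] := sP j.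
apply: filterS => x Fx0.
have [t [Ft rO]] := ortho_projection hP eP (F x).
suff -> : F x - t = 0 by rewrite (psd0l ipP) subr0.
apply: bT => j; have [Sj bO _] := sP j.
have [rs _] := cov_orth_span rO Sj.
have [rt _] := cov_orth_span bO Ft.
rewrite -[b j](subrK (s j)) (psdDr ipP) rs addr0 (psdBl ipP) Fx0.
by rewrite (psdC ipP) rt subrr.
Qed.

(** Parseval's identity for [F x] is integrated term by term. *)
Lemma cov_trace_eigen :
  (forall h mu, mu != 0 -> orth h -> cov_eigen mu h -> h = 0) ->
  (\sum_(0 <= i <oo) (cov (e i) (e i))%:E = (cov_trace)%:E)%E.
Proof.
move=> complete.
under eq_eseriesr do rewrite /cov Rintegral_EFin ?integrable_ip_mul //.
rewrite -integral_nneseries //; last 2 first.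
- move=> i; exact: measurable_int (integrable_ip_mul _ _).
- by move=> i x _; rewrite lee_fin -expr2 sqr_ge0.
rewrite /cov_trace Rintegral_EFin; last exact: integrable_sqnorm.
apply: ae_eq_integral => //.
- apply: ge0_emeasurable_sum => [i x _ _|i _].
    by rewrite lee_fin -expr2 sqr_ge0.
  exact: measurable_int (integrable_ip_mul _ _).
- exact/measurable_EFinP/measurable_sqnorm.
- move: (cov_parseval complete); apply: filterS => x Fx _.
  apply: cvg_lim => //.
  apply: cvg_EFin; first by apply: nearW => n; rewrite sumEFin.
  apply: cvg_trans Fx; apply: near_eq_cvg; apply: nearW => n /=.
  by rewrite sumEFin /=; apply: eq_bigr => i _; rewrite expr2.
Qed.

End OrthogonalComplement.

End CovarianceForm.

(** * Eigenvalues of an integral operator with kernel [ip (F x) (F y)] *)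

Lemma sqr_integrable_Lfun2 {d} {T : measurableType d} {R : realType} (N : probability T R)
    (g : T -> R) : measurable_fun setT g ->
  N.-integrable setT (EFin \o (fun x => g x ^+ 2)) -> g \in Lfun N 2%:E.
Proof.
move=> mg g2; rewrite inE; apply/andP; split; first by rewrite inE.
rewrite inE /= /finite_norm unlock /= poweR_lty //.
move/integrableP : g2 => [_]; congr (_ < _)%E.
by apply: eq_integral => x _; rewrite /= powR_mulrn ?normr_ge0 // normrX.
Qed.

Section OrthonormalBasis.
Context {R : realType} {V : lmodType R} {ip : V -> V -> R}.
Hypothesis hP : hilbert ip.
Let ipP : psd_form ip := hP.

Definition lin_closed (S : V -> Prop) : Prop :=
  S 0 /\ forall a u w, S u -> S w -> S (a *: u + w).

Lemma gs_lin_closed (v : nat -> V) (S : V -> Prop) n : lin_closed S ->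
  (forall i, (i <= n)%N -> S (v i)) -> S (gs (ip := ip) v n).
Proof.
move=> [S0 SD]; elim/ltn_ind: n => n IH Sv.
apply: gs_closed => //; first exact: Sv.
by move=> i ni _; apply: IH => // j ji; apply: Sv; rewrite (leq_trans ji) // ltnW.
Qed.

(** The family is padded with zeros and orthonormalized: a zero among the first
    [n] results would be a linear relation. The third clause says that each [e i]
    is in the linear span of [v]. *)
Lemma orthonormal_basis n (v : 'I_n -> V) :
  (forall c : 'I_n -> R, \sum_(i < n) c i *: v i = 0 -> forall i, c i = 0) ->
  exists e : nat -> V,
  [/\ forall i j, i != j -> ip (e i) (e j) = 0,
      forall i, (i < n)%N -> ip (e i) (e i) = 1,
      forall S, lin_closed S -> (forall i, S (v i)) -> forall i, S (e i)
    & forall h, (forall i, (i < n)%N -> ip h (e i) = 0) ->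
        forall i, ip h (v i) = 0].
Proof.
move=> free.
pose w (k : nat) : V := if insub k is Some i then v i else 0.
have wE (i : 'I_n) : w i = v i by rewrite /w valK.
have w_out k : (n <= k)%N -> w k = 0.
  by move=> nk; rewrite /w insubF // ltnNge nk.
have closed S : lin_closed S -> (forall i, S (v i)) -> forall i, S (gs (ip := ip) w i).
  move=> SS Sv i; apply: gs_lin_closed => // j _.
  by rewrite /w; case: insubP => [k _ _|_] //; exact: SS.1.
exists (gs (ip := ip) w); split => //.
- exact: (gs_orthonormal hP w).1.
- move=> k kn; have [gk0|//] := gs_norm hP w k.
  pose S u := exists c : 'I_n -> R, (forall i : 'I_n, (k <= i)%N -> c i = 0) /\
     u = \sum_(i < n) c i *: v i.
  have SS : lin_closed S.
    split; first by exists (fun=> 0); split => //; rewrite big1 // => i _; rewrite scale0r.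
    move=> a x y [c [ck ->]] [c' [c'k ->]]; exists (fun i => a * c i + c' i); split.
      by move=> i ki; rewrite ck // c'k // mulr0 addr0.
    rewrite scaler_sumr -big_split; apply: eq_bigr => i _ /=.
    by rewrite scalerDl scalerA.
  have Sv j : (j < k)%N -> S (w j).
    move=> jk; exists (fun i : 'I_n => (val i == j)%:R); split.
      by move=> i ki; rewrite gtn_eqF // (leq_trans jk).
    have jn : (j < n)%N := ltn_trans jk kn.
    rewrite (bigD1 (Ordinal jn)) //= eqxx scale1r big1 ?addr0.
      by rewrite -[RHS]wE.
    move=> i ij; rewrite (_ : (val i == j) = false) ?scale0r //.
    by apply/negbTE; apply: contraNneq ij => ij; apply/eqP/val_inj.
  have Sg j : (j < k)%N -> S (gs (ip := ip) w j).
    by move=> jk; apply: gs_lin_closed => // i ij; apply: Sv; exact: leq_ltn_trans jk.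
  have [c [ck]] : S (w k).
    rewrite -[w k](subrK (\sum_(0 <= i < k) ip (w k) (gs (ip := ip) w i) *: gs (ip := ip) w i)).
    rewrite -/(gs_residue _ _) gs_residueE // gk0 scaler0 add0r big_nat.
    elim/big_rec : _ => [|i x ik Sx]; first exact: SS.1.
    by apply: SS.2 => //; exact: Sg.
  rewrite (wE (Ordinal kn)) => vE.
  suff /free/(_ (Ordinal kn))/eqP :
      \sum_(i < n) (c i - (val i == k)%:R) *: v i = 0.
    by rewrite ck //= eqxx sub0r oppr_eq0 oner_eq0.
  under eq_bigr do rewrite scalerBl.
  rewrite big_split /= -vE (bigD1 (Ordinal kn)) //= eqxx scale1r addrA subrr add0r.
  rewrite big1 // => i ik; rewrite (_ : (val i == k) = false) ?scale0r ?oppr0 //.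
  by apply/negbTE; apply: contraNneq ik => ik; apply/eqP/val_inj.
- move=> h hE i; rewrite -wE; apply: (gs_orth hP w h).2 => k.
  have [kn|nk] := ltnP k n; first exact: hE.
  rewrite gsE //; suff -> : gs_residue (ip := ip) w k = 0.
    by rewrite /normalize scaler0 (psd0r ipP).
  rewrite /gs_residue w_out // sub0r big1 ?oppr0 // => j _.
  by rewrite (psd0l ipP) scale0r.
Qed.

End OrthonormalBasis.

Section IntegralOperator.
Context {R : realType} {V : lmodType R} {ip : V -> V -> R}.
Hypothesis hP : hilbert ip.
Let ipP : psd_form ip := hP.
Context {b : nat -> V}.
Hypothesis bP : orthonormal_family (ip := ip) b.
Hypothesis bT : total_family (ip := ip) b.
Context {d} {T : measurableType d} (N : probability T R) (F : T -> V).
Hypothesis mFb : forall j, measurable_fun setT (fun x => ip (F x) (b j)).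
Hypothesis FFoo : (\int[N]_x (ip (F x) (F x))%:E < +oo)%E.
Context (A : (T -> R) -> T -> R).
Hypothesis AE : forall g, g \in Lfun N 2%:E ->
  {ae N, forall x, A g x = \int[N]_y (ip (F x) (F y) * g y)}.

Let mF u := measurable_ip hP bP bT mFb u.
Let iF2 u := integrable_ip_sqr hP bP bT mFb FFoo u.
Let iFF := integrable_sqnorm hP bP bT mFb FFoo.
Let cv := cov (ip := ip) N F.
Let eig := cov_eigen (ip := ip) N F.

Lemma Lfun2_measurable g : g \in Lfun N 2%:E -> measurable_fun setT g.
Proof. by rewrite inE => /andP[/[!inE]]. Qed.

Lemma Rintegral_ae_eq (f g : T -> R) :
  measurable_fun setT f -> measurable_fun setT g ->
  {ae N, forall x, f x = g x} -> \int[N]_x f x = \int[N]_x g x.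
Proof.
move=> mf mg fg; rewrite /Rintegral; congr fine; apply: ae_eq_integral => //.
- exact/measurable_EFinP.
- exact/measurable_EFinP.
- by apply: filterS fg => x -> _.
Qed.

(** The eigenspaces of the operator on $L^2$ and of the covariance form
    correspond by [h |-> ip (F x) h]. The inverse image of [g] is
    [mu^-1] times the weak integral of [g x *: F x], which Riesz' theorem
    provides. *)
Lemma eigenspace_to_cov mu g : mu != 0 -> eigenspace_L2 N A mu g ->
  exists h, eig mu h /\ {ae N, forall x, ip (F x) h = g x}.
Proof.
move=> mu0 [gL Ag]; have mg := Lfun2_measurable gL.
have g2 := Lfun2_integrable_sqr gL.
have iug u : N.-integrable setT (EFin \o (fun x => ip (F x) u * g x)).
  exact: integrable_mul_sqr.
pose L u := mu^-1 * \int[N]_x (ip (F x) u * g x).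
have iK : N.-integrable setT (EFin \o (fun x => ip (F x) (F x) + g x ^+ 2)).
  exact: (integrableD measurableT iFF g2).
pose K := \int[N]_x (ip (F x) (F x) + g x ^+ 2).
have LB u : L u ^+ 2 <= (mu^-1 * K) ^+ 2 * ip u u.
  rewrite /L [X in _ <= X]mulrC !exprMn [X in _ <= X]mulrCA.
  rewrite ler_wpM2l ?sqr_ge0 // -[ip u u]sqr_sqrtr ?(psd_ge0 ipP) // -exprMn.
  rewrite -[X in X <= _]real_normK ?num_real // ler_pXn2r ?nnegrE //; last first.
    rewrite mulr_ge0 ?sqrtr_ge0 //; apply: Rintegral_ge0 => x _.
    by rewrite addr_ge0 ?sqr_ge0 ?(psd_ge0 ipP).
  apply: (le_trans (le_normr_Rintegral measurableT (iug u))).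
  rewrite /K -RintegralZl //; apply: le_Rintegral => //.
  - exact: (integrable_norm (iug u)).
  - exact: (integrableZl measurableT _ iK).
  move=> x _; rewrite normrM (le_trans (ler_wpM2r (normr_ge0 _) (psd_abs_CS ipP _ _))) //.
  rewrite -mulrA mulrCA ler_wpM2l ?sqrtr_ge0 //.
  have := sqr_ge0 (Num.sqrt (ip (F x) (F x)) - `|g x|).
  rewrite sqrrB sqr_sqrtr ?(psd_ge0 ipP) // real_normK ?num_real // mulr2n.
  have := psd_ge0 ipP (F x); have := sqr_ge0 (g x); lra.
have [r rP] : exists r, forall u, ip r u = L u.
  apply: (riesz hP bP bT (B := (mu^-1 * K) ^+ 2)) LB => a u v.
  rewrite /L mulrCA -mulrDr; congr (_ * _).
  rewrite -RintegralZl // -RintegralD //; last exact: (integrableZl measurableT a (iug u)).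
  by apply: eq_Rintegral => x _; rewrite (psdDr ipP) (psdZr ipP); ring.
have rg : {ae N, forall x, ip (F x) r = g x}.
  apply: filterS2 (AE gL) Ag => x -> Agx.
  rewrite (psdC ipP) rP /L.
  apply: (mulfI mu0); rewrite mulVKf // -Agx; apply: eq_Rintegral => y _.
  by rewrite (psdC ipP).
exists r; split => // u; rewrite rP /L mulVKf //.
apply: Rintegral_ae_eq; [exact: measurable_funM|exact: measurable_funM|].
by apply: filterS rg => x ->; rewrite mulrC.
Qed.

Lemma cov_to_eigenspace mu h : eig mu h ->
  eigenspace_L2 N A mu (fun x => ip (F x) h).
Proof.
move=> hmu; have gL : (fun x => ip (F x) h) \in Lfun N 2%:E by exact: sqr_integrable_Lfun2.
split => //; apply: filterS (AE gL) => x ->.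
rewrite (psdC ipP (F x) h) -hmu /cov; apply: eq_Rintegral => y _.
by rewrite (psdC ipP (F x)) mulrC.
Qed.

Lemma cov_multiplicity mu n : mu != 0 -> has_multiplicity N A mu n ->
  exists v : 'I_n -> V,
  [/\ forall i, eig mu (v i),
      forall c : 'I_n -> R, \sum_(i < n) c i *: v i = 0 -> forall i, c i = 0
    & forall h, eig mu h -> exists c : 'I_n -> R, h = \sum_(i < n) c i *: v i].
Proof.
move=> mu0 [phi [phiE free gen]].
have /choice[v vP] i := eigenspace_to_cov mu0 (phiE i).
have sumE (c : 'I_n -> R) : {ae N, forall x,
    ip (F x) (\sum_(i < n) c i *: v i) = \sum_(i < n) c i * phi i x}.
  have : {ae N, forall x, forall i, ip (F x) (v i) = phi i x}.
    by apply: filter_forall => i; exact: (vP i).2.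
  apply: filterS => x vx; rewrite (psd_sumr ipP); apply: eq_bigr => i _.
  by rewrite (psdZr ipP) vx.
exists v; split=> [i|c c0|h hmu]; first exact: (vP i).1.
- apply: free; apply: filterS (sumE c) => x <-.
  by rewrite c0 (psd0r ipP).
- have [c hc] := gen _ (cov_to_eigenspace hmu); exists c.
  apply/subr0_eq/(hilbert_eq0 hP); set k := h - _.
  suff H u : mu * ip h u = mu * ip (\sum_(i < n) c i *: v i) u.
    by rewrite (psdBl ipP) (mulfI mu0 (H k)) subrr.
  have eS : eig mu (\sum_(i < n) c i *: v i).
    move=> w; rewrite (psd_suml (cov_psd hP bP bT mFb FFoo)) (psd_suml ipP) mulr_sumr.
    apply: eq_bigr => i _.
    rewrite (psdZl (cov_psd hP bP bT mFb FFoo)) (psdZl ipP) (vP i).1; ring.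
  rewrite -hmu -eS; apply: Rintegral_ae_eq.
  + by apply: measurable_funM; exact: mF.
  + by apply: measurable_funM; exact: mF.
  + by apply: filterS2 hc (sumE c) => x -> ->.
Qed.

Context {lam : nat -> R}.
Hypothesis lamP : eigenvalue_sequence N A lam.

(** The bijection between the indices of the value [mu] and a basis of the
    eigenspace numbers an orthonormal basis by these indices. *)
Lemma cov_level_basis mu : mu != 0 -> exists e : nat -> V,
  [/\ forall l, eig mu (e l),
      forall l, lam l = mu -> ip (e l) (e l) = 1,
      forall l l', lam l = mu -> lam l' = mu -> l != l' -> ip (e l) (e l') = 0
    & forall h, eig mu h -> (forall l, lam l = mu -> ip h (e l) = 0) -> h = 0].
Proof.
move=> mu0; have [n mult /card_set_bijP[f [fE finj fsurj]]] := lamP mu0.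
have [v [vE free gen]] := cov_multiplicity mu0 mult.
have [e [e_orth e_norm e_closed e_span]] := orthonormal_basis hP free.
have covP := cov_psd hP bP bT mFb FFoo.
exists (e \o f); split.
- move=> l; apply: e_closed => //; split.
    by move=> u; rewrite (psd0l covP) (psd0l ipP) mulr0.
  move=> a u w Hu Hw z; rewrite (psd_linl covP) (psd_linl ipP) Hu Hw; ring.
- by move=> l lmu; apply: e_norm; exact: fE.
- move=> l l' lmu l'mu ll'; apply: e_orth; apply: contraNneq ll' => ff.
  by apply/eqP; apply: finj; rewrite ?inE.
- move=> h hmu ho; have [c hc] := gen h hmu.
  have hv : forall i, ip h (v i) = 0.
    apply: e_span => i ni; have [l lmu <-] := fsurj i ni; exact: ho.
  apply: (hilbert_eq0 hP); rewrite {2}hc (psd_sumr ipP) big1 // => i _.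
  by rewrite (psdZr ipP) hv mulr0.
Qed.

(** The indices with [lam l = 0] get the zero vector: eigenvectors for the value
    [0] contribute nothing to the trace. *)
Lemma cov_eigenbasis : exists e : nat -> V,
  [/\ orthonormal_family (ip := ip) e,
      forall l, eig (lam l) (e l),
      forall l, cv (e l) (e l) = lam l
    & forall h mu, mu != 0 -> (forall l, ip h (e l) = 0) -> eig mu h -> h = 0].
Proof.
have covP := cov_psd hP bP bT mFb FFoo.
have : forall mu, exists e : nat -> V, mu != 0 ->
  [/\ forall l, eig mu (e l),
      forall l, lam l = mu -> ip (e l) (e l) = 1,
      forall l l', lam l = mu -> lam l' = mu -> l != l' -> ip (e l) (e l') = 0
    & forall h, eig mu h -> (forall l, lam l = mu -> ip h (e l) = 0) -> h = 0].
  move=> mu; have [->|/cov_level_basis[e eP]] := eqVneq mu 0; last by exists e.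
  by exists (fun=> 0).
move=> /choice[E EP].
pose e l := if lam l == 0 then 0 else E (lam l) l.
have eE l : eig (lam l) (e l).
  rewrite /e; case: ifPn => [/eqP ->|/EP[]//].
  by move=> u; rewrite (psd0l covP) mul0r.
have e1 l : lam l != 0 -> ip (e l) (e l) = 1.
  by move=> l0; rewrite /e (negbTE l0); have [_ ->] := EP _ l0.
have e0 l : lam l = 0 -> e l = 0 by move=> l0; rewrite /e l0 eqxx.
exists e; split => //.
- split=> [i j ij|i]; last first.
    by have [/e0|/e1] := eqVneq (lam i) 0; [left|right].
  have [lij|lij] := eqVneq (lam i) (lam j).
    have [/e0 ->|j0] := eqVneq (lam j) 0; first by rewrite (psd0r ipP).
    by rewrite /e lij (negbTE j0); have [_ _ ->] := EP _ j0.
  (* eigenvectors of a symmetric form for distinct eigenvalues are orthogonal *)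
  apply/eqP; have := eE j (e i); rewrite (psdC covP) eE (psdC ipP (e j)).
  move/eqP; rewrite -subr_eq0 -mulrBl mulf_eq0 subr_eq0 (negbTE lij).
  by case/orP.
- move=> l; rewrite /cv eE; have [l0|l0] := eqVneq (lam l) 0.
    by rewrite l0 mul0r.
  by rewrite e1 ?mulr1.
- move=> h mu mu0 ho hmu; have [_ _ _] := EP _ mu0; apply => // l lmu.
  by have := ho l; rewrite /e lmu (negbTE mu0).
Qed.

Theorem sum_eigenvalues : (forall l, 0 <= lam l) /\
  (\sum_(0 <= l <oo) (lam l)%:E = (cov_trace (ip := ip) N F)%:E)%E.
Proof.
have [e [eP eE elam ec]] := cov_eigenbasis.
split=> [l|]; first by rewrite -elam; exact: psd_ge0 (cov_psd hP bP bT mFb FFoo) _.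
rewrite -(cov_trace_eigen hP bP bT mFb FFoo eP eE) //.
by apply: eq_eseriesr => l _; rewrite -elam.
Qed.

End IntegralOperator.

(** * Differentiating Laplace transforms *)

Lemma norm_le_expR (R : realType) (x : R) : `|x| <= expR x + expR (- x).
Proof.
have H (y : R) : y <= expR y by apply: le_trans (expR_ge1Dx y); rewrite lerDr.
have := H x; have := H (- x); have := expR_ge0 x; have := expR_ge0 (- x).
by rewrite ler_norml => ? ? ? ?; apply/andP; split; lra.
Qed.

Lemma expR_between (R : realType) (p q r x : R) : p <= r <= q ->
  expR (r * x) <= expR (p * x) + expR (q * x).
Proof.
move=> /andP[pr rq]; have [x0|x0] := leP 0 x.
  apply: (@le_trans _ _ (expR (q * x))); last by rewrite lerDr expR_ge0.
  by rewrite ler_expR ler_wpM2r.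
apply: (@le_trans _ _ (expR (p * x))); last by rewrite lerDl expR_ge0.
by rewrite ler_expR ler_wnM2r // ltW.
Qed.

Lemma is_derive_exp_linear (R : realType) (k c s : R) :
  is_derive s 1 (fun t : R => k * expR (t * c)) (k * c * expR (s * c)).
Proof.
have D1 : is_derive s 1 (fun t : R => t * c) c.
  have := is_deriveM (is_derive_id s 1) (is_derive_cst c s 1).
  by rewrite scaler0 add0r scaler1.
have D2 := @is_derive1_comp R expR (fun t => t * c) s _ _ (is_derive_expR (s * c)) D1.
have := is_deriveZ k D2.
rewrite (_ : k *: _ = k * c * expR (s * c)) //.
by rewrite /GRing.scale /=; ring.
Qed.

Section Laplace.
Context {d} {T : measurableType d} {R : realType} (mu : {measure set T -> \bar R}).
Context {X g : T -> R}.
Hypotheses (mX : measurable_fun setT X) (mg : measurable_fun setT g).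
Hypothesis gi : forall s,
  mu.-integrable setT (EFin \o (fun x => g x * expR (s * X x))).

Let mexp s : measurable_fun setT (fun x => expR (s * X x)).
Proof. by apply: measurableT_comp => //; exact: measurable_funM. Qed.

(** A bound, uniform for parameters at distance at most 1 from [s], for the
    derivative of the integrand: the factor [X x] is at most
    [expR (X x) + expR (- X x)], which shifts the parameter by one more unit. *)
Let bound s x := `|g x| * (2 * (expR ((s + 2) * X x) + expR ((s - 2) * X x))).

Let bound_integrable s : mu.-integrable setT (EFin \o bound s).
Proof.
have H t : mu.-integrable setT (EFin \o (fun x => `|g x * expR (t * X x)|)).
  exact: integrable_norm.
have := integrableZl measurableT 2 (integrableD measurableT (H (s + 2)) (H (s - 2))).
apply: eq_integrable => // x _ /=; rewrite -EFinD -EFinM /bound; congr EFin.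
by rewrite !normrM !(ger0_norm (expR_ge0 _)); ring.
Qed.

Let boundP s t x : s - 1 <= t <= s + 1 ->
  `|g x * X x * expR (t * X x)| <= bound s x.
Proof.
move=> st; rewrite !normrM (ger0_norm (expR_ge0 _)) -mulrA ler_wpM2l //.
apply: le_trans (ler_wpM2r (expR_ge0 _) (norm_le_expR _)) _.
rewrite mulrDl -!expRD mulr_natl mulr2n.
have -> : X x + t * X x = (t + 1) * X x by ring.
have -> : - X x + t * X x = (t - 1) * X x by ring.
rewrite [expR ((s + 2) * _) + _]addrC.
by apply: lerD; apply: expR_between; lra.
Qed.

Lemma laplace_moment_integrable s :
  mu.-integrable setT (EFin \o (fun x => g x * X x * expR (s * X x))).
Proof.
apply: integrable_dominated (bound_integrable s).
  by apply: measurable_funM => //; exact: measurable_funM.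
by move=> x; apply: boundP; lra.
Qed.

Lemma laplace_moment (phi phi' : R -> R) :
  (forall s, \int[mu]_x (g x * expR (s * X x)) = phi s) ->
  (forall s : R, is_derive s 1 phi (phi' s)) ->
  forall s, \int[mu]_x (g x * X x * expR (s * X x)) = phi' s.
Proof.
move=> phiE dphi s.
have D (t : R) x : is_derive t 1 (fun r : R => g x * expR (r * X x))
    (g x * X x * expR (t * X x)) by exact: is_derive_exp_linear.
have dE t x : partial1of2 (fun r x => g x * expR (r * X x)) t x =
    g x * X x * expR (t * X x).
  by rewrite partial1of2E; have [] := D t x.
have Is : s \in `]s - 1, s + 1[ by rewrite in_itv /=; lra.
have b0 x : 0 <= bound s x by rewrite /bound mulr_ge0 // mulr_ge0 // addr_ge0 ?expR_ge0.
have ub t x : `]s - 1, s + 1[%classic t -> setT x ->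
    `|partial1of2 (fun r x => g x * expR (r * X x)) t x| <= bound s x.
  by rewrite /= in_itv /= => st _; rewrite dE; apply: boundP; lra.
have := @differentiation_under_integral R _ T mu
  (fun r x => g x * expR (r * X x)) setT measurableT s (s - 1) (s + 1) Is
  (fun t _ => gi t) (fun t x _ _ => @ex_derive _ _ _ _ _ _ _ (D t x)) (bound s)
  b0 (bound_integrable s) ub.
rewrite (_ : (fun x' => _) = phi); last by apply/funext => t; exact: phiE.
rewrite derive1E (@derive_val _ _ _ _ _ _ _ (dphi s)) => ->.
by apply: eq_Rintegral => x _; rewrite dE.
Qed.

End Laplace.

(** * Gaussian integrals *)

Section BorelColumnVectors.
Context {R : realType} {n : nat}.

Lemma measurable_coord (i : 'I_n) :
  measurable_fun setT (fun z : borel_cV R n => (z : 'cV[R]_n) i 0).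
Proof.
move=> _ B mB; rewrite setTI; apply: sub_sigma_algebra.
by exists i, B.
Qed.

Lemma measurable_to_cV {d} {T : measurableType d} (f : T -> borel_cV R n) :
  (forall i, measurable_fun setT (fun x => (f x : 'cV[R]_n) i 0)) ->
  measurable_fun setT f.
Proof.
move=> mf; apply: (@measurability _ _ T (borel_cV R n) setT f (@cylinders R n)) => //.
move=> _ [_ [i [B [mB ->]]] <-].
exact: (mf i measurableT B mB).
Qed.

Definition rectangles : set (set (borel_cV R n)) :=
  [set A | exists B : 'I_n -> set R, (forall i, measurable (B i)) /\
     A = [set z : 'cV[R]_n | forall i, B i (z i 0)]].

Lemma measurable_rectangle A : rectangles A -> measurable A.
Proof.
move=> [B [mB ->]].
rewrite (_ : [set z | _] = \bigcap_(i in [set: 'I_n])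
   [set z : 'cV[R]_n | B i (z i 0)]); last first.
  by apply/seteqP; split=> z /= Bz i; [move=> _|]; apply: Bz.
apply: fin_bigcap_measurable; first exact: finite_finset.
by move=> i _; apply: sub_sigma_algebra; exists i, (B i).
Qed.

(** Rectangles are stable under intersection and generate the Borel sets. *)
Lemma rectangles_unique (m1 m2 : probability (borel_cV R n) R) :
  (forall A, rectangles A -> m1 A = m2 A) ->
  forall A, measurable A -> m1 A = m2 A.
Proof.
move=> m12 A mA; apply: (measure_unique rectangles (fun=> setT)) => //.
- apply/seteqP; split.
    apply: smallest_sub; first exact: smallest_sigma_algebra.
    move=> _ [i [B [mB ->]]]; apply: sub_sigma_algebra.
    exists (fun j => if j == i then B else setT); split.
      by move=> j; case: ifP.
    apply/seteqP; split=> z /= zB; last by have := zB i; rewrite eqxx.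
    by move=> j; case: ifPn => // /eqP ->.
  apply: smallest_sub; first exact: sigma_algebra_measurable.
  exact: measurable_rectangle.
- move=> _ _ [B [mB ->]] [C [mC ->]]; exists (fun i => B i `&` C i); split.
    by move=> i; exact: measurableI.
  apply/seteqP; split=> z /=; first by move=> [zB zC] i; split.
  by move=> zBC; split=> i; have [] := zBC i.
- by move=> _; exists (fun=> setT); split => //; apply/seteqP.
- by rewrite bigcup_const //; exists 0%N.
- by move=> _; rewrite (le_lt_trans (probability_le1 _ _)) // ltry.
Qed.

End BorelColumnVectors.

Lemma ord_cons_ind n (P : 'I_n.+1 -> Prop) :
  P 0 -> (forall j : 'I_n, P (rshift 1 j)) -> forall i, P i.
Proof.
move=> P0 PS i; have [j ->|->//] := unliftP 0 i.
by rewrite (_ : lift 0 j = rshift 1 j) //; exact: val_inj.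
Qed.

Section Product.
Context {R : realType} {n : nat}.
Notation N01 := (normal_prob (0 : R) 1).

Definition tail_cV (z : borel_cV R n.+1) : borel_cV R n :=
  @dsubmx R 1 n 1 z.

Definition cons_cV (p : measurableTypeR R * borel_cV R n) : borel_cV R n.+1 :=
  @col_mx R 1 n 1 (const_mx p.1) p.2.

Lemma measurable_tail_cV : measurable_fun setT tail_cV.
Proof.
apply: measurable_to_cV => i; rewrite /tail_cV.
by under eq_fun do rewrite mxE; exact: measurable_coord.
Qed.

Lemma cons_cV0 p : cons_cV p 0 0 = p.1.
Proof.
have -> : (0 : 'I_n.+1) = lshift n (0 : 'I_1) by apply: val_inj.
by apply: etrans (@col_mxEu R 1 n 1 (const_mx p.1) p.2 0 0) _; rewrite mxE.
Qed.

Lemma cons_cVS p (i : 'I_n) : cons_cV p (rshift 1 i) 0 = (p.2 : 'cV[R]_n) i 0.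
Proof. exact: (@col_mxEd R 1 n 1 (const_mx p.1) p.2 i 0). Qed.

Lemma measurable_cons_cV : measurable_fun setT cons_cV.
Proof.
apply: measurable_to_cV; apply: ord_cons_ind => [|j].
  by under eq_fun do rewrite cons_cV0; exact: measurable_fst.
under eq_fun do rewrite cons_cVS.
exact: (measurableT_comp (measurable_coord _) measurable_snd).
Qed.

HB.instance Definition _ := isMeasurableFun.Build _ _ _ _ tail_cV measurable_tail_cV.
HB.instance Definition _ := isMeasurableFun.Build _ _ _ _ cons_cV measurable_cons_cV.

Context {G : probability (borel_cV R n.+1) R} (Gstd : std_gaussian G).

Definition tail_law : probability (borel_cV R n) R := distribution G tail_cV.

Lemma rect_prob_split (B0 : set R) (B : 'I_n -> set R) :
  measurable B0 -> (forall i, measurable (B i)) ->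
  G [set z : 'cV[R]_n.+1 | B0 (z 0 0) /\ forall i, B i (z (rshift 1 i) 0)] =
  (N01 B0 * \prod_(i < n) N01 (B i))%E.
Proof.
move=> mB0 mB.
pose C (i : 'I_n.+1) := if unlift 0 i is Some j then B j else B0.
have C0 : C 0 = B0 by rewrite /C unlift_none.
have CS i : C (rshift 1 i) = B i.
  by rewrite (_ : rshift 1 i = lift 0 i) ?/C ?liftK //; exact: val_inj.
have := Gstd (B := C).
rewrite big_ord_recl C0.
rewrite (eq_bigr (fun i => N01 (B i))) => [|i _]; last first.
  by rewrite -CS; congr (N01 (C _)); exact: val_inj.
move=> <-; last by move=> i; rewrite /C; case: unlift.
congr (G _); apply/seteqP; split=> z /=.
  by move=> [z0 zS]; apply: ord_cons_ind => [|j]; rewrite ?C0 ?CS.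
by move=> zC; split=> [|i]; [rewrite -C0|rewrite -CS]; exact: zC.
Qed.

Lemma tail_law_std : std_gaussian tail_law.
Proof.
move=> B mB; transitivity (G [set z : 'cV[R]_n.+1 |
    [set: R] (z 0 0) /\ forall i, B i (z (rshift 1 i) 0)]).
  congr (G _); apply/seteqP; split=> z /= => [zB|[_ zB]].
    by split => // i; have := zB i; rewrite /tail_cV mxE.
  by move=> i; rewrite /tail_cV mxE.
by rewrite rect_prob_split // probability_setT mul1e.
Qed.

Lemma std_gaussian_prod A : measurable A ->
  G A = distribution (N01 \x tail_law)%E cons_cV A.
Proof.
apply: rectangles_unique => _ [B [mB ->]].
have -> : [set z : 'cV[R]_n.+1 | forall i, B i (z i 0)] =
    [set z : 'cV[R]_n.+1 | B 0 (z 0 0) /\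
      forall i, B (rshift 1 i) (z (rshift 1 i) 0)].
  apply/seteqP; split=> z /=; first by move=> zB; split.
  by move=> [z0 zS]; apply: ord_cons_ind.
apply: etrans (rect_prob_split (B0 := B 0) (B := fun i => B (rshift 1 i)) _ _) _ => //.
transitivity ((N01 \x tail_law)%E (B 0 `*`
   [set z : 'cV[R]_n | forall i, B (rshift 1 i) (z i 0)])); last first.
  congr ((N01 \x tail_law)%E _); apply/seteqP; split=> -[x z] /=; rewrite cons_cV0.
    by move=> [xB zB]; split => // i; rewrite cons_cVS.
  by move=> [xB zB]; split => // i; have := zB i; rewrite cons_cVS.
rewrite product_measure1E //=; last first.
  by apply: measurable_rectangle; exists (fun i => B (rshift 1 i)).
  exact: mB.
congr (_ * _)%E; apply: esym.
exact: (tail_law_std (B := fun i => B (rshift 1 i))).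
Qed.

Lemma std_gaussian_fubini (f : borel_cV R n.+1 -> \bar R) :
  measurable_fun setT f -> (forall z, 0 <= f z)%E ->
  (\int[G]_z f z = \int[tail_law]_v \int[N01]_x f (cons_cV (x, v)))%E.
Proof.
move=> mf f0.
rewrite (eq_measure_integral (distribution (N01 \x tail_law)%E cons_cV)); last first.
  by move=> A mA _; exact: std_gaussian_prod.
rewrite ge0_integral_distribution //.
have mfc := measurableT_comp mf measurable_cons_cV.
apply: etrans (@fubini_tonelli2 _ _ _ _ _ N01 tail_law _ mfc _) _ => //.
by move=> p; exact: f0.
Qed.

End Product.

Section NormalLaplace.
Context {R : realType}.
Notation N01 := (normal_prob (0 : R) 1).
Notation mu := (@lebesgue_measure R).

(** The normal law is defined by its values on sets; its density is recovered
    as its Radon-Nikodym derivative. *)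
Lemma integral_normal_density (m s : R) (f : measurableTypeR R -> \bar R) :
  measurable_fun setT f -> (forall x, 0 <= f x)%E ->
  (\int[normal_prob m s]_x f x = \int[mu]_x (f x * (normal_pdf m s x)%:E))%E.
Proof.
move=> mf f0.
have dom := normal_prob_dominates m s.
rewrite -(Radon_Nikodym_SigmaFinite.change_of_variables dom) //.
apply: ae_eq_integral => //.
- apply: emeasurable_funM => //; apply: (measurable_int mu).
  exact: Radon_Nikodym_SigmaFinite.f_integrable.
- apply: emeasurable_funM => //; apply/measurable_EFinP.
  exact: measurable_normal_pdf.
- apply: ae_eqe_mul2l; apply: integral_ae_eq => //.
  + exact: Radon_Nikodym_SigmaFinite.f_integrable.
  + by apply/measurable_EFinP; exact: measurable_normal_pdf.
  + by move=> E _ mE; rewrite -Radon_Nikodym_SigmaFinite.f_integral.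
Qed.

Lemma measurable_gauss_weight1 (q b : R) :
  measurable_fun setT (fun x : R => expR (- ((q - 1) * x ^+ 2) / 2 + b * x)).
Proof.
apply: measurableT_comp => //; apply: measurable_funD; last exact: measurable_funM.
apply: measurable_funM => //; apply: measurableT_comp => //.
by apply: measurable_funM => //; exact: measurable_funX.
Qed.

(** Completing the square turns the integrand into a multiple of the density of
    the normal law of mean [b / q] and variance [q^-1]. *)
Lemma normal_laplace (q b : R) : 0 < q ->
  (\int[N01]_x (expR (- ((q - 1) * x ^+ 2) / 2 + b * x))%:E =
   ((Num.sqrt q)^-1 * expR (b ^+ 2 / (2 * q)))%:E)%E.
Proof.
move=> q0.
have sq0 : 0 < Num.sqrt q by rewrite sqrtr_gt0.
have s0 : (Num.sqrt q)^-1 != 0 by rewrite invr_eq0 gt_eqF.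
have s2 : (Num.sqrt q)^-1 ^+ 2 = q^-1 by rewrite exprVn sqr_sqrtr // ltW.
rewrite integral_normal_density; last 2 first.
- by apply/measurable_EFinP; exact: measurable_gauss_weight1.
- by move=> x; rewrite lee_fin expR_ge0.
transitivity (\int[mu]_x (((Num.sqrt q)^-1 * expR (b ^+ 2 / (2 * q)))%:E *
    (normal_pdf (b / q) (Num.sqrt q)^-1 x)%:E))%E.
  apply: eq_integral => x _; rewrite -!EFinM; congr EFin.
  rewrite !normal_pdfE ?oner_eq0 // /normal_peak /normal_fun s2 expr1n mul1r.
  rewrite -(mulrnAr q^-1) sqrtrM ?invr_ge0 ?ltW // sqrtrV ?ltW //.
  have k0 : Num.sqrt (pi *+ 2) != 0 :> R.
    by rewrite gt_eqF // sqrtr_gt0 pmulrn_lgt0 // pi_gt0.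
  have EE : expR (- ((q - 1) * x ^+ 2) / 2 + b * x) * expR (- (x - 0) ^+ 2 / (1 *+ 2)) =
      expR (b ^+ 2 / (2 * q)) * expR (- (x - b / q) ^+ 2 / (q^-1 *+ 2)).
    rewrite -!expRD; congr expR; rewrite -[q^-1 *+ 2]mulr_natl -[1 *+ 2]/(2 : R).
    by field; rewrite gt_eqF.
  rewrite mulrCA EE; field.
  by rewrite k0 gt_eqF.
rewrite ge0_integralZl //.
- by rewrite integral_normal_pdf mule1.
- by apply/measurable_EFinP; exact: measurable_normal_pdf.
- by move=> x _; rewrite lee_fin normal_pdf_ge0.
Qed.

End NormalLaplace.

Section DotProduct.
Context {R : realType}.

Definition dotc n (u v : 'cV[R]_n) : R := (u^T *m v) 0 0.

Lemma dotcE n (u v : 'cV[R]_n) : dotc u v = \sum_i u i 0 * v i 0.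
Proof. by rewrite /dotc mxE; apply: eq_bigr => i _; rewrite mxE. Qed.

Lemma dotcC n (u v : 'cV[R]_n) : dotc u v = dotc v u.
Proof. by rewrite !dotcE; apply: eq_bigr => i _; rewrite mulrC. Qed.

Lemma dotcDl n (u v w : 'cV[R]_n) : dotc (u + v) w = dotc u w + dotc v w.
Proof. by rewrite /dotc linearD mulmxDl mxE. Qed.

Lemma dotcZl n a (u w : 'cV[R]_n) : dotc (a *: u) w = a * dotc u w.
Proof. by rewrite /dotc linearZ /= -scalemxAl mxE. Qed.

Lemma dotcNl n (u w : 'cV[R]_n) : dotc (- u) w = - dotc u w.
Proof. by rewrite -scaleN1r dotcZl mulN1r. Qed.

Lemma dotcDr n (u v w : 'cV[R]_n) : dotc w (u + v) = dotc w u + dotc w v.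
Proof. by rewrite !(dotcC w) dotcDl. Qed.

Lemma dotcZr n a (u w : 'cV[R]_n) : dotc w (a *: u) = a * dotc w u.
Proof. by rewrite !(dotcC w) dotcZl. Qed.

Lemma dotcNr n (u w : 'cV[R]_n) : dotc w (- u) = - dotc w u.
Proof. by rewrite !(dotcC w) dotcNl. Qed.

Lemma dotc_mulmx n m (A : 'M[R]_(n, m)) u v :
  dotc u (A *m v) = dotc (A^T *m u) v.
Proof. by rewrite /dotc trmx_mul trmxK mulmxA. Qed.

Lemma mulmx_outer n (r v : 'cV[R]_n) : r *m r^T *m v = dotc r v *: r.
Proof.
by apply/matrixP => i j; rewrite !ord1 -mulmxA [LHS]mxE big_ord1 [RHS]mxE mulrC.
Qed.

Lemma dotc_delta n (u : 'cV[R]_n) i : dotc (delta_mx i 0) u = u i 0.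
Proof.
rewrite dotcE (bigD1 i) //= big1 => [|j ji]; rewrite !mxE ?eqxx ?mul1r ?addr0 //.
by rewrite (negbTE ji) mul0r.
Qed.

Lemma dotc_ge0 n (u : 'cV[R]_n) : 0 <= dotc u u.
Proof. by rewrite dotcE sumr_ge0 // => i _; rewrite -expr2 sqr_ge0. Qed.

Lemma dotc_eq0 n (u : 'cV[R]_n) : dotc u u = 0 -> u = 0.
Proof.
rewrite dotcE => /eqP; rewrite psumr_eq0; last by move=> i _; rewrite -expr2 sqr_ge0.
move=> /allP u0; apply/colP => i; rewrite mxE.
by have := u0 i; rewrite mem_index_enum -expr2 sqrf_eq0 => /(_ isT)/eqP.
Qed.

Lemma dotc_col n (x y : R) (u v : 'cV[R]_n) :
  dotc (col_mx (const_mx x : 'M[R]_1) u) (col_mx (const_mx y : 'M[R]_1) v) =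
  x * y + dotc u v.
Proof.
rewrite /dotc tr_col_mx mul_row_col mxE; congr (_ + _).
by rewrite mxE big_ord1 !mxE.
Qed.

Definition posdef n (Q : 'M[R]_n) : Prop :=
  Q^T = Q /\ forall v, v != 0 -> 0 < dotc v (Q *m v).

(** One step of the Gaussian elimination of a symmetric matrix; [S] is the Schur
    complement of the corner [q]. *)
Lemma posdef_block n (Q : 'M[R]_(1 + n)) : posdef Q ->
  let q := Q 0 0 in let r := dlsubmx Q in
  let S := drsubmx Q - q^-1 *: (r *m r^T) in
  [/\ 0 < q,
      forall x v, Q *m col_mx (const_mx x) v =
        col_mx (const_mx (q * x + dotc r v)) (x *: r + drsubmx Q *m v),
      posdef S & \det Q = q * \det S].
Proof.
move=> [QT Qpos] q r S.
have E11 (A : 'M[R]_1) : A = const_mx (A 0 0) by apply/matrixP => i j; rewrite !ord1 mxE.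
have qE : ulsubmx Q = const_mx q.
  by rewrite [LHS]E11 !mxE /q; congr (const_mx (Q _ _)); apply: val_inj.
have rE : ursubmx Q = r^T by rewrite /r trmx_dlsub QT.
have dT : (drsubmx Q)^T = drsubmx Q by rewrite trmx_drsub QT.
have Qmul x v : Q *m col_mx (const_mx x) v =
    col_mx (const_mx (q * x + dotc r v)) (x *: r + drsubmx Q *m v).
  rewrite -{1}[Q]submxK mul_block_col qE rE -/r; congr col_mx.
    apply/matrixP => i j; rewrite !ord1 !mxE big_ord1 !mxE; congr (_ + _).
    by rewrite dotcE; apply: eq_bigr => k _; rewrite !mxE.
  congr (_ + _); apply/matrixP => i j; rewrite !ord1 !mxE big_ord1 mxE mulrC.
  by congr (_ * _); rewrite /r !mxE.
have col_eq0 x v : col_mx (const_mx x : 'M[R]_1) v = 0 -> x = 0 /\ v = 0 :> 'cV_n.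
  move=> /(congr1 (fun A => (usubmx A, dsubmx A))); rewrite col_mxKu col_mxKd.
  rewrite !linear0 => -[/matrixP/(_ 0 0) + ->]; by rewrite !mxE.
have q0 : 0 < q.
  have := Qpos (col_mx (const_mx 1) 0).
  rewrite Qmul dotc_col mulmx0 !dotcE !big1 => [|i _|i _]; rewrite ?mxE ?mulr0 ?mul0r //.
  rewrite !addr0 mul1r mulr1; apply; apply/eqP => /col_eq0[/eqP].
  by rewrite oner_eq0.
have q0' : q != 0 by rewrite gt_eqF.
split=> //.
  split; first by rewrite /S linearB linearZ /= trmx_mul trmxK dT.
  move=> v v0.
  have := Qpos (col_mx (const_mx (- (dotc r v / q))) v).
  rewrite Qmul dotc_col dotcDr dotcZr (dotcC v r) /S mulmxBl dotcDr dotcNr.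
  rewrite -scalemxAl mulmx_outer !dotcZr (dotcC v r).
  move=> H; apply: lt_le_trans (H _) _.
    by apply/eqP => /col_eq0[_ /eqP]; rewrite (negbTE v0).
  by rewrite le_eqVlt; apply/orP; left; apply/eqP; field.
have -> : Q = block_mx 1%:M 0 (q^-1 *: r) 1%:M *m block_mx (ulsubmx Q) (ursubmx Q) 0 S.
  rewrite mulmx_block !mul1mx !mul0mx !addr0 /S.
  rewrite -{1}[Q]submxK -/r rE -!scalemxAl [_ + (drsubmx Q - _)]addrC subrK.
  congr block_mx; rewrite qE.
  by apply/matrixP => i j; rewrite !mxE big_ord1 !mxE !ord1; field.
rewrite det_mulmx det_lblock det_ublock !det1 !mul1r qE.
rewrite [const_mx q](_ : _ = q%:M) ?det_scalar1 //.
by apply/matrixP => i j; rewrite !ord1 !mxE eqxx mulr1n.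
Qed.

End DotProduct.

Section GaussianLaplace.
Context {R : realType}.
Notation N01 := (normal_prob (0 : R) 1).

Lemma posdef_det n (Q : 'M[R]_n) : posdef Q -> 0 < \det Q.
Proof.
elim: n => [|n IH] in Q *; first by rewrite det_mx00 ltr01.
by move=> /(@posdef_block R n)[q0 _ Spos ->]; rewrite mulr_gt0 // IH.
Qed.

Lemma posdef_unit n (Q : 'M[R]_n) : posdef Q -> Q \in unitmx.
Proof. by move=> /posdef_det Q0; rewrite unitmxE unitfE gt_eqF. Qed.

Lemma measurable_row n (a : 'cV[R]_n) :
  measurable_fun setT (fun v : borel_cV R n => dotc a v).
Proof.
under eq_fun do rewrite dotcE; apply: measurable_sum => i.
by apply: measurable_funM => //; exact: measurable_coord.
Qed.

Lemma measurable_mulmx n m (A : 'M[R]_(m, n)) :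
  measurable_fun setT (fun v : borel_cV R n => (A *m v : borel_cV R m)).
Proof.
apply: measurable_to_cV => i.
rewrite (_ : (fun _ => _) = fun v : borel_cV R n => dotc (row i A)^T v).
  exact: measurable_row.
by apply/funext => v; rewrite dotcE mxE; apply: eq_bigr => j _; rewrite !mxE.
Qed.

Lemma measurable_dotc {d} {T : measurableType d} n (f g : T -> borel_cV R n) :
  measurable_fun setT f -> measurable_fun setT g ->
  measurable_fun setT (fun x => dotc (f x : 'cV[R]_n) (g x)).
Proof.
move=> mf mg; under eq_fun do rewrite dotcE; apply: measurable_sum => i.
by apply: measurable_funM; apply: (measurableT_comp (measurable_coord i)).
Qed.

(** Times the density of the standard Gaussian law, this is proportional to the
    density of the law $N(Q^{-1} b, Q^{-1})$. *)
Definition gauss_weight n (Q : 'M[R]_n) (b v : 'cV[R]_n) : R :=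
  expR (- (dotc v (Q *m v) - dotc v v) / 2 + dotc b v).

Lemma measurable_gauss_weight n (Q : 'M[R]_n) b :
  measurable_fun setT (fun v : borel_cV R n => gauss_weight Q b v).
Proof.
rewrite /gauss_weight; apply: measurableT_comp => //.
apply: measurable_funD; last exact: measurable_row.
apply: measurable_funM => //; apply: measurableT_comp => //.
by apply: measurable_funB; apply: measurable_dotc => //; exact: measurable_mulmx.
Qed.

(** Integrating out one coordinate performs one step of Gaussian elimination,
    both on [Q] and on the system [Q *m u = b]. *)
Lemma gaussian_laplace n (G : probability (borel_cV R n) R) (Q : 'M[R]_n)
    (b u : 'cV[R]_n) : std_gaussian G -> posdef Q -> Q *m u = b ->
  (\int[G]_v (gauss_weight Q b v)%:E =
   ((Num.sqrt (\det Q))^-1 * expR (dotc b u / 2))%:E)%E.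
Proof.
elim: n => [|n IH] in G Q b u *.
  move=> _ _ _; rewrite det_mx00 sqrtr1 invr1 mul1r dotcE big_ord0 mul0r expR0.
  under eq_integral do rewrite /gauss_weight !dotcE !big_ord0 subrr oppr0 mul0r addr0 expR0.
  by rewrite integral_cst // mul1e; exact: probability_setT.
move=> Gstd Qpos Qu; have [q0 Qmul Spos detQ] := @posdef_block R n Q Qpos.
set q := Q 0 0 in q0 Qmul Spos detQ.
set r := dlsubmx _ in Qmul Spos detQ; set D := drsubmx _ in Qmul Spos detQ.
set S := D - _ in Spos detQ.
have q0' : q != 0 by rewrite gt_eqF.
have split_cV (w : 'cV[R]_(1 + n)) : w = col_mx (const_mx (w 0 0)) (dsubmx w).
  rewrite -[LHS]vsubmxK; congr col_mx; apply/matrixP => i j; rewrite !ord1 !mxE.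
  by congr (w _ _); apply: val_inj.
set b0 := b 0 0; set b' : 'cV[R]_n := @dsubmx R 1 n 1 b.
set u0 := u 0 0; set u' : 'cV[R]_n := @dsubmx R 1 n 1 u.
have bE : b = @col_mx R 1 n 1 (const_mx b0) b' by exact: split_cV.
have uE : u = @col_mx R 1 n 1 (const_mx u0) u' by exact: split_cV.
have [E0 E'] : b0 = q * u0 + dotc r u' /\ b' = u0 *: r + D *m u'.
  move: Qu; rewrite {1}uE Qmul bE => /(@eq_col_mx R 1 n 1)[/matrixP/(_ 0 0) + <-].
  by rewrite !mxE => <-.
have Su : S *m u' = b' - (b0 / q) *: r.
  rewrite mulmxBl E' -scalemxAl mulmx_outer scalerA [u0 *: r + _]addrC -addrA; congr (_ + _).
  rewrite -scaleNr -scalerBl; congr (_ *: _); rewrite E0.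
  by field.
apply: etrans (std_gaussian_fubini Gstd
  (f := fun z => (gauss_weight Q b z)%:E) _ _) _.
- by apply/measurable_EFinP; exact: measurable_gauss_weight.
- by move=> z; rewrite lee_fin expR_ge0.
transitivity (\int[tail_law (G := G)]_v (((Num.sqrt q)^-1 * expR (b0 ^+ 2 / (2 * q)))%:E *
    (gauss_weight S (b' - (b0 / q) *: r) v)%:E))%E.
  apply: eq_integral => v _.
  pose K := expR (- (dotc v (D *m v) - dotc v v) / 2 + dotc b' v).
  transitivity (\int[N01]_x (K%:E *
      (expR (- ((q - 1) * x ^+ 2) / 2 + (b0 - dotc r v) * x))%:E))%E.
    apply: eq_integral => x _; rewrite -EFinM -expRD; congr (expR _)%:E.
    rewrite /cons_cV /= {1}Qmul bE !dotc_col dotcDr dotcZr (dotcC v r).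
    have aux (q1 b1 y t DD vv c : R) :
        - (y * (q1 * y + t) + (y * t + DD) - (y * y + vv)) / 2 + (b1 * y + c) =
        - (DD - vv) / 2 + c + (- ((q1 - 1) * y ^+ 2) / 2 + (b1 - t) * y) by field.
    exact: aux.
  rewrite ge0_integralZl //; last 2 first.
  - by apply/measurable_EFinP; exact: measurable_gauss_weight1.
  - by rewrite lee_fin expR_ge0.
  rewrite normal_laplace // -!EFinM; congr EFin.
  rewrite mulrCA -[RHS]mulrA /K /gauss_weight -!expRD; congr (_ * expR _).
  rewrite /S mulmxBl -scalemxAl mulmx_outer !(dotcDl, dotcDr, dotcNl, dotcNr, dotcZl, dotcZr).
  rewrite (dotcC v r).
  have aux (q1 b1 t DD vv c : R) : q1 != 0 ->
      - (DD - vv) / 2 + c + (b1 - t) ^+ 2 / (2 * q1) =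
      b1 ^+ 2 / (2 * q1) + (- (DD - q1^-1 * (t * t) - vv) / 2 + (c - b1 / q1 * t)).
    by move=> ?; field.
  exact: aux.
rewrite ge0_integralZl //; first last.
- by move=> v _; rewrite lee_fin expR_ge0.
- by apply/measurable_EFinP; exact: measurable_gauss_weight.
rewrite (IH _ _ _ u') //; last exact: tail_law_std.
rewrite -EFinM; congr EFin; rewrite detQ sqrtrM ?ltW // [in RHS]invfM mulrACA -expRD.
congr (_ * expR _); rewrite bE uE dotc_col dotcDl dotcNl dotcZl E0.
have aux (q1 u1 t c : R) : q1 != 0 ->
    (q1 * u1 + t) ^+ 2 / (2 * q1) + (c - (q1 * u1 + t) / q1 * t) / 2 =
    ((q1 * u1 + t) * u1 + c) / 2.
  by move=> ?; field.
exact: aux.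
Qed.

End GaussianLaplace.

(** * Moments of tilted Gaussian laws *)

Section Derivatives.
Context {R : realType}.
Implicit Types (f g : R -> R) (s : R).

Lemma is_derive_affine (a c s : R) : is_derive s 1 (fun t : R => a + t * c) c.
Proof.
have D1 := is_deriveM (is_derive_id s (1 : R)) (is_derive_cst c s (1 : R)).
have := is_deriveD (is_derive_cst a s (1 : R)) D1.
by rewrite scaler0 add0r add0r scaler1.
Qed.

Lemma is_derive_const (a s : R) : is_derive s 1 (fun _ : R => a) (0 : R).
Proof. exact: is_derive_cst. Qed.

Lemma is_derive_mul f g s a c : is_derive s 1 f a -> is_derive s 1 g c ->
  is_derive s 1 (fun t => f t * g t) (a * g s + f s * c).
Proof.
move=> Df Dg; apply: is_derive_eq (is_deriveM Df Dg) _.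
by rewrite /GRing.scale /=; ring.
Qed.

Lemma is_derive_add f g s a c : is_derive s 1 f a -> is_derive s 1 g c ->
  is_derive s 1 (fun t => f t + g t) (a + c).
Proof. by move=> Df Dg; exact: is_deriveD. Qed.

Lemma is_derive_expR_comp f s a : is_derive s 1 f a ->
  is_derive s 1 (fun t => expR (f t)) (expR (f s) * a).
Proof. by move=> Df; exact: (is_derive1_comp (is_derive_expR (f s)) Df). Qed.

End Derivatives.

Section Moments.
Context {R : realType} {n : nat} {G : probability (borel_cV R n) R}.
Hypothesis Gstd : std_gaussian G.
Context {Q : 'M[R]_n}.
Hypothesis Qpos : posdef Q.

Let C := invmx Q.
Let QU : Q \in unitmx := posdef_unit Qpos.

Lemma inv_posdef_sym i j : C i j = C j i.
Proof.
have CT : C^T = C by rewrite /C trmx_inv Qpos.1.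
by rewrite -[in LHS]CT mxE.
Qed.

Definition gauss_mass (b : 'cV[R]_n) : R :=
  (Num.sqrt (\det Q))^-1 * expR (dotc b (C *m b) / 2).

(** The moments are kept as functions of the tilt [b] in order to be
    differentiated. *)
Definition has_moment (P : 'cV[R]_n -> R) (pol : 'cV[R]_n -> R) : Prop :=
  forall b,
  G.-integrable setT (EFin \o (fun v : borel_cV R n => P v * gauss_weight Q b v)) /\
  \int[G]_v (P v * gauss_weight Q b v) = pol b * gauss_mass b.

Lemma has_moment1 : has_moment (fun=> 1) (fun=> 1).
Proof.
move=> b.
have I : (\int[G]_v (gauss_weight Q b v)%:E = (gauss_mass b)%:E)%E.
  by apply: gaussian_laplace => //; rewrite /C mulKVmx.
have E : (fun v : borel_cV R n => 1 * gauss_weight Q b v) = gauss_weight Q b.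
  by apply/funext => v; rewrite mul1r.
split; last by rewrite E /Rintegral I mul1r.
rewrite E; apply/integrableP; split.
  by apply/measurable_EFinP; exact: measurable_gauss_weight.
rewrite (eq_integral (fun v : borel_cV R n => (gauss_weight Q b v)%:E)) ?I ?ltry // => v _.
by rewrite /= ger0_norm ?expR_ge0.
Qed.

Lemma gauss_weight_shift b i s v :
  gauss_weight Q (b + s *: delta_mx i 0) v = gauss_weight Q b v * expR (s * v i 0).
Proof.
rewrite /gauss_weight -expRD dotcDl dotcZl dotc_delta addrA.
by [].
Qed.

Definition lin i (b : 'cV[R]_n) : R := (C *m b) i 0.

Lemma lin_delta i j : lin i (delta_mx j 0) = C i j.
Proof.
rewrite /lin mxE (bigD1 j) //= !mxE !eqxx mulr1 big1 ?addr0 // => k kj.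
by rewrite !mxE (negbTE kj) mulr0.
Qed.

Lemma lin_shift i j b s : lin i (b + s *: delta_mx j 0) = lin i b + s * C i j.
Proof. by rewrite -lin_delta /lin mulmxDr -scalemxAr !mxE. Qed.

Lemma is_derive_mass b i (s : R) :
  is_derive s 1 (fun t => gauss_mass (b + t *: delta_mx i 0))
   (lin i (b + s *: delta_mx i 0) * gauss_mass (b + s *: delta_mx i 0)).
Proof.
have E t : dotc (b + t *: delta_mx i 0) (C *m (b + t *: delta_mx i 0)) / 2 =
    (dotc b (C *m b) / 2 + t * lin i b) + t * t * (C i i / 2).
  have -> : C *m (b + t *: delta_mx i 0) = C *m b + t *: (C *m delta_mx i 0).
    by rewrite mulmxDr scalemxAr.
  rewrite !(dotcDl, dotcDr, dotcZl, dotcZr) !dotc_delta.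
  have -> : dotc b (C *m delta_mx i 0) = lin i b.
    rewrite dotc_mulmx dotcC dotc_delta /lin; congr ((_ *m b) _ _).
    by apply/matrixP => k l; rewrite mxE inv_posdef_sym.
  by rewrite -/(lin i b) -/(lin i (delta_mx i 0)) lin_delta; field.
have cst k := is_derive_const k s.
have Did := is_derive_id s (1 : R).
have D := is_derive_mul (cst (Num.sqrt (\det Q))^-1)
  (is_derive_expR_comp (is_derive_add
    (is_derive_affine (dotc b (C *m b) / 2) (lin i b) s)
    (is_derive_mul (is_derive_mul Did Did) (cst (C i i / 2))))).
rewrite [X in is_derive _ _ X _](_ : _ = fun t => (Num.sqrt (\det Q))^-1 *
    expR ((dotc b (C *m b) / 2 + t * lin i b) + t * t * (C i i / 2))).
  apply: is_derive_eq D _.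
  by rewrite /gauss_mass E lin_shift /=; move: (Num.sqrt _)^-1 => K; field.
by apply/funext => t; rewrite /gauss_mass E.
Qed.

(** Multiplying the integrand by a coordinate amounts to differentiating with
    respect to the corresponding coordinate of the tilt [b]. *)
Lemma has_moment_step P pol dpol i :
  measurable_fun setT (P : borel_cV R n -> R) ->
  has_moment P pol ->
  (forall b (s : R), is_derive s 1 (fun t => pol (b + t *: delta_mx i 0))
     (dpol (b + s *: delta_mx i 0))) ->
  has_moment (fun v => P v * v i 0) (fun b => dpol b + pol b * lin i b).
Proof.
move=> mP PE Dpol b.
pose g (v : borel_cV R n) := P v * gauss_weight Q b v.
pose X (v : borel_cV R n) := (v : 'cV[R]_n) i 0.
have mg : measurable_fun setT g.
  by apply: measurable_funM => //; exact: measurable_gauss_weight.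
have gE s v : g v * expR (s * X v) = P v * gauss_weight Q (b + s *: delta_mx i 0) v.
  by rewrite gauss_weight_shift mulrA.
have gi s : G.-integrable setT (EFin \o (fun v => g v * expR (s * X v))).
  by under eq_fun do rewrite gE; exact: (PE _).1.
have XE v : P v * v i 0 * gauss_weight Q b v = g v * X v * expR (0 * X v).
  by rewrite mul0r expR0 /g /X; ring.
split.
  under eq_fun do rewrite XE.
  exact: (laplace_moment_integrable (measurable_coord i) mg gi).
under eq_Rintegral do rewrite XE.
pose phi s := pol (b + s *: delta_mx i 0) * gauss_mass (b + s *: delta_mx i 0).
pose phi' s := (dpol (b + s *: delta_mx i 0) + pol (b + s *: delta_mx i 0) *
   lin i (b + s *: delta_mx i 0)) * gauss_mass (b + s *: delta_mx i 0).
have phiE s : \int[G]_v (g v * expR (s * X v)) = phi s.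
  by under eq_Rintegral do rewrite gE; exact: (PE _).2.
have Dphi (s : R) : is_derive s 1 phi (phi' s).
  apply: is_derive_eq (is_derive_mul (Dpol b s) (is_derive_mass b i s)) _.
  by rewrite /phi'; ring.
by rewrite (laplace_moment gi phiE Dphi) /phi' scale0r addr0.
Qed.

Lemma is_derive_lin b i j (s : R) :
  is_derive s 1 (fun t => lin i (b + t *: delta_mx j 0)) (C i j).
Proof. by under eq_fun do rewrite lin_shift; exact: is_derive_affine. Qed.

Lemma has_moment_coord i : has_moment (fun v => v i 0) (lin i).
Proof.
have D (b : 'cV[R]_n) (s : R) := is_derive_const 1 s.
have := has_moment_step (dpol := fun=> 0) (i := i) (@measurable_cst _ _ _ _ _ _) has_moment1 (fun b s => D b s).
move=> H b; have [] := H b; rewrite add0r mul1r => I <-.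
split; last by apply: eq_Rintegral => v _; rewrite mul1r.
by apply: eq_integrable I => // v _ /=; rewrite mul1r.
Qed.

Let mcoord i := @measurable_coord R n i.

Lemma has_moment2 i j :
  has_moment (fun v => v i 0 * v j 0) (fun b => C i j + lin i b * lin j b).
Proof.
apply: (has_moment_step (dpol := fun=> C i j)) (has_moment_coord i) _ => // b s.
exact: is_derive_lin.
Qed.

Lemma has_moment3 i j k :
  has_moment (fun v => v i 0 * v j 0 * v k 0)
    (fun b => (C i k * lin j b + lin i b * C j k) + (C i j + lin i b * lin j b) * lin k b).
Proof.
apply: (has_moment_step (dpol := fun b => C i k * lin j b + lin i b * C j k)) (has_moment2 i j) _.
  exact: measurable_funM.
move=> b s; apply: is_derive_eq (is_derive_add (is_derive_const (C i j) s)
  (is_derive_mul (is_derive_lin b i k s) (is_derive_lin b j k s))) _.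
by rewrite add0r.
Qed.

(** The value at [0] is Isserlis' formula, with one term for each pairing of the
    four indices. *)
Lemma has_moment4 i j k l : exists pol,
  has_moment (fun v => v i 0 * v j 0 * v k 0 * v l 0) pol /\
  pol 0 = C i k * C j l + C i l * C j k + C i j * C k l.
Proof.
have lin0 m : lin m 0 = 0 by rewrite /lin mulmx0 mxE.
eexists; split.
  apply: (has_moment_step (dpol := fun b => C i k * C j l + C i l * C j k +
   ((C i l * lin j b + lin i b * C j l) * lin k b + (C i j + lin i b * lin j b) * C k l)))
   (has_moment3 i j k) _.
    by apply: measurable_funM => //; exact: measurable_funM.
  move=> b s; have cst c := is_derive_const c s.
  have D m := is_derive_lin b m l s.
  apply: is_derive_eq (is_derive_add
    (is_derive_add (is_derive_mul (cst (C i k)) (D j)) (is_derive_mul (D i) (cst (C j k))))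
    (is_derive_mul (is_derive_add (cst (C i j)) (is_derive_mul (D i) (D j))) (D k))) _.
  by rewrite /=; ring.
by rewrite /= !lin0; ring.
Qed.

End Moments.

(** * The reproducing kernel Hilbert space as a type *)

Section RkhsType.
Context {R : realType} {T : Type} {k : T -> T -> R} (H : rkhs k).

Definition rkhs_mem : {pred T -> R^o} := fun f => `[< rkhs_space H f >].

Lemma rkhs_submod_closed : submod_closed rkhs_mem.
Proof.
split; first by apply/asboolP; exact: rkhs_space0.
move=> a f g /asboolP Hf /asboolP Hg; apply/asboolP.
exact: (rkhs_space_lin a Hf Hg).
Qed.

HB.instance Definition _ := GRing.isSubmodClosed.Build R (T -> R^o) rkhs_mem
  rkhs_submod_closed.

Record rkhs_vec := RkhsVec { rkhs_val : T -> R^o; _ : rkhs_val \in rkhs_mem }.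

HB.instance Definition _ := [isSub for rkhs_val].
HB.instance Definition _ := [Choice of rkhs_vec by <:].
HB.instance Definition _ := [SubChoice_isSubLmodule of rkhs_vec by <:].

Definition vip (u v : rkhs_vec) : R := rkhs_ip H (rkhs_val u) (rkhs_val v).

Lemma rkhs_valP u : rkhs_space H (rkhs_val u).
Proof. by case: u => f fP; apply/asboolP. Qed.

Lemma rkhs_val_lin a u v :
  rkhs_val (a *: u + v) = fun x => a * rkhs_val u x + rkhs_val v x.
Proof. exact: (linearP (val : rkhs_vec -> T -> R^o)). Qed.

Lemma rkhs_valB u v x : rkhs_val (u - v) x = rkhs_val u x - rkhs_val v x.
Proof. by rewrite -[rkhs_val]/(val : rkhs_vec -> _) raddfB. Qed.

Lemma vip_hilbert : hilbert vip.
Proof.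
have valB u v : rkhs_val (u - v) = fun x => rkhs_val u x - rkhs_val v x.
  by apply/funext => x; exact: rkhs_valB.
split; first split.
- by move=> u v; apply: rkhs_ipC; exact: rkhs_valP.
- move=> a u v w; rewrite /vip rkhs_val_lin.
  by apply: rkhs_ip_linl; exact: rkhs_valP.
- by move=> u; apply: rkhs_ip_ge0; exact: rkhs_valP.
- move=> u u0; apply: val_inj => /=.
  have -> : rkhs_val u = fun=> 0 by apply: (rkhs_ip_eq0 (rkhs_valP u)).
  exact: esym (raddf0 (val : rkhs_vec -> T -> R^o)).
- move=> u cu; have [|l Hl ul] := rkhs_complete (fun n => rkhs_valP (u n)).
    move=> e e0; have [n0 Hn0] := cu e e0; exists n0 => m n mn nn.
    by rewrite -valB; exact: Hn0.
  have lm : (l : T -> R^o) \in rkhs_mem by apply/asboolP.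
  exists (RkhsVec lm); rewrite /vip.
  by under eq_cvg do rewrite valB.
Qed.

Definition kvec x : rkhs_vec :=
  RkhsVec (introT (asboolP _) (rkhs_kernel H x) : (k^~ x : T -> R^o) \in rkhs_mem).

Lemma kvecE x z : rkhs_val (kvec x) z = k z x.
Proof. by []. Qed.

Lemma vip_kvec u x : vip u (kvec x) = rkhs_val u x.
Proof. by apply: rkhs_reproducing; exact: rkhs_valP. Qed.

End RkhsType.

(** * Matrix identities *)

Section MatrixIdentities.
Context {R : realType}.

(** The same block matrix has two triangular factorizations. *)
Lemma sylvester_det n (X Y : 'M[R]_n) :
  \det (1%:M + X *m Y) = \det (1%:M + Y *m X).
Proof.
have E1 : block_mx 1%:M (- X) Y 1%:M =
    block_mx 1%:M 0 Y 1%:M *m block_mx 1%:M (- X) 0 (1%:M + Y *m X).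
  rewrite mulmx_block !mul1mx !mul0mx ?mulmx0 !mulmx1 !addr0 mulmxN.
  by rewrite [1%:M + _]addrC addKr.
have E2 : block_mx 1%:M (- X) Y 1%:M =
    block_mx 1%:M (- X) 0 1%:M *m block_mx (1%:M + X *m Y) 0 Y 1%:M.
  rewrite mulmx_block !mul1mx !mul0mx ?mulmx0 !mulmx1 ?addr0 ?add0r mulNmx.
  by rewrite addrK.
have := congr1 determinant E2; rewrite E1 !det_mulmx !det_lblock !det_ublock.
by rewrite !det1 !mul1r !mulr1.
Qed.

Lemma push_through n (X Y : 'M[R]_n) : 1%:M + X *m Y \in unitmx ->
  1%:M + Y *m X \in unitmx ->
  invmx (1%:M + X *m Y) *m X = X *m invmx (1%:M + Y *m X).
Proof.
move=> U1 U2; apply: (canRL (mulmxK U2)); rewrite -mulmxA.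
have -> : X *m (1%:M + Y *m X) = (1%:M + X *m Y) *m X.
  by rewrite mulmxDl mulmxDr mulmx1 mul1mx mulmxA.
by rewrite mulKmx.
Qed.

Lemma mxtrace_mul_sum n (X Y : 'M[R]_n) :
  \tr (X *m Y) = \sum_i \sum_j X i j * Y j i.
Proof. by apply: eq_bigr => i _; rewrite mxE. Qed.

Lemma posdef_1D n (M : 'M[R]_n) : M^T = M -> (forall v, 0 <= dotc v (M *m v)) ->
  posdef (1%:M + M).
Proof.
move=> MT M0; split; first by rewrite linearD /= trmx1 MT.
move=> v v0; rewrite mulmxDl mul1mx dotcDr ltr_wpDr // lt_def dotc_ge0 andbT.
by apply: contraNneq v0 => /dotc_eq0 ->.
Qed.

Context {n : nat} {A : 'M[R]_n} {sigma : R} (sigma0 : 0 < sigma).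
Let S := A *m A^T.
Let V := Vmx sigma S.
Let Vi := invmx V.
(** The precision matrix of the standard Gaussian law multiplied by the kernel
    at a fixed point, both seen through [A]. *)
Let Q := 1%:M + (2 * sigma) *: (A^T *m A).
Let C := invmx Q.
Let J := (2 * sigma) *: (A^T *m Vi *m A).
Let U := V + (2 * sigma) *: S.
Let W := invmx U *m S.

Let s0 : 0 <= 2 * sigma. Proof. by rewrite mulr_ge0 // ltW. Qed.

Let ST : S^T = S. Proof. by rewrite trmx_mul trmxK. Qed.

Lemma gram_ge0 v : 0 <= dotc v (S *m v).
Proof. by rewrite /S -mulmxA dotc_mulmx dotc_ge0. Qed.

Lemma posdef_Vmx : posdef V.
Proof.
apply: posdef_1D; first by rewrite linearZ /= ST.
by move=> v; rewrite -scalemxAl dotcZr mulr_ge0 // gram_ge0.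
Qed.

Lemma posdef_tilt : posdef Q.
Proof.
apply: posdef_1D; first by rewrite linearZ /= trmx_mul trmxK.
by move=> v; rewrite -scalemxAl dotcZr mulr_ge0 // -mulmxA dotc_mulmx trmxK dotc_ge0.
Qed.

Lemma posdef_U : posdef U.
Proof.
rewrite /U /V /Vmx -addrA; apply: posdef_1D; first by rewrite linearD !linearZ /= ST.
by move=> v; rewrite mulmxDl -!scalemxAl dotcDr !dotcZr addr_ge0 // mulr_ge0 // gram_ge0.
Qed.

Let VU : V \in unitmx := posdef_unit posdef_Vmx.
Let QU : Q \in unitmx := posdef_unit posdef_tilt.
Let UU : U \in unitmx := posdef_unit posdef_U.

Let ViT : Vi^T = Vi. Proof. by rewrite /Vi trmx_inv posdef_Vmx.1. Qed.

Lemma tilt_symm : J^T = J.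
Proof. by rewrite /J linearZ /= !trmx_mul trmxK ViT mulmxA. Qed.

Lemma posdef_1J : posdef (1%:M + J).
Proof.
apply: posdef_1D; first exact: tilt_symm.
move=> v; rewrite -scalemxAl dotcZr mulr_ge0 //.
rewrite -!mulmxA dotc_mulmx trmxK.
have [x ->] : exists x, A *m v = V *m x.
  by exists (Vi *m (A *m v)); rewrite /Vi mulKVmx.
rewrite /Vi mulKmx // dotcC.
have [->|x0] := eqVneq x 0; first by rewrite mulmx0 /dotc mulmx0 mxE.
by apply: ltW; exact: posdef_Vmx.2.
Qed.

Lemma tilt_push : C *m A^T = A^T *m Vi.
Proof.
have := @push_through n ((2 * sigma) *: A^T) A.
rewrite -scalemxAl -scalemxAr -/Q -/S -/(Vmx sigma S) -/V => /(_ QU VU).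
rewrite -scalemxAr -scalemxAl => /scalerI; apply.
by rewrite gt_eqF // mulr_gt0.
Qed.

Lemma tilt_cov : C = 1%:M - J.
Proof.
have AC : A *m C = Vi *m A.
  have := congr1 trmx tilt_push; rewrite !trmx_mul trmxK ViT.
  by rewrite [C^T](_ : _ = C) // /C trmx_inv posdef_tilt.1.
rewrite /J -mulmxA -AC mulmxA scalemxAl.
apply: (canRL (addrK _)); rewrite -{1}[C]mul1mx -mulmxDl.
by rewrite /C mulmxV.
Qed.

Lemma tilt_woodbury : Vi = 1%:M - (2 * sigma) *: (A *m C *m A^T).
Proof.
rewrite -mulmxA tilt_push mulmxA -/S scalemxAl.
apply: (canRL (addrK _)); rewrite -{1}[Vi]mul1mx -mulmxDl.
by rewrite /Vi mulmxV.
Qed.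

Lemma tilt_det : \det Q = \det V.
Proof. by rewrite /V /Vmx /Q scalemxAl sylvester_det -scalemxAr. Qed.

Lemma tilt_det_1J : \det V * \det (1%:M + J) = \det U.
Proof.
rewrite /J -mulmxA scalemxAl sylvester_det -det_mulmx; congr (\det _).
rewrite mulmxDr mulmx1 -scalemxAr; congr (_ + _).
by rewrite -scalemxAr !mulmxA mulmxV // mul1mx.
Qed.

Let K := invmx (1%:M + J).

(** [J *m K] and [(2 * sigma) *: W] are products of the same two matrices in
    opposite orders, so the traces of their powers agree. *)
Lemma tilt_trace_aux : exists X Y : 'M[R]_n,
  J *m K = X *m Y /\ Y *m X = (2 * sigma) *: W.
Proof.
pose X := (2 * sigma) *: A^T; pose Y := Vi *m A.
have JE : J = X *m Y by rewrite /J /X /Y -scalemxAl mulmxA.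
have YX : V *m (1%:M + Y *m X) = U.
  rewrite mulmxDr mulmx1 /Y /X -scalemxAr; congr (_ + _).
  by rewrite -scalemxAr !mulmxA mulmxV // mul1mx.
have YXU : 1%:M + Y *m X \in unitmx.
  by have := UU; rewrite -YX unitmx_mul => /andP[].
have JU : 1%:M + X *m Y \in unitmx by rewrite -JE; exact: posdef_unit posdef_1J.
exists X, (invmx (1%:M + Y *m X) *m Y); split.
  by rewrite push_through // mulmxA -JE.
rewrite -mulmxA; apply: (canLR (mulKmx YXU)).
apply: (can_inj (mulKmx VU)).
rewrite [RHS]mulmxA YX -[RHS]scalemxAr /W mulKVmx // /Y /X -scalemxAr.
by rewrite -scalemxAr !mulmxA mulmxV // mul1mx.
Qed.

Lemma tilt_trace : \tr (J *m K) = 2 * sigma * \tr W.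
Proof.
have [X [Y [-> YX]]] := tilt_trace_aux.
by rewrite mxtrace_mulC YX mxtraceZ.
Qed.

Lemma tilt_trace2 : \tr (J *m K *m (J *m K)) = 4 * sigma ^+ 2 * \tr (W *m W).
Proof.
have [X [Y [-> YX]]] := tilt_trace_aux.
rewrite -mulmxA mxtrace_mulC -mulmxA -[X *m Y *m X]mulmxA YX mulmxA YX.
by rewrite -scalemxAl -scalemxAr scalerA mxtraceZ; ring.
Qed.

End MatrixIdentities.

(** * Separability of the space of the Gaussian kernel *)

Section GaussianRkhs.
Context {R : realType} {d : nat} {sigma : R} (sigma0 : 0 < sigma).
Context {H : rkhs (@gauss_kernel R d sigma)}.
Notation V := (rkhs_vec H).
Notation hP := (vip_hilbert H).
Implicit Types (u r : V) (x y z : 'cV[R]_d).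

Lemma gauss_kernelE x y : gauss_kernel sigma x y = expR (- sigma * dotc (x - y) (x - y)).
Proof. by []. Qed.

Lemma gauss_kernel_refl x : gauss_kernel sigma x x = 1.
Proof. by rewrite gauss_kernelE subrr /dotc mulmx0 mxE mulr0 expR0. Qed.

Lemma rkhs_val_bound u x : `|rkhs_val u x| <= Num.sqrt (vip u u).
Proof.
rewrite -vip_kvec (le_trans (psd_abs_CS hP _ _)) // vip_kvec kvecE gauss_kernel_refl.
by rewrite sqrtr1 mulr1.
Qed.

Lemma rkhs_val_lipschitz u x y :
  (rkhs_val u x - rkhs_val u y) ^+ 2 <= vip u u * (2 * sigma * dotc (x - y) (x - y)).
Proof.
rewrite -!vip_kvec -(psdBr hP); apply: (le_trans (psd_CS hP _ _)).
rewrite ler_wpM2l ?(psd_ge0 hP) // (psdBB hP) !vip_kvec !kvecE !gauss_kernel_refl.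
rewrite gauss_kernelE.
have -> : dotc (y - x) (y - x) = dotc (x - y) (x - y).
  by rewrite -opprB dotcNl dotcNr opprK.
have := expR_ge1Dx (- sigma * dotc (x - y) (x - y)); lra.
Qed.

Definition rational_kernels n : V :=
  if unpickle n is Some q then kvec H (map_mx (ratr : rat -> R) (q : 'cV[rat]_d))
  else 0.

Lemma rational_approx x e : 0 < e -> exists q : 'cV[rat]_d,
  dotc (x - map_mx ratr q) (x - map_mx ratr q) <= e ^+ 2 * d%:R.
Proof.
move=> e0; have /choice[q qP] : forall i : 'I_d, exists q : rat,
    ratr q \in `]x i 0, x i 0 + e[.
  by move=> i; apply: rat_in_itvoo; rewrite ltrDl.
exists (\col_i q i); rewrite dotcE.
rewrite -[d%:R](_ : \sum_(i < d) 1 = _) ?mulr_sumr; last by rewrite sumr_const card_ord.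
apply: ler_sum => i _; rewrite !mxE -expr2 mulr1.
have := qP i; rewrite in_itv /= => /andP[q1 q2].
move: (ratr (q i)) q1 q2 => t q1 q2.
have t0 : 0 <= t - x i 0 by rewrite subr_ge0 ltW.
have te : t - x i 0 <= e by rewrite lerBlDl ltW.
by rewrite -sqrrN opprB ler_pXn2r // nnegrE // ltW.
Qed.

(** A function of the space that vanishes at the rational points vanishes
    everywhere, by continuity; this gives the space a countable total family. *)
Lemma rational_kernels_total : total_family (ip := @vip _ _ _ H) rational_kernels.
Proof.
move=> r r0; apply: (hilbert_eq0 hP).
have rq (q : 'cV[rat]_d) : rkhs_val r (map_mx ratr q) = 0.
  by have := r0 (pickle q); rewrite /rational_kernels pickleK vip_kvec.
suff r_eq0 : rkhs_val r = fun=> 0.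
  have -> : r = 0.
    apply: val_inj => /=; rewrite r_eq0.
    exact: esym (raddf0 (val : V -> 'cV[R]_d -> R^o)).
  by rewrite (psd0l hP).
apply/funext => x; apply: contrapT => /eqP rx.
pose c := vip r r * (2 * sigma * d%:R).
have c0 : 0 <= c by rewrite !mulr_ge0 ?(psd_ge0 hP) // ltW.
have rx2 : 0 < rkhs_val r x ^+ 2 by rewrite exprn_even_gt0.
pose e := Num.min 1 (rkhs_val r x ^+ 2 / (c + 1)).
have c1 : 0 < c + 1 by rewrite ltr_wpDl.
have e0 : 0 < e by rewrite lt_min ltr01 divr_gt0.
have [q qx] := rational_approx x e0.
have := rkhs_val_lipschitz r x (map_mx ratr q); rewrite rq subr0 => H1.
have H2 : rkhs_val r x ^+ 2 <= c * e ^+ 2.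
  apply: (le_trans H1); rewrite /c -!mulrA ler_wpM2l ?(psd_ge0 hP) // !ler_pM2l //.
  by rewrite mulrC.
have e1 : e <= 1 by rewrite ge_min lexx.
have e2 : e * (c + 1) <= rkhs_val r x ^+ 2 by rewrite -ler_pdivlMr // ge_min lexx orbT.
have : c * e ^+ 2 <= c * e by rewrite ler_wpM2l // expr2 ler_piMr // ltW.
have := mulr_gt0 e0 c1; nra.
Qed.

Definition rkhs_basis : nat -> V := gs (ip := @vip _ _ _ H) rational_kernels.

Lemma rkhs_basis_on : orthonormal_family (ip := @vip _ _ _ H) rkhs_basis.
Proof. exact: (gs_orthonormal hP). Qed.

Lemma rkhs_basis_total : total_family (ip := @vip _ _ _ H) rkhs_basis.
Proof. exact: (gs_total hP rational_kernels_total). Qed.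

Lemma measurable_basis {dd} {T : measurableType dd} (F : T -> V) :
  (forall z, measurable_fun setT (fun t => rkhs_val (F t) z)) ->
  forall j, measurable_fun setT (fun t => vip (F t) (rkhs_basis j)).
Proof.
move=> mF j; apply: (gs_lin_closed (v := rational_kernels)
  (S := fun u => measurable_fun setT (fun t => vip (F t) u))).
- split=> [|a u w mu mw] /=.
    by under eq_fun do rewrite (psd0r hP); exact: measurable_cst.
  under eq_fun do rewrite (psdDr hP) (psdZr hP).
  by apply: measurable_funD => //; exact: measurable_funM.
- move=> i _; rewrite /rational_kernels; case: unpickle => [q|].
    by under eq_fun do rewrite vip_kvec; exact: mF.
  by under eq_fun do rewrite (psd0r hP); exact: measurable_cst.
Qed.

Lemma measurable_gauss_kernel z :
  measurable_fun setT (fun x : borel_cV R d => gauss_kernel sigma z x).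
Proof.
under eq_fun do rewrite gauss_kernelE.
apply: measurableT_comp => //; apply: measurable_funM => //.
have mz : measurable_fun setT (fun x : borel_cV R d => (z - x : borel_cV R d)).
  apply: measurable_to_cV => i; under eq_fun do rewrite !mxE.
  by apply: measurable_funB => //; exact: measurable_coord.
exact: measurable_dotc.
Qed.

Lemma measurable_rkhs_val u :
  measurable_fun setT (fun x : borel_cV R d => rkhs_val u x).
Proof.
under eq_fun do rewrite -vip_kvec (psdC hP).
apply: (measurable_ip hP rkhs_basis_on rkhs_basis_total).
by apply: measurable_basis => z; exact: measurable_gauss_kernel.
Qed.

(** Since evaluations are bounded, integrating against a finite signed measure
    is a bounded functional and has a representer. *)
Lemma rkhs_representer {dd} {T : measurableType dd} (mu : {measure set T -> \bar R})
    (f : T -> borel_cV R d) (h : T -> R) : measurable_fun setT f ->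
  mu.-integrable setT (EFin \o h) ->
  (forall u, mu.-integrable setT (EFin \o (fun v => rkhs_val u (f v) * h v))) /\
  exists r, forall u, vip r u = \int[mu]_v (rkhs_val u (f v) * h v).
Proof.
move=> mf ih; have mh := (measurable_EFinP _ _).1 (measurable_int mu ih).
have iu u : mu.-integrable setT (EFin \o (fun v => rkhs_val u (f v) * h v)).
  apply: (@integrable_dominated _ _ _ _ _ (fun v => Num.sqrt (vip u u) * `|h v|)).
  - by apply: measurable_funM => //; apply: (measurableT_comp (measurable_rkhs_val u)).
  - by move=> v; rewrite normrM ler_wpM2r // rkhs_val_bound.
  - exact: (integrableZl measurableT _ (integrable_norm ih)).
split => //; pose K := \int[mu]_v `|h v|.
apply: (riesz hP rkhs_basis_on rkhs_basis_total (B := K ^+ 2)) => [a u w|u].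
  rewrite -RintegralZl // -RintegralD //; last exact: (integrableZl measurableT a (iu u)).
  by apply: eq_Rintegral => v _; rewrite rkhs_val_lin; ring.
have K0 : 0 <= K by apply: Rintegral_ge0 => v _.
rewrite -[vip u u]sqr_sqrtr ?(psd_ge0 hP) // -exprMn.
rewrite -[X in X <= _]real_normK ?num_real // ler_pXn2r ?nnegrE ?mulr_ge0 ?sqrtr_ge0 //.
apply: (le_trans (le_normr_Rintegral measurableT (iu u))).
rewrite mulrC -RintegralZl //; last exact: integrable_norm.
apply: le_Rintegral => //.
- exact: (integrable_norm (iu u)).
- exact: (integrableZl measurableT _ (integrable_norm ih)).
by move=> v _; rewrite normrM ler_wpM2r // rkhs_val_bound.
Qed.

End GaussianRkhs.

(** * Kernels projected off a finite dimensional space of functions *)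

Section RintegralSum.
Context {dd} {T : measurableType dd} {R : realType} (mu : {measure set T -> \bar R}).

Lemma Rintegral_sum (I : finType) (f : I -> T -> R) :
  (forall i, mu.-integrable setT (EFin \o f i)) ->
  mu.-integrable setT (EFin \o (fun x => \sum_i f i x)) /\
  \int[mu]_x (\sum_i f i x) = \sum_i \int[mu]_x f i x.
Proof.
move=> fi; elim: (index_enum I) => [|i s [IH1 IH2]].
  split; first by under eq_fun do rewrite big_nil; exact: integrable0.
  under eq_Rintegral do rewrite big_nil.
  by rewrite big_nil /Rintegral integral0.
split; first by under eq_fun do rewrite big_cons; exact: (integrableD measurableT (fi i) IH1).
by under eq_Rintegral do rewrite big_cons; rewrite RintegralD // IH2 big_cons.
Qed.

Lemma integrable_scale (a : R) (f : T -> R) : mu.-integrable setT (EFin \o f) ->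
  mu.-integrable setT (EFin \o (fun x => a * f x)).
Proof. exact: integrableZl. Qed.

End RintegralSum.

Section Frame.
Context {R : realType} {d : nat} {sigma : R} (sigma0 : 0 < sigma).
Context {H : rkhs (@gauss_kernel R d sigma)}.
Notation V := (rkhs_vec H).
Notation hP := (vip_hilbert H).
Context {dd} {T : measurableType dd} (mu : probability T R).
Context {phi : T -> borel_cV R d} (mphi : measurable_fun setT phi).
Context {J : finType} {c : J -> R} {h : J -> T -> R}.
Hypothesis mh : forall j, measurable_fun setT (h j).
Hypothesis h2 : forall j, mu.-integrable setT (EFin \o (fun v => h j v ^+ 2)).

Lemma frame_integrable j : mu.-integrable setT (EFin \o h j).
Proof.
have i1 : mu.-integrable setT (EFin \o (fun _ : T => (1 : R) ^+ 2)).
  exact: finite_measure_integrable_cst.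
have := integrable_mul_sqr (mh j) (measurable_cst (1 : R)) (h2 j) i1.
by under eq_fun do rewrite mulr1.
Qed.

Lemma frame_integrable2 i j : mu.-integrable setT (EFin \o (fun v => h i v * h j v)).
Proof. exact: integrable_mul_sqr. Qed.

(** The weak integral of [h j v *: kvec H (phi v)]. *)
Definition frame_rep (j : J) : V :=
  proj1_sig (cid (rkhs_representer sigma0 mphi (frame_integrable j)).2).

Lemma frame_repE j u :
  vip (frame_rep j) u = \int[mu]_v (rkhs_val u (phi v) * h j v).
Proof. by rewrite /frame_rep; case: cid. Qed.

Lemma frame_rep_val j z :
  rkhs_val (frame_rep j) z = \int[mu]_v (gauss_kernel sigma (phi v) z * h j v).
Proof. by rewrite -vip_kvec frame_repE. Qed.

Definition frame_feature (x : borel_cV R d) (w : J -> R) : V :=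
  kvec H x - \sum_j (c j * w j) *: frame_rep j.

(** The functions [h j] with weights [c j] form a reproducing frame of their
    span for the inner product of $L^2(\mu)$, so that the kernel
    [\sum_j c j * h j v * h j w] is the orthogonal projection on the span. *)
Hypothesis reproducing : forall i w,
  \sum_j c j * (\int[mu]_v (h j v * h i v)) * h j w = h i w.

Lemma frame_rep_reproducing i :
  frame_rep i = \sum_j (c j * \int[mu]_v (h j v * h i v)) *: frame_rep j.
Proof.
apply/subr0_eq/(hilbert_eq0 hP); set y := _ - _.
have E u : vip y u = 0.
  rewrite (psdBl hP) (psd_suml hP); apply/eqP; rewrite subr_eq0; apply/eqP.
  under eq_bigr do rewrite (psdZl hP) frame_repE.
  rewrite frame_repE.
  have iu j := (rkhs_representer (H := H) sigma0 mphi (frame_integrable j)).1 u.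
  pose e j := c j * \int[mu]_v (h j v * h i v).
  transitivity (\sum_j \int[mu]_v (e j * (rkhs_val u (phi v) * h j v))); last first.
    by apply: eq_bigr => j _; rewrite RintegralZl.
  rewrite -(Rintegral_sum (fun j => integrable_scale (e j) (iu j))).2.
  apply: eq_Rintegral => v _; rewrite -{1}reproducing mulr_sumr.
  by apply: eq_bigr => j _; rewrite /e; ring.
exact: E.
Qed.

(** Expanding the square, the cross term is twice the trace of the kernel on the
    span, and the reproducing property makes the last term equal to this
    trace. *)
Lemma frame_trace :
  mu.-integrable setT (EFin \o (fun v =>
    vip (frame_feature (phi v) (h^~ v)) (frame_feature (phi v) (h^~ v)))) /\
  \int[mu]_v vip (frame_feature (phi v) (h^~ v)) (frame_feature (phi v) (h^~ v)) =
  1 - \sum_j c j * \int[mu]_v (rkhs_val (frame_rep j) (phi v) * h j v).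
Proof.
have iR i j := (rkhs_representer (H := H) sigma0 mphi (frame_integrable j)).1 (frame_rep i).
pose a v j := 2 * c j * (rkhs_val (frame_rep j) (phi v) * h j v).
pose b v i := \sum_j c i * c j * vip (frame_rep i) (frame_rep j) * (h i v * h j v).
have E v : vip (frame_feature (phi v) (h^~ v)) (frame_feature (phi v) (h^~ v)) =
    1 - \sum_j a v j + \sum_i b v i.
  rewrite /frame_feature (psdBB hP) vip_kvec kvecE gauss_kernel_refl //.
  rewrite (psdC hP (kvec _ _)) vip_kvec; congr (_ - _ + _).
    rewrite -vip_kvec (psd_suml hP) mulr_sumr; apply: eq_bigr => j _.
    by rewrite (psdZl hP) vip_kvec /a; ring.
  rewrite (psd_suml hP); apply: eq_bigr => i _.
  rewrite (psd_sumr hP) /b; apply: eq_bigr => j _.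
  by rewrite (psdZl hP) (psdZr hP); ring.
have ia j : mu.-integrable setT (EFin \o (a^~ j)) by exact: integrable_scale.
have [ib1 ib2] : (forall i, mu.-integrable setT (EFin \o (b^~ i))) /\
    forall i, \int[mu]_v b v i =
    \sum_j c i * c j * vip (frame_rep i) (frame_rep j) * \int[mu]_v (h i v * h j v).
  have ib i j := integrable_scale (c i * c j * vip (frame_rep i) (frame_rep j))
    (frame_integrable2 i j).
  split=> i; first exact: (Rintegral_sum (ib i)).1.
  rewrite (Rintegral_sum (ib i)).2; apply: eq_bigr => j _.
  by rewrite RintegralZl //; exact: frame_integrable2.
have [iA sA] := Rintegral_sum ia; have [iB sB] := Rintegral_sum ib1.
have i1 : mu.-integrable setT (EFin \o (fun _ : T => (1 : R))).
  exact: finite_measure_integrable_cst.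
have iBA := integrableB measurableT i1 iA.
split; first by under eq_fun do rewrite E; exact: (integrableD measurableT iBA iB).
under eq_Rintegral do rewrite E.
have mu1 : \int[mu]_v (1 : R) = 1.
  by rewrite Rintegral_cst // mul1r; exact: (congr1 fine (probability_setT mu)).
rewrite RintegralD // RintegralB // sA sB mu1 -addrA; congr (_ + _).
under [X in _ + X]eq_bigr do rewrite ib2.
have -> : \sum_i \sum_j c i * c j * vip (frame_rep i) (frame_rep j) *
    \int[mu]_v (h i v * h j v) = \sum_i c i * vip (frame_rep i) (frame_rep i).
  apply: eq_bigr => i _; rewrite [X in _ = _ * vip X _]frame_rep_reproducing.
  rewrite (psd_suml hP) mulr_sumr; apply: eq_bigr => j _.
  rewrite (psdZl hP) (psdC hP (frame_rep j)).
  by under [X in _ = _ * (_ * X * _)]eq_Rintegral do rewrite mulrC; ring.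
rewrite -sumrN -big_split -sumrN; apply: eq_bigr => i _ /=.
by rewrite frame_repE /a RintegralZl //; ring.
Qed.

End Frame.

(** * Quadratic polynomials under a Gaussian law *)

Section QuadraticMoments.
Context {R : realType} {n : nat} {G : probability (borel_cV R n) R}.
Hypothesis Gstd : std_gaussian G.

Section Tilted.
Context {Q : 'M[R]_n}.
Hypothesis Qpos : posdef Q.
Let C := invmx Q.

Lemma has_moment_lin (a : R) P P' p p' : has_moment (G := G) (Q := Q) P p ->
  has_moment (G := G) (Q := Q) P' p' ->
  has_moment (G := G) (Q := Q) (fun v => a * P v + P' v) (fun b => a * p b + p' b).
Proof.
move=> HP HP' b; have [I E] := HP b; have [I' E'] := HP' b.
have aI := integrable_scale a I.
have X v : (a * P v + P' v) * gauss_weight Q b v =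
    a * (P v * gauss_weight Q b v) + P' v * gauss_weight Q b v by ring.
split; first by under eq_fun do rewrite X; exact: (integrableD measurableT aI I').
under eq_Rintegral do rewrite X.
by rewrite RintegralD // RintegralZl // E E'; ring.
Qed.

(** [x] is the expectation of [P] under the law $N(0, Q^{-1})$. *)
Definition ev (P : 'cV[R]_n -> R) (x : R) : Prop :=
  G.-integrable setT (EFin \o (fun v : borel_cV R n => P v * gauss_weight Q 0 v)) /\
  \int[G]_v (P v * gauss_weight Q 0 v) = (Num.sqrt (\det Q))^-1 * x.

Lemma has_moment_ev P p : has_moment (G := G) (Q := Q) P p -> ev P (p 0).
Proof.
move=> HP; have [I E] := HP 0; split => //.
rewrite E /gauss_mass mulmx0 [dotc 0 0](_ : _ = 0) ?mul0r ?expR0 ?mulr1 1?mulrC //.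
by rewrite /dotc mulmx0 mxE.
Qed.

Lemma ev1 : ev (fun=> 1) 1.
Proof. exact: (has_moment_ev (has_moment1 Gstd Qpos)). Qed.

Lemma ev_lin (a : R) P P' x x' : ev P x -> ev P' x' ->
  ev (fun v => a * P v + P' v) (a * x + x').
Proof.
move=> [I E] [I' E']; have aI := integrable_scale a I.
have X v : (a * P v + P' v) * gauss_weight Q 0 v =
    a * (P v * gauss_weight Q 0 v) + P' v * gauss_weight Q 0 v by ring.
split; first by under eq_fun do rewrite X; exact: (integrableD measurableT aI I').
under eq_Rintegral do rewrite X.
by rewrite RintegralD // RintegralZl // E E'; ring.
Qed.

Lemma ev_ext P P' x x' : (forall v, P v = P' v) -> x = x' -> ev P x -> ev P' x'.
Proof. by move=> /funext -> ->. Qed.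

Lemma ev_scale (a : R) P x : ev P x -> ev (fun v => a * P v) (a * x).
Proof.
move=> [I E]; have aI := integrable_scale a I.
have X v : a * P v * gauss_weight Q 0 v = a * (P v * gauss_weight Q 0 v).
  by rewrite mulrA.
split; first by under eq_fun do rewrite X.
by under eq_Rintegral do rewrite X; rewrite RintegralZl // E; ring.
Qed.

Lemma ev_sum (I : finType) (P : I -> 'cV[R]_n -> R) (x : I -> R) :
  (forall i, ev (P i) (x i)) -> ev (fun v => \sum_i P i v) (\sum_i x i).
Proof.
move=> H.
have X v : (\sum_i P i v) * gauss_weight Q 0 v = \sum_i (P i v * gauss_weight Q 0 v).
  by rewrite mulr_suml.
have [J E] := Rintegral_sum (fun i => (H i).1).
split; first by under eq_fun do rewrite X.
under eq_Rintegral do rewrite X.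
by rewrite E mulr_sumr; apply: eq_bigr => i _; exact: (H i).2.
Qed.

Let lin0 i : lin (Q := Q) i 0 = 0.
Proof. by rewrite /lin mulmx0 mxE. Qed.

Lemma ev_coord i : ev (fun v => v i 0) 0.
Proof.
by apply: ev_ext (has_moment_ev (has_moment_coord Gstd Qpos i)) => //; rewrite lin0.
Qed.

Lemma ev_coord2 i j : ev (fun v => v i 0 * v j 0) (C i j).
Proof.
apply: ev_ext (has_moment_ev (has_moment2 Gstd Qpos i j)) => //.
by rewrite !lin0 mulr0 addr0.
Qed.

Lemma ev_coord3 i j k : ev (fun v => v i 0 * v j 0 * v k 0) 0.
Proof.
apply: ev_ext (has_moment_ev (has_moment3 Gstd Qpos i j k)) => //.
by rewrite !lin0; ring.
Qed.

Lemma ev_coord4 i j k l : ev (fun v => v i 0 * v j 0 * v k 0 * v l 0)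
  (C i k * C j l + C i l * C j k + C i j * C k l).
Proof.
by have [pol [H <-]] := has_moment4 Gstd Qpos i j k l; exact: has_moment_ev.
Qed.

Lemma quad_formE (M : 'M[R]_n) (v : 'cV[R]_n) :
  dotc v (M *m v) = \sum_i \sum_j M i j * (v i 0 * v j 0).
Proof.
rewrite dotcE; apply: eq_bigr => i _; rewrite mxE mulr_sumr.
by apply: eq_bigr => j _; ring.
Qed.

Let CS i j : C i j = C j i.
Proof. exact: (inv_posdef_sym Qpos). Qed.

Lemma ev_quad (M : 'M[R]_n) : ev (fun v => dotc v (M *m v)) (\tr (M *m C)).
Proof.
apply: ev_ext (ev_sum (fun i => ev_sum (fun j => ev_scale (M i j) (ev_coord2 i j)))).
- by move=> v; rewrite quad_formE.
- rewrite mxtrace_mul_sum; apply: eq_bigr => i _; apply: eq_bigr => j _.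
  by rewrite CS.
Qed.

(** In Isserlis' formula one pairing gives the square of the trace, and the two
    crossed ones agree because [M] is symmetric. *)
Lemma ev_quad_sqr (M : 'M[R]_n) : M^T = M ->
  ev (fun v => dotc v (M *m v) ^+ 2)
     (\tr (M *m C) ^+ 2 + 2 * \tr (M *m C *m (M *m C))).
Proof.
move=> MT; have MS i j : M i j = M j i by rewrite -[in LHS]MT mxE.
apply: ev_ext (ev_sum (fun i => ev_sum (fun j => ev_sum (fun k => ev_sum (fun l =>
  ev_scale (M i j * M k l) (ev_coord4 i j k l)))))).
- move=> v; rewrite quad_formE expr2 mulr_suml; apply: eq_bigr => i _.
  rewrite mulr_suml; apply: eq_bigr => j _.
  rewrite mulr_sumr; apply: eq_bigr => k _.
  by rewrite mulr_sumr; apply: eq_bigr => l _; ring.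
- pose S4 (F : 'I_n -> 'I_n -> 'I_n -> 'I_n -> R) :=
    \sum_i \sum_j \sum_k \sum_l F i j k l.
  have S4D F F' : S4 (fun i j k l => F i j k l + F' i j k l) = S4 F + S4 F'.
    rewrite /S4 -big_split; apply: eq_bigr => i _ /=.
    rewrite -big_split; apply: eq_bigr => j _ /=.
    by rewrite -big_split; apply: eq_bigr => k _ /=; rewrite -big_split.
  have T2 : \tr (M *m C *m (M *m C)) = S4 (fun i j k l => M i j * M k l * (C i k * C j l)).
    rewrite mxtrace_mul_sum; apply: eq_bigr => i _.
    transitivity (\sum_l \sum_j \sum_k M i j * M k l * (C i k * C j l)).
      apply: eq_bigr => l _; rewrite mxE mulr_suml; apply: eq_bigr => j _.
      rewrite mxE mulr_sumr; apply: eq_bigr => k _.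
      by rewrite (MS l k) (CS k i); ring.
    by rewrite exchange_big; apply: eq_bigr => j _; rewrite exchange_big.
  have T2' : \tr (M *m C *m (M *m C)) = S4 (fun i j k l => M i j * M k l * (C i l * C j k)).
    rewrite T2; apply: eq_bigr => i _; apply: eq_bigr => j _.
    rewrite exchange_big; apply: eq_bigr => k _; apply: eq_bigr => l _.
    by rewrite (MS l k).
  have T1 : \tr (M *m C) ^+ 2 = S4 (fun i j k l => M i j * M k l * (C i j * C k l)).
    rewrite expr2 mxtrace_mul_sum mulr_suml; apply: eq_bigr => i _.
    rewrite mulr_suml; apply: eq_bigr => j _.
    rewrite mulr_sumr; apply: eq_bigr => k _.
    by rewrite mulr_sumr; apply: eq_bigr => l _; rewrite (CS j i) (CS l k); ring.
  rewrite T1 mulr_natl mulr2n {1}T2 T2' -!S4D.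
  apply: eq_bigr => i _; apply: eq_bigr => j _; apply: eq_bigr => k _.
  by apply: eq_bigr => l _; ring.
Qed.

End Tilted.

End QuadraticMoments.

(** * The Hermite polynomials of degree at most two *)

Section Hermite.
Context {R : realType} {d : nat}.

Definition hermite_index : finType := (unit + ('I_d + 'I_d * 'I_d))%type.

Definition hermite (j : hermite_index) (v : 'cV[R]_d) : R :=
  match j with
  | inl _ => 1
  | inr (inl i) => v i 0
  | inr (inr (i, k)) => v i 0 * v k 0 - (i == k)%:R
  end.

(** The pairs [(i, k)] and [(k, i)] index the same polynomial, whence the weight
    [2^-1]. *)
Definition hermite_weight (j : hermite_index) : R :=
  match j with inl _ => 1 | inr (inl _) => 1 | inr (inr _) => 2^-1 end.

Lemma sum_hermite (F : hermite_index -> R) :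
  \sum_j F j = F (inl tt) + (\sum_i F (inr (inl i)) + \sum_p F (inr (inr p))).
Proof.
rewrite big_sumType /= big_sumType /=; congr (_ + _).
by rewrite (big_pred1 tt) // => -[].
Qed.

Lemma measurable_hermite j :
  measurable_fun setT (fun v : borel_cV R d => hermite j v).
Proof.
case: j => [u|[i|[i k]]] /=; first exact: measurable_cst.
- exact: measurable_coord.
- apply: measurable_funB => //.
  by apply: measurable_funM; exact: measurable_coord.
Qed.

Context {G : probability (borel_cV R d) R}.
Hypothesis Gstd : std_gaussian G.

Lemma posdef1 : posdef (1%:M : 'M[R]_d).
Proof.
split; first exact: trmx1.
move=> v v0; rewrite mul1mx lt_def dotc_ge0 andbT.
by apply: contraNneq v0 => /dotc_eq0 ->.
Qed.

Let ev1' := ev (G := G) (Q := (1%:M : 'M[R]_d)).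

Lemma ev_identity P x : ev1' P x ->
  G.-integrable setT (EFin \o (P : borel_cV R d -> R)) /\ \int[G]_v P v = x.
Proof.
have E (v : borel_cV R d) : P v * gauss_weight 1%:M 0 v = P v.
  by rewrite /gauss_weight mul1mx subrr oppr0 mul0r add0r /dotc trmx0 mul0mx mxE expR0 mulr1.
move=> [I]; under eq_Rintegral do rewrite E.
rewrite det1 sqrtr1 invr1 mul1r => ->; split => //.
by move: I; under eq_fun do rewrite E.
Qed.

Let del (i j : 'I_d) : R := (i == j)%:R.

Let std2 i j : ev1' (fun v => v i 0 * v j 0) (del i j).
Proof.
by apply: ev_ext (ev_coord2 Gstd posdef1 i j) => //; rewrite invmx1 mxE.
Qed.

Let std4 i j k l : ev1' (fun v => v i 0 * v j 0 * v k 0 * v l 0)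
  (del i k * del j l + del i l * del j k + del i j * del k l).
Proof.
by apply: ev_ext (ev_coord4 Gstd posdef1 i j k l) => //; rewrite invmx1 !mxE.
Qed.

Definition hermite_gram (j j' : hermite_index) : R :=
  match j, j' with
  | inl _, inl _ => 1
  | inr (inl i), inr (inl k) => (i == k)%:R
  | inr (inr (i, k)), inr (inr (i', k')) =>
      (i == i')%:R * (k == k')%:R + (i == k')%:R * (k == i')%:R
  | _, _ => 0
  end.

Lemma ev_hermite_mul j j' :
  ev1' (fun v => hermite j v * hermite j' v) (hermite_gram j j').
Proof.
have e1 := ev1 Gstd posdef1.
case: j => [u|[i|[i k]]]; case: j' => [u'|[i'|[i' k']]] /=.
- by apply: ev_ext e1 => // v; rewrite mulr1.
- by apply: ev_ext (ev_coord Gstd posdef1 i') => // v; rewrite mul1r.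
- apply: ev_ext (ev_lin (- del i' k') e1 (std2 i' k')); last by rewrite mulr1 addNr.
  by move=> v; rewrite mul1r mulr1 addrC.
- by apply: ev_ext (ev_coord Gstd posdef1 i) => // v; rewrite mulr1.
- exact: std2.
- apply: ev_ext (ev_lin (- del i' k') (ev_coord Gstd posdef1 i) (ev_coord3 Gstd posdef1 i i' k')).
    by move=> v; rewrite /del; ring.
  by rewrite mulr0 addr0.
- apply: ev_ext (ev_lin (- del i k) e1 (std2 i k)); last by rewrite mulr1 addNr.
  by move=> v; rewrite !mulr1 addrC.
- apply: ev_ext (ev_lin (- del i k) (ev_coord Gstd posdef1 i') (ev_coord3 Gstd posdef1 i k i')).
    by move=> v; rewrite /del; ring.
  by rewrite mulr0 addr0.
- apply: ev_ext (ev_lin (- del i' k') (std2 i k) (ev_lin (- del i k) (std2 i' k')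
    (ev_lin (del i k * del i' k') e1 (std4 i k i' k')))).
    by move=> v; rewrite /del; ring.
  rewrite -!/(del _ _); ring.
Qed.

Lemma hermite_gramE j j' : \int[G]_v (hermite j v * hermite j' v) = hermite_gram j j'.
Proof. exact: (ev_identity (ev_hermite_mul j j')).2. Qed.

Lemma hermite_sqr_integrable j :
  G.-integrable setT (EFin \o (fun v => hermite j v ^+ 2)).
Proof.
by under eq_fun do rewrite expr2; exact: (ev_identity (ev_hermite_mul j j)).1.
Qed.

(** The Gram matrix is the identity in degree at most one, and the sum of the
    identity and of the flip of pairs in degree two. *)
Lemma hermite_reproducing i (w : 'cV[R]_d) :
  \sum_j hermite_weight j * (\int[G]_v (hermite j v * hermite i v)) * hermite j w =
  hermite i w.
Proof.
under eq_bigr do rewrite hermite_gramE.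
rewrite sum_hermite; case: i => [[]|[k|[k l]]] /=.
- rewrite !big1 => [|[i k] _|i _]; rewrite ?mulr0 ?mul0r //.
  by rewrite !addr0 !mulr1.
- rewrite (bigD1 k) //= eqxx !big1 => [|[i j] _|i ik]; rewrite ?mulr0 ?mul0r ?(negbTE ik) ?mulr0 ?mul0r //.
  by rewrite !(mul0r, mulr0, add0r, addr0, mul1r, mulr1).
- rewrite big1 => [|i _]; last by rewrite !mulr0 mul0r.
  have sel (p0 : 'I_d * 'I_d) (X : 'I_d * 'I_d -> R) :
      \sum_p ((p.1 == p0.1)%:R * (p.2 == p0.2)%:R) * X p = X p0.
    rewrite (bigD1 p0) //= !eqxx !mul1r big1 ?addr0 // => -[p1 p2] pp.
    by rewrite -natrM mulnb -[_ && _]/((p1, p2) == p0) (negbTE pp) mul0r.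
  pose X (p : 'I_d * 'I_d) := w p.1 0 * w p.2 0 - (p.1 == p.2)%:R.
  transitivity (2^-1 * (\sum_p ((p.1 == k)%:R * (p.2 == l)%:R) * X p +
      \sum_p ((p.1 == l)%:R * (p.2 == k)%:R) * X p)).
    rewrite mulr0 mul0r !add0r mulrDr !mulr_sumr -big_split; apply: eq_bigr => -[i j] _.
    by rewrite /X /=; ring.
  rewrite (sel (k, l)) (sel (l, k)) /X /= [w l 0 * _]mulrC [l == k]eq_sym.
  by field.
Qed.

End Hermite.

(** * The features as projected kernels *)

Section Features.
Context {R : realType} {d : nat} {sigma : R} (sigma0 : 0 < sigma).
Context {H : rkhs (@gauss_kernel R d sigma)}.
Context (m0 : 'cV[R]_d) (A : 'M[R]_d).
Context {G : probability (borel_cV R d) R} (Gstd : std_gaussian G).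
Implicit Types (z v w c : 'cV[R]_d).

Let S := A *m A^T.
Let V := Vmx sigma S.
Let Vi := invmx V.
Let Q := 1%:M + (2 * sigma) *: (A^T *m A).
Let C := invmx Q.
Let J := (2 * sigma) *: (A^T *m Vi *m A).
Let Qpos : posdef Q := posdef_tilt sigma0.
Let Vpos : posdef V := posdef_Vmx sigma0.
Let CE : C = 1%:M - J := tilt_cov sigma0.

Definition affine_map (v : borel_cV R d) : borel_cV R d := m0 + A *m v.

Lemma measurable_affine_map : measurable_fun setT affine_map.
Proof.
apply: measurable_to_cV => i.
have -> : (fun v : borel_cV R d => (affine_map v : 'cV[R]_d) i 0) =
    (fun v : borel_cV R d => m0 i 0 + (A *m v : 'cV[R]_d) i 0).
  by apply/funext => v; rewrite /affine_map mxE.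
apply: measurable_funD => //.
exact: (measurableT_comp (measurable_coord i) (measurable_mulmx A)).
Qed.

(** The tilt that the kernel at [z] puts on the standard Gaussian law. *)
Definition tilt z : 'cV[R]_d := (2 * sigma) *: (A^T *m (z - m0)).

(** As a function of [v] the shifted kernel is a tilted Gaussian weight, so its
    integrals against polynomials are moments. *)
Lemma shifted_kernel v z : gauss_kernel sigma (affine_map v) z =
  expR (- sigma * dotc (z - m0) (z - m0)) * gauss_weight Q (tilt z) v.
Proof.
rewrite gauss_kernelE /gauss_weight -expRD; congr expR.
have -> : affine_map v - z = A *m v - (z - m0).
  by rewrite /affine_map opprB [m0 + _]addrC -addrA; congr (_ + _); rewrite addrC.
rewrite /tilt /Q mulmxDl mul1mx -scalemxAl -mulmxA; move: (z - m0) => c.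
rewrite !(dotcDl, dotcDr, dotcNl, dotcNr, dotcZl, dotcZr) [dotc v (A^T *m _)]dotc_mulmx trmxK.
rewrite -[dotc (A^T *m c) v]dotc_mulmx (dotcC (A *m v) c).
by field.
Qed.

Lemma tilted_mass z : expR (- sigma * dotc (z - m0) (z - m0)) *
  gauss_mass (Q := Q) (tilt z) = mean_embedding sigma m0 S z.
Proof.
rewrite /gauss_mass /mean_embedding /Q tilt_det // mulrCA; congr (_ * _).
rewrite -expRD /tilt; congr expR; move: (z - m0) => c.
have -> : (c^T *m invmx (Vmx sigma S) *m c) 0 0 = dotc c (Vi *m c).
  by rewrite /dotc mulmxA.
rewrite /Vi tilt_woodbury // mulmxBl mul1mx -scalemxAl dotcDr dotcNr dotcZr.
rewrite -scalemxAr !(dotcZl, dotcZr) -/Q -/C.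
have -> : dotc (A^T *m c) (C *m (A^T *m c)) = dotc c (A *m C *m A^T *m c).
  by rewrite -!mulmxA [RHS]dotc_mulmx.
by field.
Qed.

Lemma tilt_mean z : C *m tilt z = (2 * sigma) *: (A^T *m Vi *m (z - m0)).
Proof. by rewrite /tilt -scalemxAr mulmxA tilt_push. Qed.

Definition hermite_mean (j : hermite_index) (b : 'cV[R]_d) : R :=
  match j with
  | inl _ => 1
  | inr (inl i) => lin (Q := Q) i b
  | inr (inr (i, k)) => C i k + lin (Q := Q) i b * lin (Q := Q) k b - (i == k)%:R
  end.

Lemma has_moment_hermite j :
  has_moment (G := G) (Q := Q) (hermite j) (hermite_mean j).
Proof.
have m1 := has_moment1 Gstd Qpos.
case: j => [u|[i|[i k]]]; [exact: m1|exact: has_moment_coord|].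
have := has_moment_lin (- (i == k)%:R) m1 (has_moment2 Gstd Qpos i k).
have -> : (fun v : 'cV[R]_d => - (i == k)%:R * 1 + v i 0 * v k 0) = hermite (inr (inr (i, k))).
  by apply/funext => v /=; rewrite mulr1 addrC.
congr (has_moment _ _); apply/funext => b /=.
by rewrite mulr1 addrC.
Qed.

Let mphi := measurable_affine_map.
Let rep := frame_rep (H := H) sigma0 mphi (@measurable_hermite R d)
  (hermite_sqr_integrable Gstd).

(** Integrating a shifted kernel against a Hermite polynomial gives the mean
    embedding times the moment of this polynomial under the tilted law. *)
Lemma rep_closed_form j z :
  rkhs_val (rep j) z = mean_embedding sigma m0 S z * hermite_mean j (tilt z).
Proof.
rewrite /rep frame_rep_val -tilted_mass.
have [I E] := has_moment_hermite j (tilt z).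
rewrite -mulrA [gauss_mass _ * _]mulrC -E -RintegralZl //.
by apply: eq_Rintegral => v _; rewrite shifted_kernel; ring.
Qed.

Let Fw w := frame_feature (H := H) (c := @hermite_weight R d) sigma0 mphi
  (@measurable_hermite R d) (hermite_sqr_integrable Gstd)
  (affine_map w) (fun j => hermite j w).

Lemma hermite_expansion w b : let a := C *m b in
  \sum_j (hermite_weight j * hermite j w) * hermite_mean j b =
  1 + dotc a w + 2^-1 * \tr ((a *m a^T - J) *m (w *m w^T - 1%:M)).
Proof.
move=> a; have la i : lin (Q := Q) i b = a i 0 by [].
rewrite sum_hermite /= !mulr1 addrA; congr (1 + _ + _).
  by rewrite dotcE; apply: eq_bigr => i _; rewrite la mul1r mulrC.
rewrite mxtrace_mul_sum pair_big mulr_sumr; apply: eq_bigr => -[i k] _ /=.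
rewrite !la CE !mxE !big_ord1 !mxE [k == i]eq_sym; ring.
Qed.

(** The Hermite coefficients of degree one and two of the kernel shifted along
    [affine_map] are, up to composition with [A], the derivatives of the mean
    embedding in the mean and in the covariance. This is why subtracting the embedding and its derivative amounts to subtracting the
    projection on the polynomials of degree at most two. *)
Lemma feature_frame w :
  rkhs_val (Fw w) = feature sigma m0 S (affine_map w).
Proof.
apply/funext => z.
rewrite -vip_kvec /Fw /frame_feature (psdBl (vip_hilbert H)) vip_kvec kvecE.
rewrite (psd_suml (vip_hilbert H)) /feature -/V -/Vi; congr (_ - _).
transitivity (mean_embedding sigma m0 S z * \sum_j (hermite_weight j * hermite j w) *
    hermite_mean j (tilt z)).
  rewrite mulr_sumr; apply: eq_bigr => j _.
  rewrite (psdZl (vip_hilbert H)) vip_kvec -/(rep j) rep_closed_form; ring.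
congr (_ * _); rewrite hermite_expansion tilt_mean.
set c := z - m0; set a := (2 * sigma) *: (A^T *m Vi *m c).
have xw : affine_map w - m0 = A *m w by rewrite /affine_map addrC addKr.
have ViT : Vi^T = Vi by rewrite /Vi trmx_inv Vpos.1.
congr (1 + _ + _).
- rewrite xw /a dotcZl; congr (_ * _).
  by rewrite /dotc !trmx_mul trmxK ViT !mulmxA.
- rewrite /Bmx xw.
  have -> : A *m w *m (A *m w)^T - S = A *m (w *m w^T - 1%:M) *m A^T.
    by rewrite mulmxBr mulmxBl mulmx1 trmx_mul !mulmxA.
  set X := w *m w^T - 1%:M.
  pose Y := Vi *m ((2 * sigma) *: (c *m c^T *m Vi)) - Vi.
  have -> : Vi *m ((2 * sigma) *: (c *m c^T *m Vi) - 1%:M) = Y.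
    by rewrite mulmxBr mulmx1.
  have -> : a *m a^T - J = (2 * sigma) *: (A^T *m Y *m A).
    rewrite /Y mulmxBr mulmxBl scalerBr; congr (_ - _).
    rewrite /a linearZ /= !trmx_mul trmxK ViT -!scalemxAl -!scalemxAr.
    by rewrite -!scalemxAl !mulmxA.
  have -> : \tr (Y *m (A *m X *m A^T)) = \tr (A^T *m Y *m A *m X).
    by rewrite mulmxA mxtrace_mulC !mulmxA.
  by rewrite -scalemxAl mxtraceZ mulrA; congr (_ * _); field.
Qed.

Lemma mxtrace_outer v (M : 'M[R]_d) : \tr (v *m v^T *m M) = dotc v (M *m v).
Proof. by rewrite -mulmxA mxtrace_mulC /mxtrace big_ord1 -mulmxA. Qed.

Let W := invmx (V + (2 * sigma) *: S) *m S.

(** The diagonal of the projected part of the kernel is a polynomial of degree four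
    times the Gaussian weight of [1%:M + J], which Isserlis' formula
    integrates. *)
Lemma integral_feature_sqnorm :
  G.-integrable setT (EFin \o (fun w => vip (Fw w) (Fw w))) /\
  \int[G]_w vip (Fw w) (Fw w) = 1 - (Num.sqrt (\det (2 *: V - 1%:M)))^-1 *
     (1 + 2 * sigma * \tr W + 2 * sigma ^+ 2 * \tr W ^+ 2
      + 4 * sigma ^+ 2 * \tr (W *m W)).
Proof.
have [I E] := frame_trace (H := H) sigma0 mphi (@measurable_hermite R d)
  (hermite_sqr_integrable Gstd) (hermite_reproducing Gstd).
split; [exact: I|rewrite [LHS]E; congr (1 - _)].
pose K := 1%:M + J; have Kpos : posdef K := posdef_1J sigma0.
have iR j := (rkhs_representer (H := H) sigma0 mphi
  (frame_integrable (@measurable_hermite R d) (hermite_sqr_integrable Gstd) j)).1 (rep j).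
transitivity (\int[G]_v \sum_j
    (hermite_weight j * (rkhs_val (rep j) (affine_map v) * hermite j v))).
  rewrite (Rintegral_sum (fun j => integrable_scale (hermite_weight j) (iR j))).2.
  by apply: eq_bigr => j _; rewrite RintegralZl.
pose P v := 1 + dotc v (J *m v) +
   2^-1 * (dotc v (J *m v) ^+ 2 - dotc v (J *m v) - dotc v (J *m J *m v) + \tr J).
have Pint v : \sum_j (hermite_weight j * (rkhs_val (rep j) (affine_map v) * hermite j v)) =
    (Num.sqrt (\det V))^-1 * (P v * gauss_weight K 0 v).
  have vm : affine_map v - m0 = A *m v by rewrite /affine_map addrC addKr.
  transitivity (mean_embedding sigma m0 S (affine_map v) *
     \sum_j (hermite_weight j * hermite j v) * hermite_mean j (tilt (affine_map v))).
    by rewrite mulr_sumr; apply: eq_bigr => j _; rewrite rep_closed_form; ring.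
  have -> : mean_embedding sigma m0 S (affine_map v) =
      (Num.sqrt (\det V))^-1 * gauss_weight K 0 v.
    rewrite /mean_embedding /gauss_weight vm; congr (_ * expR _).
    rewrite -/V -/Vi /K mulmxDl mul1mx [dotc 0 v](_ : _ = 0); last first.
      by rewrite /dotc trmx0 mul0mx mxE.
    rewrite dotcDr /J -scalemxAl dotcZr.
    have -> : dotc v (A^T *m Vi *m A *m v) = ((A *m v)^T *m Vi *m (A *m v)) 0 0.
      by rewrite /dotc trmx_mul !mulmxA.
    by field.
  rewrite -mulrA; congr (_ * _); rewrite mulrC; congr (_ * _).
  rewrite hermite_expansion tilt_mean vm.
  have -> : (2 * sigma) *: (A^T *m Vi *m (A *m v)) = J *m v.
    by rewrite /J -scalemxAl !mulmxA.
  have JT : J^T = J := tilt_symm sigma0.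
  rewrite /P dotcC; congr (_ + _ * _).
  rewrite mulmxBl !mulmxBr !mulmx1 !linearB /= mxtrace_outer.
  rewrite mulmx_outer dotcZr (dotcC (J *m v) v) -expr2.
  have -> : \tr (J *m v *m (J *m v)^T) = dotc v (J *m J *m v).
    rewrite -[X in \tr X]mulmx1 mxtrace_outer mul1mx -mulmxA.
    by rewrite [RHS]dotc_mulmx JT.
  by rewrite [\tr (J *m _)]mxtrace_mulC mxtrace_outer; ring.
under eq_Rintegral do rewrite Pint.
have Pev : ev (G := G) (Q := K) P (1 + 2 * sigma * \tr W + 2 * sigma ^+ 2 * \tr W ^+ 2
      + 4 * sigma ^+ 2 * \tr (W *m W)).
  have KU := posdef_unit Kpos.
  have JJK : \tr (J *m J *m invmx K) = \tr J - \tr (J *m invmx K).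
    have <- : J *m (1%:M - invmx K) = J *m J *m invmx K.
      rewrite -mulmxA; congr (_ *m _).
      by rewrite -(mulmxV KU) {1}/K mulmxDl mul1mx addrAC subrr add0r.
    by rewrite mulmxBr mulmx1 linearB.
  have t1 := tilt_trace (A := A) sigma0; have t2 := tilt_trace2 (A := A) sigma0.
  apply: ev_ext (ev_lin 2^-1 (ev_quad_sqr Gstd Kpos (tilt_symm sigma0))
    (ev_lin 2^-1 (ev_quad Gstd Kpos J) (ev_lin (- 2^-1) (ev_quad Gstd Kpos (J *m J))
      (ev_scale (1 + 2^-1 * \tr J) (ev1 Gstd Kpos))))).
    by move=> v; rewrite /P; field.
  by rewrite JJK t1 t2; field.
rewrite RintegralZl //; last exact: Pev.1.
rewrite Pev.2 mulrA -invfM -sqrtrM ?ltW ?posdef_det // /K tilt_det_1J //.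
congr (_^-1 * _); congr (Num.sqrt (\det _)).
by apply/matrixP => i j; rewrite /V /Vmx !mxE; ring.
Qed.

End Features.

(** * Integrals of functions known outside a null set *)

Section Conull.
Context {dd} {T : measurableType dd} {R : realType} (mu : {measure set T -> \bar R}).
Context {E : set T} (mE : measurable E) (E0 : mu (~` E) = 0%E).
Import HBNNSimple.

(** Here [f] need not be measurable: restricting to [E] the simple functions below
    [f] does not change their integrals. *)
Lemma ge0_integral_conull (f : T -> \bar R) : (forall x, 0 <= f x)%E ->
  (\int[mu]_x f x = \int[mu]_x (f \_ E) x)%E.
Proof.
move=> f0.
have fE0 x : (0 <= (f \_ E) x)%E by rewrite patchE; case: ifP.
have fEf x : ((f \_ E) x <= f x)%E by rewrite patchE; case: ifP.
rewrite !ge0_integralTE //; apply/eqP; rewrite eq_le; apply/andP; split; last first.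
  by apply: le_ereal_sup => _ [h hf <-]; exists h => // x; exact: le_trans (hf x) (fEf x).
apply: ge_ereal_sup => _ [h hf <-].
pose hE : {nnsfun T >-> R} := proj_nnsfun h mE.
have -> : sintegral mu h = sintegral mu hE.
  rewrite -!integralT_nnsfun; apply: ge0_ae_eq_integral => //.
  - exact/measurable_EFinP.
  - exact/measurable_EFinP.
  - by move=> x _; rewrite lee_fin.
  - by move=> x _; rewrite lee_fin.
  - exists (~` E); split => //; first exact: measurableC.
    move=> x /= H Ex; apply: H => _; congr EFin.
    by rewrite /hE /= mindicE mem_set // mulr1.
apply: ereal_sup_ubound; exists hE => // x.
by rewrite /hE /= mindicE patchE; case: ifP => xE; rewrite ?mulr1 ?mulr0.
Qed.

Lemma integral_conull (f : T -> \bar R) :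
  (\int[mu]_x f x = \int[mu]_x (f \_ E) x)%E.
Proof.
rewrite integralE [RHS]integralE funepos_restrict funeneg_restrict.
by rewrite -!ge0_integral_conull.
Qed.

Lemma Rintegral_conull (f g : T -> R) : (forall x, E x -> f x = g x) ->
  \int[mu]_x f x = \int[mu]_x g x.
Proof.
move=> fg; rewrite /Rintegral; congr fine; rewrite integral_conull [RHS]integral_conull.
by apply: eq_integral => x _; rewrite !patchE; case: ifP => // /set_mem/fg ->.
Qed.

End Conull.

(** * The expectation of a weighted sum of squares *)

Section Expectation.
Context {R : realType}.
Notation N01 := (normal_prob (0 : R) 1).

(** The second derivative at [0] of the Laplace transform. *)
Lemma normal_second_moment : (\int[N01]_x ((x : R) ^+ 2)%:E = 1)%E.
Proof.
pose phi (s : R) := expR (s * s * 2^-1).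
have E s : (\int[N01]_x (expR (s * (x : R)))%:E = (phi s)%:E)%E.
  have := normal_laplace s (ltr01 : 0 < (1 : R)).
  rewrite sqrtr1 invr1 mul1r mulr1 expr2 => <-.
  by apply: eq_integral => x _; rewrite subrr mul0r oppr0 mul0r add0r.
have mid : measurable_fun setT (fun x : measurableTypeR R => (x : R)) by [].
have mE s : measurable_fun setT (fun x : measurableTypeR R => 1 * expR (s * (x : R))).
  by apply: measurable_funM => //; apply: measurableT_comp => //; exact: measurable_funM.
have i0 s : N01.-integrable setT (EFin \o (fun x : measurableTypeR R => 1 * expR (s * (x : R)))).
  apply/integrableP; split; first exact/measurable_EFinP.
  rewrite (_ : integral _ _ _ = (phi s)%:E) ?ltry // -E.
  by apply: eq_integral => x _; rewrite /= mul1r ger0_norm ?expR_ge0.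
have e0 s : \int[N01]_x (1 * expR (s * (x : R))) = phi s.
  by rewrite /Rintegral; under eq_integral do rewrite mul1r; rewrite E.
have m1 : measurable_fun setT (fun _ : measurableTypeR R => (1 : R)) by [].
have dphi (s : R) : is_derive s 1 phi (phi s * s).
  have Did := is_derive_id s (1 : R).
  apply: is_derive_eq (is_derive_expR_comp
    (is_derive_mul (is_derive_mul Did Did) (is_derive_const 2^-1 s))) _.
  by rewrite /phi /=; field.
have e1 := laplace_moment i0 e0 dphi.
have i1 := laplace_moment_integrable mid m1 i0.
have dphi1 (s : R) : is_derive s 1 (fun s => phi s * s) (phi s * s * s + phi s * 1).
  exact: is_derive_mul (dphi s) (is_derive_id s (1 : R)).
have e2 := laplace_moment i1 e1 dphi1 0.
have i2 := laplace_moment_integrable mid (measurable_funM m1 mid) i1 0.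
have X (x : measurableTypeR R) : 1 * (x : R) * x * expR (0 * x) = (x : R) ^+ 2.
  by rewrite mul0r expR0 mul1r mulr1 expr2.
transitivity ((\int[N01]_x (1 * (x : R) * x * expR (0 * x)))%:E).
  by rewrite (Rintegral_EFin i2); apply: eq_integral => x _; rewrite X.
by rewrite e2 /phi !mulr0 mul0r expR0 mulr1 add0r.
Qed.

Context {disp : measure_display} {Omega : measurableType disp}.
Context {P : probability Omega R} {X : nat -> {RV P >-> R}}.
Hypothesis Xiid : iid_std_normal X.
Context {lam : nat -> R} (lam0 : forall l, 0 <= lam l).

Lemma iid_second_moment l : (\int[P]_w (X l w ^+ 2)%:E = 1)%E.
Proof.
pose Y : Omega -> measurableTypeR R := X l.
have mY : measurable_fun setT Y.
  by move=> mT B mB; exact: (@measurable_funPT _ _ _ _ (X l) mT B mB).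
have mX2 : measurable_fun setT (fun x : measurableTypeR R => ((x : R) ^+ 2)%:E).
  by apply/measurable_EFinP; exact: measurable_funX.
have sq0 : {in [set: measurableTypeR R], forall x, (0 <= ((x : R) ^+ 2)%:E)%E}.
  by move=> x _; rewrite lee_fin sqr_ge0.
rewrite -normal_second_moment.
have := ge0_integral_pushforward mY P measurableT mX2 sq0.
rewrite preimage_setT => <-.
by apply: eq_measure_integral => B mB _; exact: Xiid.2.
Qed.

Lemma expectation_weighted_squares (Z : {RV P >-> R}) :
  {ae P, forall w, \sum_(0 <= l < n) lam l * X l w ^+ 2 @[n --> \oo] --> Z w} ->
  ('E_P[Z] = \sum_(0 <= l <oo) (lam l)%:E)%E.
Proof.
move=> ZX; rewrite expectation_def.
have mterm l : measurable_fun setT (fun w => (lam l * X l w ^+ 2)%:E).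
  apply/measurable_EFinP; apply: measurable_funM => //.
  exact: measurable_funX.
have term0 l w : (0 <= (lam l * X l w ^+ 2)%:E)%E.
  by rewrite lee_fin mulr_ge0 ?sqr_ge0.
transitivity (\int[P]_w \sum_(0 <= l <oo) (lam l * X l w ^+ 2)%:E)%E.
  apply: ae_eq_integral => //.
  - exact/measurable_EFinP.
  - by apply: ge0_emeasurable_sum => [l w _ _|l _].
  - apply: filterS ZX => w Zw _; apply/esym/cvg_lim => //.
    apply: cvg_EFin; first by apply: nearW => n; rewrite sumEFin.
    apply: cvg_trans Zw; apply: near_eq_cvg; apply: nearW => n /=.
    by rewrite sumEFin.
rewrite integral_nneseries //.
apply: eq_eseriesr => l _.
under eq_integral do rewrite EFinM.
rewrite ge0_integralZl //.
- by rewrite iid_second_moment mule1.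
- by apply/measurable_EFinP; exact: measurable_funX.
- by move=> w _; rewrite lee_fin sqr_ge0.
- by rewrite lee_fin.
Qed.

End Expectation.

(** * The expectation of the limit law *)

Section Assembly.
Context {R : realType} {d : nat} {sigma : R} (sigma0 : 0 < sigma).
Context {H : rkhs (@gauss_kernel R d sigma)}.
Context (m0 : 'cV[R]_d) (A : 'M[R]_d).
Context {G : probability (borel_cV R d) R} (Gstd : std_gaussian G).
Context {N : probability (borel_cV R d) R}.
Hypothesis NG : forall E : set (borel_cV R d), measurable E ->
  N E = G [set z : 'cV[R]_d | E (m0 + A *m z)].

Let phi := affine_map m0 A.
Let mphi : measurable_fun setT phi := measurable_affine_map m0 A.

Definition embedded_feature (w : 'cV[R]_d) : rkhs_vec H :=
  frame_feature (c := @hermite_weight R d) sigma0 mphi (@measurable_hermite R d)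
    (hermite_sqr_integrable Gstd) (phi w) (fun j => hermite j w).

(** A measurable choice of a preimage under the affine map. *)
Definition affine_lift (x : borel_cV R d) : borel_cV R d := pinvmx A *m (x - m0).

Definition vec_feature (x : borel_cV R d) : rkhs_vec H :=
  embedded_feature (affine_lift x).

Definition affine_range : set (borel_cV R d) := [set x | phi (affine_lift x) = x].

Lemma affine_liftK w : affine_range (phi w).
Proof.
have P : A *m (pinvmx A *m (A *m w)) = A *m w.
  by rewrite (mulmxA (pinvmx A)) mulmxA (mulmxA A) (mulmxKpV (submx_refl A)).
rewrite /affine_range /= /affine_lift /phi /affine_map.
have -> : m0 + A *m w - m0 = A *m w by rewrite addrC addKr.
by rewrite P.
Qed.

Lemma measurable_affine_lift : measurable_fun setT affine_lift.
Proof.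
have -> : affine_lift = fun x : borel_cV R d =>
    (- (pinvmx A *m m0) + pinvmx A *m x : borel_cV R d).
  by apply/funext => x; rewrite /affine_lift mulmxBr addrC.
exact: measurable_affine_map.
Qed.

Lemma measurable_affine_range : measurable affine_range.
Proof.
have -> : affine_range = \bigcap_(i in [set: 'I_d])
    ((fun x : borel_cV R d => (phi (affine_lift x) : 'cV[R]_d) i 0 - (x : 'cV[R]_d) i 0)
      @^-1` [set 0]).
  apply/seteqP; split=> x /= Hx.
    by move=> i _ /=; rewrite Hx subrr.
  by apply/colP => i; apply/subr0_eq; exact: Hx.
apply: fin_bigcap_measurable; first exact: finite_finset.
move=> i _; rewrite -[X in measurable X]setTI.
apply: (measurable_funB _ _) => //; last exact: measurable_coord.
exact: (measurableT_comp (measurable_coord i)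
  (measurableT_comp mphi measurable_affine_lift)).
Qed.

Lemma affine_range_conull : N (~` affine_range) = 0%E.
Proof.
rewrite NG; last exact: measurableC measurable_affine_range.
rewrite [X in G X](_ : _ = set0) ?measure0 //.
by apply/seteqP; split => // w /=; apply; exact: affine_liftK.
Qed.

Lemma embedded_featureE w :
  rkhs_val (embedded_feature w) = feature sigma m0 (A *m A^T) (phi w).
Proof. exact: feature_frame. Qed.

Lemma vec_featureE x : affine_range x ->
  rkhs_val (vec_feature x) = feature sigma m0 (A *m A^T) x.
Proof. by move=> xr; rewrite /vec_feature embedded_featureE xr. Qed.

Lemma vec_feature_phi w : vec_feature (phi w) = embedded_feature w.
Proof.
have E := vec_featureE (affine_liftK w).
apply: val_inj; exact: etrans E (esym (embedded_featureE w)).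
Qed.

Lemma measurable_vec_feature z :
  measurable_fun setT (fun x => rkhs_val (vec_feature x) z).
Proof.
have -> : (fun x => rkhs_val (vec_feature x) z) = (fun w : borel_cV R d =>
    gauss_kernel sigma z (phi w) - \sum_j (hermite_weight j * hermite j w) *
    rkhs_val (frame_rep (H := H) sigma0 mphi (@measurable_hermite R d)
       (hermite_sqr_integrable Gstd) j) z) \o affine_lift.
  apply/funext => x; rewrite [RHS]/comp /vec_feature /embedded_feature /frame_feature.
  rewrite -vip_kvec (psdBl (vip_hilbert H)) vip_kvec kvecE.
  rewrite (psd_suml (vip_hilbert H)); congr (_ - _).
  by apply: eq_bigr => j _; rewrite (psdZl (vip_hilbert H)) vip_kvec.
apply: measurableT_comp measurable_affine_lift; apply: measurable_funB.
  exact: (measurableT_comp (measurable_gauss_kernel z) mphi).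
apply: measurable_sum => j; apply: measurable_funM => //.
by apply: measurable_funM => //; exact: measurable_hermite.
Qed.

Lemma integral_image (f : borel_cV R d -> R) : measurable_fun setT f ->
  G.-integrable setT (EFin \o (f \o phi)) ->
  N.-integrable setT (EFin \o f) /\ \int[N]_x f x = \int[G]_w f (phi w).
Proof.
move=> mf iG; have mfE : measurable_fun setT (EFin \o f) by exact/measurable_EFinP.
have E (g : borel_cV R d -> \bar R) : (\int[N]_x g x = \int[pushforward G phi]_x g x)%E.
  by apply: eq_measure_integral => B mB _; exact: NG.
have ip := integrable_pushforward mphi mfE iG measurableT.
split.
  by apply/integrableP; split => //; rewrite E; have /integrableP[] := ip.
by rewrite /Rintegral E (integral_pushforward mphi mfE iG measurableT).
Qed.

(** [vec_feature] is a measurable family of vectors that agrees with the feature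
    map on [affine_range], which carries all the mass of [N]; the integral
    operator with kernel [vip (vec_feature x) (vec_feature y)] therefore agrees
    with [Sk] almost everywhere. *)
Lemma sum_Sk_eigenvalues (lambda : nat -> R) :
  eigenvalue_sequence N (Sk H m0 (A *m A^T) N) lambda ->
  (forall l, 0 <= lambda l) /\
  (\sum_(0 <= l <oo) (lambda l)%:E =
    (\int[G]_w vip (embedded_feature w) (embedded_feature w))%:E)%E.
Proof.
move=> lamP; have hP := vip_hilbert H.
have bP := rkhs_basis_on (H := H); have bT := rkhs_basis_total (H := H) sigma0.
have mFb := measurable_basis measurable_vec_feature.
have mFF := measurable_sqnorm hP bP bT mFb.
have iG : G.-integrable setT (EFin \o ((fun x => vip (vec_feature x) (vec_feature x)) \o phi)).
  rewrite (_ : _ \o phi = fun w => vip (embedded_feature w) (embedded_feature w)).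
    exact: (integral_feature_sqnorm (H := H) sigma0 m0 A Gstd).1.
  by apply/funext => w; rewrite /comp vec_feature_phi.
have [iN EN] := integral_image mFF iG.
have FFoo : (\int[N]_x (vip (vec_feature x) (vec_feature x))%:E < +oo)%E.
  by rewrite -(Rintegral_EFin iN) ltry.
have AE g : g \in Lfun N 2%:E -> {ae N, forall x, Sk H m0 (A *m A^T) N g x =
    \int[N]_y (vip (vec_feature x) (vec_feature y) * g y)}.
  move=> _; exists (~` affine_range); split.
  - exact: measurableC measurable_affine_range.
  - exact: affine_range_conull.
  - move=> x /= Hx xr; apply: Hx; rewrite /Sk.
    apply: (Rintegral_conull measurable_affine_range affine_range_conull) => y yr.
    by rewrite /vip !vec_featureE.
have [lam0 ->] := sum_eigenvalues hP bP bT mFb FFoo AE lamP.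
split => //; rewrite /cov_trace EN; congr EFin.
by apply: eq_Rintegral => w _; rewrite vec_feature_phi.
Qed.

End Assembly.

Theorem proposition1 (R : realType) (d : nat) (sigma : R) (sigma_gt0 : 0 < sigma)
  (m0 : 'cV[R]_d) (Sigma0 : 'M[R]_d) (Sigma0_cov : covariance_matrix Sigma0)
  (N : probability (borel_cV R d) R) (N_gaussian : gaussian m0 Sigma0 N)
  (H : rkhs (@gauss_kernel R d sigma))
  (lambda : nat -> R)
  (lambda_eigen : eigenvalue_sequence N (Sk H m0 Sigma0 N) lambda)
  (disp : measure_display) (Omega : measurableType disp)
  (P : probability Omega R)
  (Zl : nat -> {RV P >-> R}) (Zl_iid : iid_std_normal Zl)
  (Z : {RV P >-> R})
  (Z_series : {ae P, forall w,
     \sum_(0 <= l < n) lambda l * Zl l w ^+ 2 @[n --> \oo] --> Z w}) :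
  let V : 'M[R]_d := 1%:M + (2 * sigma) *: Sigma0 in
  let W : 'M[R]_d := invmx (V + (2 * sigma) *: Sigma0) *m Sigma0 in
  'E_P[Z]%E =
  (1 - (Num.sqrt (\det (2 *: V - 1%:M)))^-1 *
       (1 + 2 * sigma * \tr W
        + 2 * sigma ^+ 2 * (\tr W) ^+ 2
        + 4 * sigma ^+ 2 * \tr (W *m W)))%:E.
Proof.
have [A [G [AA Gstd NG]]] := N_gaussian.
move: lambda_eigen; rewrite -AA => lamP V W.
have [lam0 lamE] := sum_Sk_eigenvalues (H := H) sigma_gt0 Gstd NG lamP.
rewrite (expectation_weighted_squares Zl_iid lam0 Z_series) lamE.
by rewrite (integral_feature_sqnorm (H := H) sigma_gt0 m0 A Gstd).2.
Qed.
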